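(* Let $s\in(0,1)$, $a=1-2s$ and $N\geq 2$. Let $(u,v)$ be a positive solution of $$\begin{cases} \mathrm{div}(y^a\nabla u)=\mathrm{div}(y^a\nabla v)=0, &\text{in } \mathbb{R}^{N+1}_+,\\ u,v>0, &\text{in } \overline{\mathbb{R}^{N+1}_+},\\ \lim_{y\to0^+}y^a\frac{\partial u}{\partial y}=uv^2,\quad \lim_{y\to0^+}y^a\frac{\partial v}{\partial y}=vu^2, &\text{on } \partial\mathbb{R}^{N+1}_+=\mathbb{R}^N\times\{0\}. \end{cases}$$ Then there exists a constant $c>0$ such that $$u(x,y)+v(x,y)\leq c\left(1+|x|^2+y^2\right)^{s}\qquad\text{for all }(x,y)\in\overline{\mathbb{R}^{N+1}_+}.$$
   Context: Points of $\mathbb{R}^{N+1}_+$ are written $z=(x,y)$ with $x\in\mathbb{R}^N$, $y>0$; $B_r^+=\{z\in\mathbb{R}^{N+1}_+:|z|<r\}$. For $\Omega\subset\mathbb{R}^{N+1}_+$, $H^{1;a}(\Omega)=\{u:\Omega\to\mathbb{R}:\int_\Omega y^a(|u|^2+|\nabla u|^2)<+\infty\}$, and $H^{1;a}_{loc}(\overline{\mathbb{R}^{N+1}_+})$ is the set of $u:\mathbb{R}^{N+1}_+\to\mathbb{R}$ with $u|_{B_r^+}\in H^{1;a}(B_r^+)$ for all $r>0$. Solutions are understood in the weak sense: $u,v\in H^{1;a}_{loc}(\overline{\mathbb{R}^{N+1}_+})$, continuous on $\overline{\mathbb{R}^{N+1}_+}$, with $$\int_{\mathbb{R}^{N+1}_+}y^a\nabla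 u\cdot\nabla\phi+\int_{\mathbb{R}^N}uv^2\phi\,dx=0,\qquad \int_{\mathbb{R}^{N+1}_+}y^a\nabla v\cdot\nabla\phi+\int_{\mathbb{R}^N}vu^2\phi\,dx=0$$ for all $\phi\in C^\infty_c(\overline{\mathbb{R}^{N+1}_+})$. (This system is the Caffarelli–Silvestre extension of $-(-\Delta)^su=uv^2$, $-(-\Delta)^sv=vu^2$ in $\mathbb{R}^N$.) *)

(* Defs.v *)
From HB Require Import structures.
From mathcomp Require Import all_boot all_order all_algebra.
From mathcomp Require Import all_classical all_reals all_analysis.

Set Implicit Arguments.
Unset Strict Implicit.
Unset Printing Implicit Defensive.

Import Order.TTheory GRing.Theory Num.Theory.
Import numFieldNormedType.Exports.

Local Open Scope classical_set_scope.
Local Open Scope ring_scope.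

(* The sigma-algebra of R^n generated by the coordinates, that is, the Borel
   sigma-algebra. *)
Section measurable_rV.
Context {R : realType} (n : nat).

Let coord (i : 'I_n) (x : 'rV[R]_n) : R := x ord0 i.

Let rV_set0 : g_sigma_preimage coord set0.
Proof. exact: sigma_algebra0. Qed.

Let rV_setC A : g_sigma_preimage coord A -> g_sigma_preimage coord (~` A).
Proof. exact: sigma_algebraC. Qed.

Let rV_bigcup (F : _^nat) : (forall i, g_sigma_preimage coord (F i)) ->
  g_sigma_preimage coord (\bigcup_i (F i)).
Proof. exact: sigma_algebra_bigcup. Qed.

HB.instance Definition _ :=
  @isMeasurable.Build (measure_tuple_display default_measure_display)
    'rV[R]_n (g_sigma_preimage coord) rV_set0 rV_setC rV_bigcup.

Lemma measurable_coord (i : 'I_n) :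
  measurable_fun [set: 'rV[R]_n] (fun x : 'rV[R]_n => x ord0 i).
Proof.
move=> _ Y mY; rewrite setTI; apply: sub_sigma_algebra => /=.
rewrite -bigcup_seq/=; exists i => /=; first by rewrite mem_index_enum.
by exists Y => //; rewrite setTI.
Qed.

Lemma measurable_fun_rVP d (T : measurableType d) (f : T -> 'rV[R]_n) :
  (forall i, measurable_fun [set: T] (fun t => f t ord0 i)) ->
  measurable_fun [set: T] f.
Proof.
move=> mf _ A mA; rewrite setTI; move: A mA.
suff : g_sigma_preimage coord `<=` [set A | measurable (f @^-1` A)] by apply.
apply: smallest_sub.
  split=> [|A mA|F mF] /=.
  - by rewrite preimage_set0.
  - rewrite setTD preimage_setC; exact: measurableC.
  - by rewrite preimage_bigcup; apply: bigcup_measurable => k _; exact: mF.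
rewrite -bigcup_seq => A [i _] [B mB <-] /=.
rewrite setTI; have := mf i measurableT B mB.
by rewrite setTI.
Qed.

End measurable_rV.

Definition cons_rV (R : realType) (n : nat) (p : R * 'rV[R]_n) : 'rV[R]_n.+1 :=
  row_mx (p.1%:M : 'rV[R]_1) p.2.

Section lebesgue_rV.
Context {R : realType}.

Lemma cons_rV0 n (p : R * 'rV[R]_n) : cons_rV p ord0 ord0 = p.1.
Proof.
have -> : ord0 = lshift n (ord0 : 'I_1) by apply/val_inj.
by rewrite /cons_rV (row_mxEl (p.1%:M : 'rV_1)) mxE.
Qed.

Lemma cons_rVS n (p : R * 'rV[R]_n) i : cons_rV p ord0 (lift ord0 i) = p.2 ord0 i.
Proof.
have -> : lift ord0 i = rshift 1 i by apply/val_inj.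
by rewrite /cons_rV (row_mxEr (p.1%:M : 'rV_1)).
Qed.

Lemma measurable_cons_rV n : measurable_fun setT (@cons_rV R n).
Proof.
apply: measurable_fun_rVP => i; have [->|[j ->]] : i = ord0 \/ exists j, i = lift ord0 j.
  by case: (unliftP ord0 i) => [j ->|->]; [right; exists j|left].
- by under eq_fun do rewrite cons_rV0; exact: measurable_fst.
- under eq_fun do rewrite cons_rVS.
  apply: (measurableT_comp (measurable_coord j)); exact: measurable_snd.
Qed.

Definition uncons_rV n (x : 'rV[R]_n.+1) : R * 'rV[R]_n :=
  (x ord0 ord0, \row_i x ord0 (lift ord0 i)).

Lemma cons_rVK n : cancel (@cons_rV R n) (@uncons_rV n).
Proof.
move=> [t x]; rewrite /uncons_rV cons_rV0; congr pair.
by apply/rowP => i; rewrite mxE cons_rVS.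
Qed.

Lemma measurable_uncons_rV n : measurable_fun setT (@uncons_rV n).
Proof.
apply/measurable_fun_pair; first exact: measurable_coord.
apply: measurable_fun_rVP => i; under eq_fun do rewrite mxE.
exact: measurable_coord.
Qed.

Section step.
Context (n : nat) (mu : {sigma_finite_measure set 'rV[R]_n -> \bar R}).
Local Open Scope ereal_scope.

Definition lebesgue_rV_step : set 'rV[R]_n.+1 -> \bar R :=
  pushforward (lebesgue_measure \x mu) (@cons_rV R n).

Let step0 : lebesgue_rV_step set0 = 0.
Proof. by rewrite /lebesgue_rV_step /pushforward preimage_set0 measure0. Qed.

Let step_ge0 A : 0 <= lebesgue_rV_step A.
Proof. exact: (measure_ge0 (lebesgue_measure \x mu)). Qed.

Let step_sigma_additive : semi_sigma_additive lebesgue_rV_step.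
Proof.
apply: measure_semi_sigma_additive; exact: measurable_cons_rV.
Qed.

HB.instance Definition _ := isMeasure.Build _ _ _ lebesgue_rV_step
  step0 step_ge0 step_sigma_additive.

Let step_sigma_finite : sigma_finite setT lebesgue_rV_step.
Proof.
have [F FT Foo] : sigma_finite setT (lebesgue_measure \x mu).
  have /sigma_finiteP[F [TF ndF Foo]] := sigma_finiteT (@lebesgue_measure R).
  have /sigma_finiteP[G [TG ndG Goo]] := sigma_finiteT mu.
  exists (fun k => F k `*` G k).
    rewrite -setXTT TF TG predeqE => -[x y]; split=> [[[k _ Fkx] [l _ Gly]]|].
      exists (maxn k l) => //; split.
      - by move: {Gly} x Fkx; exact/subsetPset/ndF/leq_maxl.
      - by move: {Fkx} y Gly; exact/subsetPset/ndG/leq_maxr.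
    by move=> [k _ [? ?]]; split; exists k.
  move=> k; have [? ?] := Foo k; have [? ?] := Goo k.
  split; first exact: measurableX.
  by rewrite product_measure1E// lte_mul_pinfty// ge0_fin_numE.
exists (fun k => @uncons_rV n @^-1` F k).
  by rewrite -preimage_bigcup -FT preimage_setT.
move=> k; have [mF Fk] := Foo k; split.
  by rewrite -[X in measurable X]setTI; exact: measurable_uncons_rV.
rewrite /lebesgue_rV_step /pushforward -comp_preimage.
by rewrite (_ : _ \o _ = id)//; apply/funext => p; exact: cons_rVK.
Qed.

HB.instance Definition _ := Measure_isSigmaFinite.Build _ _ _
  lebesgue_rV_step step_sigma_finite.

End step.

Fixpoint lebesgue_rV (n : nat) : {sigma_finite_measure set 'rV[R]_n -> \bar R} :=
  match n with
  | 0%N => dirac (0 : 'rV[R]_0)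
  | m.+1 => lebesgue_rV_step (lebesgue_rV m)
  end.

Lemma measurable_box n (A : 'I_n -> set R) :
  (forall i, measurable (A i)) ->
  measurable [set x : 'rV[R]_n | forall i, A i (x ord0 i)].
Proof.
move=> mA.
rewrite (_ : mkset _ = \big[setI/setT]_(i < n) ((fun x : 'rV[R]_n => x ord0 i) @^-1` A i)).
  apply: big_ind => // [|i _]; first exact: measurableI.
  by rewrite -[X in measurable X]setTI; exact: measurable_coord.
rewrite -bigcap_seq; apply/seteqP; split => [x Ax i _|x Ax i]; first exact: Ax.
by apply: Ax => /=; rewrite mem_index_enum.
Qed.

Lemma lebesgue_rV_box n (A : 'I_n -> set R) : (forall i, measurable (A i)) ->
  (lebesgue_rV n [set x | forall i, A i (x ord0 i)] =
   \prod_(i < n) lebesgue_measure (A i))%E.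
Proof.
elim: n A => [|n IHn] A mA.
  rewrite big_ord0 /= diracE mem_set//= => -[].
  by [].
rewrite big_ord_recl -IHn//= /lebesgue_rV_step /pushforward.
rewrite -product_measure1E; first last.
- by apply: (@measurable_box n (fun i => A (lift ord0 i))) => i; exact: mA.
- exact: mA.
congr (product_measure1 _ _ _); apply/seteqP; split => [p Ap|p [Ap1 Ap2] i] /=.
  split; first by have := Ap ord0; rewrite cons_rV0.
  by move=> i; have := Ap (lift ord0 i); rewrite cons_rVS.
case: (unliftP ord0 i) => [j ->|->]; last by rewrite cons_rV0.
by rewrite cons_rVS; exact: Ap2.
Qed.

End lebesgue_rV.

(* Points z = (x, y) of R^(N+1) are pairs in 'rV[R]_N * R. The library norm of
   such a pair is a maximum, hence the separate Euclidean norm. *)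
Section half_space.
Context {R : realType} {N : nat}.
Local Notation E := ('rV[R]_N * R)%type.
Implicit Types (z w : E) (u v phi : E -> R) (g : E -> E) (Omega : set E).

Definition lebesgue_pt := (lebesgue_rV N \x @lebesgue_measure R)%E.

HB.instance Definition _ := Measure.on lebesgue_pt.

Definition dot z w : R := \sum_(i < N) z.1 ord0 i * w.1 ord0 i + z.2 * w.2.

Definition enorm z : R := Num.sqrt (dot z z).

Definition half_space : set E := [set z | 0 < z.2].

Definition closed_half_space : set E := [set z | 0 <= z.2].

Definition half_ball (r : R) : set E := [set z | 0 < z.2 /\ enorm z < r].

Definition grad phi z : E :=
  (\row_(i < N) 'D_((delta_mx ord0 i, 0) : E) phi z, 'D_((0, 1) : E) phi z).

(* Derivatives of all orders, in all directions, exist and are continuous. *)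
Definition smooth phi := forall ws : seq E,
  let psi := foldr (fun w (f : E -> R) => 'D_w f : E -> R) phi ws in
  continuous psi /\ forall z w, derivable psi z w.

(* phi is in C^oo_c(Omega), for Omega open. *)
Definition test_function Omega phi :=
  let supp := closure [set z | phi z != 0] in
  [/\ smooth phi, compact supp & supp `<=` Omega].

Definition loc_integrable Omega (f : E -> R) := forall K : set E,
  compact K -> K `<=` Omega -> lebesgue_pt.-integrable K (EFin \o f).

(* g is the distributional gradient of u in the open set Omega. *)
Definition weak_grad Omega u g :=
  [/\ loc_integrable Omega u,
      forall w, loc_integrable Omega (fun z => dot (g z) w) &
      forall phi w, test_function Omega phi ->
        \int[lebesgue_pt]_(z in Omega) (u z * 'D_w phi z) =
        - \int[lebesgue_pt]_(z in Omega) (dot (g z) w * phi z)].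

Definition H1a (a : R) Omega u := exists g, weak_grad Omega u g /\
  (\int[lebesgue_pt]_(z in Omega)
     (z.2 `^ a * (u z ^+ 2 + dot (g z) (g z)))%:E < +oo)%E.

Definition H1a_loc (a : R) u := forall r : R, 0 < r -> H1a a (half_ball r) u.

(* Elements of C^oo_c of the closed half-space are taken to be the restrictions
   of the elements of C^oo_c(R^(N+1)), hence the test functions on setT. *)
Definition weak_equation (a : R) u v := exists g, weak_grad half_space u g /\
  forall phi, test_function setT phi ->
    \int[lebesgue_pt]_(z in half_space) (z.2 `^ a * dot (g z) (grad phi z)) +
    \int[lebesgue_rV N]_x (u (x, 0) * v (x, 0) ^+ 2 * phi (x, 0)) = 0.

(* u and v are total functions, but only their values on the closed half-space
   matter. *)
Definition weak_solution (a : R) u v :=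
  [/\ H1a_loc a u /\ H1a_loc a v,
      {within closed_half_space, continuous u},
      {within closed_half_space, continuous v},
      weak_equation a u v & weak_equation a v u].

End half_space.

(* Main.v *)
Require Import Defs.
From HB Require Import structures.
From mathcomp Require Import all_boot all_order all_algebra.
From mathcomp Require Import all_classical all_reals all_analysis.
From mathcomp Require Import measurable_realfun.
From mathcomp Require Import ring lra.
Import Order.TTheory GRing.Theory Num.Theory.
Import numFieldNormedType.Exports.
Local Open Scope classical_set_scope.
Local Open Scope ring_scope.

(** The functions u and v are bounded separately, each through its positivity and
    its own equation. Write L for the operator f |-> y^-a div(y^a grad f). Testing
    the weak equation against phi and moving the derivatives from u to phi gives,
    for phi smooth with compact support, nonnegative and with zero normal
    derivative on {y = 0},
      int_{y > 0} u y^a L phi = int_{y = 0} u v^2 phi >= 0      (subsolution_test).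
    Hence, if L phi <= K 1_S - c 1_T, then c m(T) <= K m(S) for the weighted mass
    m(S) = int_S y^a u, and, as L is homogeneous, the same holds for the images
    of S and T under z |-> x0 + l z (mass_comparison). Every estimate below is
    this inequality for an explicit phi.

    Let d = N + 1 + a, the homogeneity of m. Three kernels are needed.

    - interior_kernel: a regularised Newtonian potential with pole (0,1). Its image
      under L is about -eps^-(N+1) on a box of size eps around the pole and bounded
      above elsewhere.
      As eps tends to 0 the mass of the box yields the value of u at the pole:
      u(x0, y0) y0^d <= C m(ball of radius y0/8 about (x0, y0))  (interior_bound).

    - boundary_kernel: (|z|^2 + eps^2)^(1 - d/2) is the regularised fundamental
      solution of L with pole at a boundary point; a correction near {y = 0} makes
      it compare a small half ball with a region that stays away from {y = 0}:
      m(B_(eps l)) <= C eps^d m({z in B_(4 l) : y > dl l})      (boundary_bound).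

    - decay_kernel: y^(2s) is a solution of L vanishing on {y = 0}, and its Kelvin
      transform is y^(2s) |z|^(2 - D), D = N + 2 + 2s. A regularisation w of it at
      scale 1/l is truncated by -G(w - b), where b is a constant and G is convex
      and zero on the negative half line; this removes both the boundary and the
      exterior of a large ball. The concentration of L w near the origin has size
      l^(N + 2) only, so
      m({z in B_(6 l) : y > dl l}) <= C l^(N + 2)               (decay_bound).

    For l a large multiple of (1 + |x0|^2 + y0^2)^(1/2) and eps = 2 y0 / l the three
    bounds chain to
      u(x0, y0) <= C y0^-d (y0 / l)^d l^(N + 2) = C l^(N + 2 - d) = C l^(2s),
    which is the claim for y0 > 0; continuity gives it for y0 = 0. The exponent is
    thus the difference between the growth N + 2 allowed by the Kelvin transform
    of y^(2s) and the homogeneity d = N + 2 - 2s of the mass. *)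

Set Implicit Arguments.
Unset Strict Implicit.
Unset Printing Implicit Defensive.

(** * Functions of class C^n on an open set *)

Section Cn.
Context {R : realType} {V : normedModType R}.
Implicit Types (U : set V) (f g : V -> R).

(** Smoothness of test functions is defined by iterated directional derivatives;
    an open set is carried along because powers and inverses are smooth for t > 0 only. *)
Fixpoint Cn (n : nat) (U : set V) (f : V -> R) : Prop :=
  (forall z, U z -> {for z, continuous f}) /\
  (if n is m.+1 then
     forall w, (forall z, U z -> derivable f z w) /\ Cn m U ('D_w f)
   else True).

Lemma Cn_continuous n U f z : Cn n U f -> U z -> {for z, continuous f}.
Proof. by case: n => [|n] [h _]; exact: h. Qed.

Lemma Cn_derivable n U f z w : Cn n.+1 U f -> U z -> derivable f z w.
Proof. by move=> [_ /(_ w)[+ _]]; exact. Qed.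

Lemma CnD n U f w : Cn n.+1 U f -> Cn n U ('D_w f).
Proof. by move=> [_ /(_ w)[_]]. Qed.

Lemma CnW n U f : Cn n.+1 U f -> Cn n U f.
Proof.
elim: n f => [|n IHn] f [cf df]; split=> // w; split; first exact: (df w).1.
exact: IHn (df w).2.
Qed.

Lemma Cn_sub n U U' f : U' `<=` U -> Cn n U f -> Cn n U' f.
Proof.
move=> sU; elim: n f => [|n IHn] f [cf df]; (split; first by move=> z /sU /cf) => //.
move=> w; split; first by move=> z /sU; exact: (df w).1.
exact: IHn (df w).2.
Qed.

Lemma Cn_setU n U U' f : Cn n U f -> Cn n U' f -> Cn n (U `|` U') f.
Proof.
elim: n f => [|n IHn] f [cf df] [cf' df']; split => //.
- by move=> z [/cf|/cf'].
- by move=> z [/cf|/cf'].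
- move=> w; split; first by move=> z [/(df w).1|/(df' w).1].
  by apply: IHn; [exact: (df w).2|exact: (df' w).2].
Qed.

Lemma open_near U z (P : V -> Prop) : open U -> U z -> (forall x, U x -> P x) ->
  \forall x \near z, P x.
Proof. by move=> oU Uz h; apply: filterS (open_nbhs_nbhs (conj oU Uz)). Qed.

Lemma Cn_eq n U f g : open U -> (forall z, U z -> f z = g z) ->
  Cn n U f -> Cn n U g.
Proof.
move=> oU; elim: n f g => [|n IHn] f g fg [cf df].
- split=> // z Uz; have := cf _ Uz.
  rewrite /prop_for /continuous_at -(fg _ Uz); apply: cvg_trans.
  by apply: near_eq_cvg; apply: open_near fg.
- split=> [z Uz|w].
    have := cf _ Uz; rewrite /prop_for /continuous_at -(fg _ Uz); apply: cvg_trans.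
    by apply: near_eq_cvg; apply: open_near fg.
  split=> [z Uz|].
    apply: (near_eq_derivable _ ((df w).1 _ Uz)).
    by apply: open_near fg.
  apply: IHn (df w).2 => z Uz; apply: near_eq_derive.
  exact: open_near fg.
Qed.

Lemma Cn_cst n U (c : R) : open U -> Cn n U (fun=> c).
Proof.
move=> oU; elim: n c => [|n IHn] c; (split; first by move=> z _; exact: cvg_cst) => //.
move=> w; split=> [z _|]; first exact: derivable_cst.
by apply: Cn_eq (IHn 0) => // z _; rewrite (@derive_cst _ V R c z w).
Qed.

Lemma Cn_add n U f g : open U -> Cn n U f -> Cn n U g ->
  Cn n U (fun z => f z + g z).
Proof.
move=> oU; elim: n f g => [|n IHn] f g [cf df] [cg dg].
  by split=> // z Uz; apply: cvgD; [exact: cf|exact: cg].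
split=> [z Uz|w]; first by apply: cvgD; [exact: cf|exact: cg].
split=> [z Uz|].
  by apply: (@derivableD _ _ _ f g); [exact: (df w).1|exact: (dg w).1].
apply: Cn_eq (IHn _ _ (df w).2 (dg w).2) => // z Uz.
by rewrite -deriveD//; [exact: (df w).1|exact: (dg w).1].
Qed.

Lemma Cn_mul n U f g : open U -> Cn n U f -> Cn n U g ->
  Cn n U (fun z => f z * g z).
Proof.
move=> oU; elim: n f g => [|n IHn] f g Cf Cg.
  by split=> // z Uz; apply: cvgM; [exact: Cf.1|exact: Cg.1].
split=> [z Uz|w]; first by apply: cvgM; [exact: Cf.1|exact: Cg.1].
split=> [z Uz|].
  by apply: (@derivableM _ _ f g); [exact: Cn_derivable Cf _|exact: Cn_derivable Cg _].
apply: (Cn_eq (f := fun z => f z * 'D_w g z + g z * 'D_w f z)) => // [z Uz|].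
  by rewrite -deriveM//; [exact: Cn_derivable Cf _|exact: Cn_derivable Cg _].
by apply: Cn_add => //; apply: IHn; (exact: CnW || exact: CnD).
Qed.

Lemma Cn_opp n U f : open U -> Cn n U f -> Cn n U (fun z => - f z).
Proof.
move=> oU Cf; apply: (Cn_eq (f := fun z => -1 * f z)) => // [z _|].
  by rewrite mulN1r.
by apply: Cn_mul => //; exact: Cn_cst.
Qed.

Lemma Cn_sum n U (I : Type) (s : seq I) (f : I -> V -> R) : open U ->
  (forall i, Cn n U (f i)) -> Cn n U (fun z => \sum_(i <- s) f i z).
Proof.
move=> oU Cf; elim: s => [|i s IHs].
  by apply: (Cn_eq (f := fun=> 0)) => [//|z _|]; [rewrite big_nil|exact: Cn_cst].
apply: (Cn_eq (f := fun z => f i z + \sum_(i <- s) f i z)) => [//|z _|].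
  by rewrite big_cons.
exact: Cn_add.
Qed.

Lemma Cn_linear n U (f : {linear V -> R}) : open U -> continuous f -> Cn n U f.
Proof.
move=> oU cf; case: n => [|n]; (split; first by move=> z _; exact: cf) => //.
move=> w; have df z : 'D_w f z = f w.
  by rewrite deriveE ?(diff_lin)//; exact: linear_differentiable.
split=> [z _|]; first by apply: diff_derivable; exact: linear_differentiable.
by apply: (Cn_eq (f := fun=> f w)) => [//|z _|]; [rewrite df|exact: Cn_cst].
Qed.

End Cn.

Section Cn_comp.
Context {R : realType} {V : normedModType R}.
Implicit Types (U : set V) (f g : V -> R).

Lemma derive_line f z w : 'D_w f z = 'D_1 (fun t : R => f (t *: w + z)) 0.
Proof.
rewrite /derive; set g1 := fun h => h^-1 *: _; set g2 := fun h => h^-1 *: _.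
suff -> : g1 = g2 by [].
by rewrite funeqE /g1 /g2 => h /=; rewrite addr0 scale0r add0r [_%:A]mulr1.
Qed.

(** A directional derivative is an ordinary derivative along a line, which reduces
    the chain rule to its one-variable form. *)
Lemma is_derive_comp1 (h : R -> R) f z w : derivable f z w ->
  derivable h (f z) 1 ->
  is_derive z w (fun x => h (f x)) ('D_1 h (f z) * 'D_w f z).
Proof.
move=> df dh.
have [F EF] : exists F, F = (fun t : R => f (t *: w + z)) by eexists.
have dF : derivable F 0 1 by rewrite EF; exact: ((derivable1P _ _ _).1 df).
have F0 : F 0 = f z by rewrite EF scale0r add0r.
have dh0 : derivable h (F 0) 1 by rewrite F0.
have EhF : (fun t : R => h (f (t *: w + z))) = h \o F by rewrite EF.
apply: DeriveDef.
  apply: ((derivable1P _ _ _).2); rewrite EhF; apply/derivable1_diffP.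
  apply: differentiable_comp; first exact: (derivable1_diffP F 0).1 dF.
  exact: (derivable1_diffP h (F 0)).1 dh0.
rewrite (derive_line (fun x => h (f x))) (derive_line f) -EF EhF -!derive1E -F0.
exact: derive1_comp dF dh0.
Qed.

Lemma Cn_comp n U (I : set R) (h : R -> R) f : open U -> open I ->
  Cn n I h -> Cn n U f -> (forall z, U z -> I (f z)) ->
  Cn n U (fun x => h (f x)).
Proof.
move=> oU oI; elim: n h f => [|n IHn] h f Ch Cf UI.
  split=> // z Uz; apply: continuous_comp; first exact: Cn_continuous Cf Uz.
  exact: Cn_continuous Ch (UI _ Uz).
split=> [z Uz|w].
  apply: continuous_comp; first exact: Cn_continuous Cf Uz.
  exact: Cn_continuous Ch (UI _ Uz).
have D z (Uz : U z) :
    is_derive z w (fun x => h (f x)) ('D_1 h (f z) * 'D_w f z).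
  apply: is_derive_comp1; first exact: Cn_derivable Cf Uz.
  exact: Cn_derivable Ch (UI _ Uz).
split=> [z Uz|]; first by have [] := D z Uz.
apply: (Cn_eq (f := fun z => 'D_1 h (f z) * 'D_w f z)) => // [z Uz|].
  by have [_ ->] := D z Uz.
apply: Cn_mul => //; last exact: CnD.
by apply: (IHn ('D_1 h) f) => //; [exact: CnD|exact: CnW].
Qed.

Lemma Cn_inv n (I : set R) : open I -> (forall t, I t -> 0 < t) ->
  Cn n I (fun t : R => t^-1).
Proof.
move=> oI I0.
have cV t : I t -> {for t, continuous (fun t : R => t^-1)}.
  by move=> It; apply: inv_continuous; exact: lt0r_neq0 (I0 _ It).
elim: n => [|n IHn]; (split; first exact: cV) => // w.
split=> [t It|].
  by apply: (@derivableV _ _ id); [exact: lt0r_neq0 (I0 _ It)|exact: derivable_id].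
apply: (@Cn_eq R R _ _ (fun t => (- w) * (t^-1 * t^-1))) => // [t It|].
  rewrite (@deriveV _ _ id t w (lt0r_neq0 (I0 _ It))) ?derive_id//.
  by rewrite scaleNr /GRing.scale/= expr2 invfM; ring.
by apply: Cn_mul => //; [exact: Cn_cst|exact: Cn_mul].
Qed.

Lemma Cn_powR n (I : set R) (p : R) : open I -> (forall t, I t -> 0 < t) ->
  Cn n I (fun t : R => t `^ p).
Proof.
move=> oI I0; elim: n p => [|n IHn] p.
  split=> // t It; apply: differentiable_continuous; apply/derivable1_diffP.
  by have [] := is_derive1_powR p (I0 _ It).
split=> [t It|w].
  apply: differentiable_continuous; apply/derivable1_diffP.
  by have [] := is_derive1_powR p (I0 _ It).
have df t : I t -> differentiable (fun t : R => t `^ p) t.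
  by move=> It; apply/derivable1_diffP; have [] := is_derive1_powR p (I0 _ It).
split=> [t It|]; first by apply: diff_derivable; exact: df.
apply: (@Cn_eq R R _ _ (fun t => (w * p) * t `^ (p - 1))) => // [t It|].
  have [_ E] := is_derive1_powR p (I0 _ It).
  rewrite deriveE; last exact: df.
  rewrite -[w in 'd _ _ w]mulr1 linearZ/= -deriveE ?E; last exact: df.
  by rewrite /GRing.scale/= mulrA.
by apply: Cn_mul => //; exact: Cn_cst.
Qed.

Lemma derive1_scale (h : R -> R) (t w : R) : derivable h t 1 ->
  'D_w h t = w * 'D_1 h t.
Proof.
move=> dh; have dh' : differentiable h t by apply/derivable1_diffP.
by rewrite !deriveE// -[w in LHS]mulr1 linearZ.
Qed.

Lemma derivable1_all (h : R -> R) (t w : R) : derivable h t 1 -> derivable h t w.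
Proof. by move=> dh; apply: diff_derivable; apply/derivable1_diffP. Qed.

Lemma Cn1 n (I : set R) (h : R -> R) : open I ->
  (forall t, I t -> derivable h t 1) -> Cn n I ('D_1 h) -> Cn n.+1 I h.
Proof.
move=> oI dh Ch; split=> [t It|w].
  by apply: differentiable_continuous; apply/derivable1_diffP; exact: dh.
split=> [t It|]; first by apply: derivable1_all; exact: dh.
apply: (@Cn_eq R R _ _ (fun t => w * 'D_1 h t)) => // [t It|].
  by rewrite [RHS]derive1_scale//; exact: dh.
by apply: Cn_mul => //; exact: Cn_cst.
Qed.

End Cn_comp.

Section affine.
Context {R : realType} {V : normedModType R}.

Lemma is_derive_affine (f : V -> R) (l : R) (b z w : V) :
  derivable f (l *: z + b) w ->
  is_derive z w (fun x => f (l *: x + b)) (l * 'D_w f (l *: z + b)).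
Proof.
move=> df.
have [F EF] : exists F, F = (fun t : R => f (t *: w + (l *: z + b))) by eexists.
have dF : derivable F (l * 0) 1.
  by rewrite EF mulr0; exact: ((derivable1P _ _ _).1 df).
have E : (fun t : R => f (l *: (t *: w + z) + b)) = (fun t => F (l * t)).
  by apply/funext => t; rewrite EF scalerDr scalerA addrA.
have dl : is_derive (0 : R) 1 (fun t : R => l * t) l.
  by have := is_deriveZ l (is_derive_id (0 : R) 1); rewrite [_ *: 1]mulr1.
have dl1 : derivable (fun t : R => l * t) 0 1 by case: dl.
have [dc ec] := is_derive_comp1 dl1 dF.
apply: DeriveDef; first by apply: ((derivable1P _ _ _).2); rewrite E.
rewrite derive_line E ec mulr0 [X in _ * X](_ : _ = l); last by case: dl.
by rewrite mulrC EF -derive_line.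
Qed.

Lemma Cn_affine n (f : V -> R) (l : R) (b : V) : Cn n setT f ->
  Cn n setT (fun x => f (l *: x + b)).
Proof.
elim: n f => [|n IHn] f Cf.
  split=> // z _; apply: continuous_comp; last exact: Cn_continuous Cf _.
  by apply: cvgD; [apply: cvgZl_tmp; exact: cvg_id|exact: cvg_cst].
have D z w : is_derive z w (fun x => f (l *: x + b)) (l * 'D_w f (l *: z + b)).
  by apply: is_derive_affine; exact: Cn_derivable Cf I.
split=> [z _|w].
  apply: continuous_comp; last exact: Cn_continuous Cf _.
  by apply: cvgD; [apply: cvgZl_tmp; exact: cvg_id|exact: cvg_cst].
split=> [z _|]; first by have [] := D z w.
apply: (Cn_eq (f := fun z => l * 'D_w f (l *: z + b))) => // [|z _|].
- exact: openT.
- by have [_ ->] := D z w.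
- apply: Cn_mul; [exact: openT|apply: Cn_cst; exact: openT|].
  by apply: (IHn ('D_w f)); exact: CnD.
Qed.

End affine.

Lemma smoothP (R : realType) (N : nat) (phi : 'rV[R]_N * R -> R) :
  smooth phi <-> forall n, Cn n setT phi.
Proof.
have foldE (f : 'rV[R]_N * R -> R) (ws : seq ('rV[R]_N * R)) w :
    foldr (fun w (f : 'rV[R]_N * R -> R) => 'D_w f : 'rV[R]_N * R -> R) ('D_w f) ws =
    foldr (fun w (f : 'rV[R]_N * R -> R) => 'D_w f : 'rV[R]_N * R -> R) f (rcons ws w).
  by rewrite foldr_rcons.
split=> [|C].
  move=> sm n; elim: n phi sm => [|n IHn] phi sm.
    by split=> // z _; exact: (sm [::]).1.
  split=> [z _|w]; first exact: (sm [::]).1.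
  split=> [z _|]; first exact: (sm [::]).2.
  by apply: IHn => ws; rewrite foldE; exact: sm.
move=> ws; elim/last_ind: ws phi C => [|ws w IHw] phi C.
  split=> [z|z w]; first exact: (Cn_continuous (C 0%N) I).
  exact: (@Cn_derivable _ _ 0%N setT phi z w (C 1%N) I).
by rewrite -foldE; apply: IHw => n; apply: CnD; exact: C.
Qed.

(** * Flat functions and smooth steps *)

Section flat.
Context {R : realType}.
Implicit Types (t : R).

(** The family t^-k exp(-1/t), extended by 0, is closed under differentiation and is
    flat at 0; it yields every cut-off function below, as well as the convex function
    that truncates the third kernel. *)
Definition ek (k : nat) t : R := if 0 < t then t^-1 ^+ k * expR (- t^-1) else 0.

Lemma ek_le0 k t : t <= 0 -> ek k t = 0.
Proof. by move=> t0; rewrite /ek ltNge t0. Qed.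

Lemma ek_gt0 k t : 0 < t -> 0 < ek k t.
Proof. by move=> t0; rewrite /ek t0 mulr_gt0 ?expR_gt0// exprn_gt0// invr_gt0. Qed.

Lemma ek_ge0 k t : 0 <= ek k t.
Proof. by have [/ek_le0->//|/(ek_gt0 k)/ltW] := lerP t 0. Qed.

Lemma ekS k t : t * ek k.+1 t = ek k t.
Proof.
rewrite /ek; case: ifPn => [t0|_]; last by rewrite mulr0.
by rewrite exprS !mulrA mulfV ?mul1r// gt_eqF.
Qed.

Lemma ek_le k t : ek k t <= (k.+2)`!%:R * t ^+ 2.
Proof.
have [t0|t0] := lerP t 0; first by rewrite ek_le0// mulr_ge0// sqr_ge0.
rewrite /ek t0 expRN.
have x0 : 0 < t^-1 by rewrite invr_gt0.
have F0 : 0 < (k.+2)`!%:R :> R by rewrite ltr0n fact_gt0.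
have h : t^-1 ^+ k.+2 / (k.+2)`!%:R <= expR t^-1.
  by apply: le_trans (expR_ge1Dxn k.+1 (ltW x0)); rewrite lerDr.
rewrite ler_pdivrMr ?expR_gt0//.
have -> : t^-1 ^+ k = (k.+2)`!%:R * t ^+ 2 * (t^-1 ^+ k.+2 / (k.+2)`!%:R).
  by rewrite !exprS; field; rewrite !gt_eqF//.
by apply: ler_wpM2l => //; rewrite mulr_ge0// ?sqr_ge0// ltW.
Qed.

(** At t = 0 the difference quotient is squeezed by the quadratic bound ek_le. *)
Lemma is_derive_ek k t : is_derive t 1 (ek k) (ek k.+2 t - k%:R * ek k.+1 t).
Proof.
have [t0|t0|t0] := ltgtP t 0.
- rewrite !ek_le0 ?(ltW t0)// mulr0 subr0.
  have d0 : is_derive t 1 (fun=> 0 : R) (0 : R) by exact: is_derive_cst.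
  apply: near_eq_is_derive d0.
  by apply: (open_near (@open_lt R 0) t0) => x /= x0; rewrite ek_le0// ltW.
- have dV : is_derive t 1 (fun x : R => x^-1) (- (t^-1 ^+ 2)).
    apply: DeriveDef; first by apply: (@derivableV _ _ id); [exact: lt0r_neq0|exact: derivable_id].
    rewrite (@deriveV _ _ id t 1 (lt0r_neq0 t0)) ?derive_id//.
    by rewrite -exprVn /GRing.scale/= mulr1.
  apply: (@near_eq_is_derive R R R (fun x => x^-1 ^+ k * expR (- x^-1))).
    by apply: (open_near (@open_gt R 0) t0) => x /= x0; rewrite /ek x0.
  have dN : is_derive t 1 (fun x : R => - x^-1) (t^-1 ^+ 2).
    by have := is_deriveN dV; rewrite opprK.
  have dN1 : derivable (fun x : R => - x^-1) t 1 by case: dN.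
  have [dE eE] := @is_derive_comp1 R R expR (fun x : R => - x^-1) t 1 dN1 (@derivable_expR R (- t^-1)).
  have dE' : is_derive t 1 (fun x : R => expR (- x^-1)) (expR (- t^-1) * t^-1 ^+ 2).
    apply: DeriveDef => //; rewrite eE.
    by have [_ ->] := is_derive_expR (- t^-1); have [_ ->] := dN.
  have := is_deriveM (is_deriveX k dV) dE'.
  rewrite exprfctE => H; apply: is_derive_eq H _.
  rewrite /ek t0 /GRing.scale/=; case: k => [|k] /=; first by ring.
  by rewrite !exprS; ring.
- rewrite t0 !ek_le0// mulr0 subr0.
  have L : (fun h : R => h^-1 *: ((ek k \o shift 0) (h *: 1) - ek k 0)) @ 0^' --> (0 : R).
    apply/cvgrPdist_le => e e0.
    have F0 : 0 < (k.+2)`!%:R :> R by rewrite ltr0n fact_gt0.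
    near=> h.
    have hn0 : h != 0 by near: h; exact: nbhs_dnbhs_neq.
    rewrite sub0r normrN /= addr0 [h *: 1]mulr1 (@ek_le0 k 0)// subr0.
    rewrite normrM normfV ler_pdivrMl ?normr_gt0// ger0_norm ?ek_ge0//.
    apply: (le_trans (ek_le _ _)).
    rewrite -real_normK ?num_real// expr2 mulrCA ler_pM2l ?normr_gt0//.
    rewrite mulrC -ler_pdivlMr//.
    by near: h; apply: dnbhs0_le; rewrite divr_gt0.
  apply: DeriveDef; first by apply/cvg_ex; exists 0.
  exact: cvg_lim L.
Unshelve. all: by end_near. Qed.

Lemma Cn_id n (U : set R) : open U -> Cn n U (fun t : R => t).
Proof. by move=> oU; apply: (@Cn_linear R R n U idfun oU) => x; exact: cvg_id. Qed.

Lemma Cn_ek n k : Cn n setT (ek k).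
Proof.
elim: n k => [|n IHn] k.
  split=> // t _; apply: differentiable_continuous; apply/derivable1_diffP.
  by have [] := is_derive_ek k t.
apply: Cn1; [exact: openT|by move=> t _; have [] := is_derive_ek k t|].
apply: (@Cn_eq R R n setT (fun t => ek k.+2 t - k%:R * ek k.+1 t)); first exact: openT.
  by move=> t _; have [_ ->] := is_derive_ek k t.
apply: Cn_add; [exact: openT|exact: IHn|].
apply: Cn_opp; first exact: openT.
by apply: Cn_mul; [exact: openT|apply: Cn_cst; exact: openT|exact: IHn].
Qed.

Definition step t : R := ek 0 (t - 1) / (ek 0 (t - 1) + ek 0 (2 - t)).

Lemma step_den t : 0 < ek 0 (t - 1) + ek 0 (2 - t).
Proof.
have [t1|t1] := ltrP 1 t.
  by rewrite ltr_wpDr ?ek_ge0// ek_gt0// subr_gt0.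
by rewrite ltr_wpDl ?ek_ge0// ek_gt0//; lra.
Qed.

Lemma Cn_step n : Cn n setT step.
Proof.
have a1 : Cn n setT (fun t => ek 0 (t - 1)).
  have := @Cn_affine R R n (ek 0) 1 (-1) (Cn_ek n 0).
  by under eq_fun do rewrite scale1r.
have a2 : Cn n setT (fun t => ek 0 (2 - t)).
  have := @Cn_affine R R n (ek 0) (-1) 2 (Cn_ek n 0).
  by under eq_fun do rewrite scaleN1r addrC.
apply: Cn_mul; [exact: openT|exact: a1|].
have o := @open_gt R 0.
apply: (@Cn_comp R R n setT _ (fun t => t^-1) (fun t => ek 0 (t - 1) + ek 0 (2 - t)) openT o).
- exact: Cn_inv.
- by apply: Cn_add => //; exact: openT.
- by move=> t _; exact: step_den.
Qed.

Lemma step_ge0 t : 0 <= step t.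
Proof. by rewrite divr_ge0 ?ek_ge0// ltW// step_den. Qed.

Lemma step_le1 t : step t <= 1.
Proof. by rewrite ler_pdivrMr ?step_den// mul1r lerDl ek_ge0. Qed.

Lemma step0 t : t <= 1 -> step t = 0.
Proof. by move=> t1; rewrite /step ek_le0 ?mul0r// subr_le0. Qed.

Lemma step1 t : 2 <= t -> step t = 1.
Proof.
move=> t2; rewrite /step (@ek_le0 0 (2 - t)) ?subr_le0// addr0 divff//.
by rewrite gt_eqF// ek_gt0//; lra.
Qed.

End flat.

(** * Boxes, Borel sets and continuous functions *)

Section boxes.
Context {R : realType} {N : nat}.
Local Notation E := ('rV[R]_N * R)%type.
Local Notation lpt := (@Defs.lebesgue_pt R N).
Implicit Types (z c : E) (A U : set E).

Definition obox c (r : R) : set E :=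
  [set z : E | (forall i, `|z.1 ord0 i - c.1 ord0 i| < r) /\ `|z.2 - c.2| < r].

Definition cbox (r : R) : set E :=
  [set z : E | (forall i, `|z.1 ord0 i| <= r) /\ `|z.2| <= r].

Lemma ball_obox c r : 0 < r -> ball c r = obox c r.
Proof.
move=> r0; apply/seteqP; split=> z.
  move=> [[_ h1] h2]; split=> [i|].
    by have := h1 ord0 i; rewrite /ball/= distrC.
  by have := h2; rewrite /ball/= distrC.
move=> [h1 h2]; split.
  by split=> // i j; rewrite (ord1 i) /ball/= distrC; exact: h1.
by rewrite /ball/= distrC.
Qed.

Lemma nbhs_obox c A : nbhs c A <-> exists2 r, 0 < r & obox c r `<=` A.
Proof.
split=> [/nbhs_ballP[r r0 h]|[r r0 h]].
  by exists r => //; rewrite -ball_obox.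
by apply/nbhs_ballP; exists r => //; rewrite ball_obox.
Qed.

Lemma measurable_coord2 : measurable_fun [set: E] (fun z : E => z.2).
Proof. exact: measurable_snd. Qed.

Lemma measurable_coords (P : 'I_N -> set R) (Q : set R) :
  (forall i, measurable (P i)) -> measurable Q ->
  measurable [set z : E | (forall i, P i (z.1 ord0 i)) /\ Q z.2].
Proof.
move=> mP mQ.
rewrite (_ : mkset _ = [set x : 'rV[R]_N | forall i, P i (x ord0 i)] `*` Q) //.
by apply: measurableX => //; exact: measurable_box.
Qed.

Lemma measurable_dist (t0 r : R) : measurable [set t : R | `|t - t0| < r].
Proof.
apply: measurable_realfun.open_measurable.
have -> : [set t : R | `|t - t0| < r] = ball t0 r.
  by apply/seteqP; split=> t; rewrite /ball/= distrC.
have [r0|r0] := lerP r 0; last exact: ball_open.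
by rewrite (ball0 _ _).2 //; exact: open0.
Qed.

Lemma measurable_obox c r : measurable (obox c r).
Proof.
exact: (@measurable_coords (fun i => [set t | `|t - c.1 ord0 i| < r])
  [set t | `|t - c.2| < r] (fun i => measurable_dist _ _) (measurable_dist _ _)).
Qed.

Lemma cboxE r : cbox r =
  [set x : 'rV[R]_N | forall i, `[- r, r]%classic (x ord0 i)] `*` `[- r, r]%classic.
Proof.
apply/seteqP; split=> z [h1 h2]; split.
- by move=> i; rewrite /= in_itv/= -ler_norml.
- by rewrite /= in_itv/= -ler_norml.
- by move=> i; have := h1 i; rewrite /= in_itv/= -ler_norml.
- by move: h2; rewrite /= in_itv/= -ler_norml.
Qed.

Lemma measurable_cbox r : measurable (cbox r).
Proof.
rewrite cboxE; apply: measurableX => //.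
exact: (@measurable_box R N (fun=> `[- r, r]%classic)).
Qed.

Lemma compact_cbox r : compact (cbox r).
Proof.
rewrite cboxE; apply: compact_setX; last exact: segment_compact.
by apply: (@rV_compact R N (fun=> `[- r, r]%classic)) => i; exact: segment_compact.
Qed.

Lemma cbox_finite r : (lpt (cbox r) < +oo)%E.
Proof.
rewrite cboxE /Defs.lebesgue_pt product_measure1E//; last exact: (@measurable_box R N (fun=> `[- r, r]%classic)).
have lf : lebesgue_measure (`[- r, r]%classic : set R) \is a fin_num.
  by rewrite lebesgue_measure_itv; case: ifP.
apply: lte_mul_pinfty => //; last by rewrite -ge0_fin_numE.
have := @lebesgue_rV_box R N (fun=> `[- r, r]%classic) (fun=> measurable_itv _).
by move=> /= ->; rewrite prode_fin_num.
Qed.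

(** The measurable structure is generated by the coordinates; an open set is the
    countable union of the boxes with rational centre and radius 1/(n+1) that it contains. *)
Lemma open_measurableE A : open A -> measurable A.
Proof.
move=> oA.
pose I := (('rV[rat]_N * rat) * nat)%type.
pose bx (p : I) : set E :=
  obox (\row_i ratr (p.1.1 ord0 i), ratr p.1.2) (p.2.+1%:R^-1).
pose F (n : nat) : set E := if unpickle n is Some p then
  (if `[< bx p `<=` A >] then bx p else set0) else set0.
suff -> : A = \bigcup_n F n.
  apply: bigcupT_measurable => n; rewrite /F; case: unpickle => // p.
  by case: asboolP => // _; exact: measurable_obox.
apply/seteqP; split=> [z Az|z [n _]]; last first.
  by rewrite /F; case: unpickle => // p; case: asboolP => // h; exact: h.
have /nbhs_obox[r r0 rA] : nbhs z A by exact: open_nbhs_nbhs.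
have [n nr] : exists n : nat, n.+1%:R^-1 < r / 2.
  have [n _ h] := near_infty_natSinv_lt (PosNum (divr_gt0 r0 (ltr0Sn R 1))).
  by exists n; apply: (h n) => /=.
set d : R := n.+1%:R^-1 in nr.
have d0 : 0 < d by rewrite invr_gt0.
have ex (t : R) : exists q : rat, `|t - ratr q| < d.
  have /rat_in_itvoo[q] : t - d < t + d by lra.
  rewrite in_itv/= => /andP[q1 q2]; exists q.
  by rewrite ltr_norml; apply/andP; split; lra.
have [f fE] := choice (fun i => ex (z.1 ord0 i)); have [q qE] := ex z.2.
pose p : I := ((\row_i f i, q), n).
have bz : bx p z.
  by split => /= [i|//]; rewrite !mxE; exact: fE.
have bA : bx p `<=` A.
  move=> w [w1 w2]; apply: rA; split=> [i|].
    have := w1 i; have := fE i; rewrite /= !mxE -/d.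
    by rewrite !ltr_norml => /andP[? ?] /andP[? ?]; apply/andP; split; lra.
  move: w2 qE => /=; rewrite -/d.
  by rewrite !ltr_norml => /andP[? ?] /andP[? ?]; apply/andP; split; lra.
exists (pickle p); first exact: Logic.I.
by rewrite /F pickleK asboolT.
Qed.

Lemma closed_measurableE A : closed A -> measurable A.
Proof.
by move=> cA; rewrite -[A]setCK; apply: measurableC; apply: open_measurableE; exact: closed_openC.
Qed.

Lemma continuous_measurableE U (f : E -> R) : open U ->
  (forall z, U z -> {for z, continuous f}) -> measurable_fun U f.
Proof.
move=> oU cf; apply: (measurability _ (measurable_realfun.RGenOInfty.measurableE R)).
move=> _ [_ [x ->] <-]; apply: open_measurableE.
rewrite openE => z [Uz fz]; rewrite /interior.
have fz' : nbhs (f z) [set t : R | x < t].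
  by apply: open_nbhs_nbhs; split; [exact: open_gt|move: fz; rewrite /= in_itv/= andbT].
have := cf _ Uz _ fz'; rewrite nbhs_simpl/= => H.
have Un : nbhs z U by exact: open_nbhs_nbhs.
by apply: filterS2 Un H => w Uw /= fw; split=> //=; rewrite in_itv/= fw.
Qed.

Lemma compact_sub_cbox (K : set E) : compact K -> exists2 r, 0 < r & K `<=` cbox r.
Proof.
move=> /compact_bounded[M [_ h]]; exists (`|M| + 1); first by rewrite ltr_pwDr.
move=> z Kz; have := h (`|M| + 1) _ z Kz.
rewrite (le_lt_trans (ler_norm M)) ?ltrDl// => /(_ isT) nz.
have [n1 n2] : `|z.1| <= `|M| + 1 /\ `|z.2| <= `|M| + 1.
  by move: nz; rewrite /Num.Def.normr/= ge_max => /andP[].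
split=> // i; apply: le_trans n1.
rewrite [leRHS]/Num.Def.normr/= mx_normrE.
by apply: (le_bigmax _ (fun ij => `|z.1 ij.1 ij.2|) (ord0, i)).
Qed.

Lemma integrable_bounded A (f : E -> R) (r M : R) : measurable A ->
  A `<=` cbox r -> measurable_fun A f -> (forall z, A z -> `|f z| <= M) ->
  lpt.-integrable A (EFin \o f).
Proof.
move=> mA Ar mf fM; apply: measurable_bounded_integrable => //.
  by apply: le_lt_trans (cbox_finite r); apply: le_measure => //; rewrite inE//; exact: measurable_cbox.
exists M; split; first exact: num_real.
by move=> x Mx z Az; apply: (le_trans (fM _ Az)); exact: ltW.
Qed.

Lemma open_half_space : open (@half_space R N).
Proof.
have -> : @half_space R N = snd @^-1` [set t : R | 0 < t] by [].
apply: open_comp; last exact: open_gt.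
by move=> z _; exact: cvg_snd.
Qed.

Lemma within_half_space (u : E -> R) : {within closed_half_space, continuous u} ->
  forall z, half_space z -> {for z, continuous u}.
Proof.
move=> cu z hz.
have : {within (@half_space R N), continuous u}.
  by apply: continuous_subspaceW cu => w; exact: ltW.
rewrite (continuous_open_subspace u open_half_space).
by apply; rewrite inE.
Qed.

Lemma measurable_half_space : measurable (@half_space R N).
Proof. exact: open_measurableE open_half_space. Qed.

Lemma within_bounded (u : E -> R) (r : R) :
  {within closed_half_space, continuous u} ->
  exists M : R, forall z, cbox r z -> 0 <= z.2 -> `|u z| <= M.
Proof.
move=> cu.
have cC : closed (@closed_half_space R N).
  have -> : @closed_half_space R N = snd @^-1` [set t : R | 0 <= t] by [].
  apply: closed_comp; last exact: closed_ge.
  by move=> z _; exact: cvg_snd.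
have cK : compact (cbox r `&` @closed_half_space R N).
  by apply: compact_closedI => //; exact: compact_cbox.
have cu' : {within cbox r `&` @closed_half_space R N, continuous u}.
  by apply: continuous_subspaceW cu => z [].
have /compact_bounded[M [_ h]] := continuous_compact cu' cK.
exists (`|M| + 1) => z rz z0; apply: (h (`|M| + 1)); last by exists z.
by rewrite (le_lt_trans (ler_norm M)) ?ltrDl.
Qed.

End boxes.

(** * Coordinates and test functions *)

Section linear_forms.
Context {R : realType} {V : normedModType R}.

Lemma is_derive_linear (f : V -> R) (z w : V) :
  (forall a u v, f (a *: u + v) = a * f u + f v) -> is_derive z w f (f w).
Proof.
move=> lf.
have L : (fun h : R => h^-1 *: ((f \o shift z) (h *: w) - f z)) @ 0^' --> f w.
  apply: cvg_near_cst; near=> h.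
  rewrite /= lf addrK /GRing.scale/= mulKf//.
  by near: h; exact: nbhs_dnbhs_neq.
apply: DeriveDef; first by apply/cvg_ex; exists (f w).
exact: cvg_lim L.
Unshelve. all: by end_near. Qed.

Lemma Cn_linear_form n (f : V -> R) : continuous f ->
  (forall a u v, f (a *: u + v) = a * f u + f v) -> Cn n setT f.
Proof.
move=> cf lf; case: n => [|n]; (split; first by move=> z _; exact: cf) => //.
move=> w; split=> [z _|]; first by have [] := is_derive_linear z w lf.
apply: (@Cn_eq R V n setT (fun=> f w)); first exact: openT.
  by move=> z _; have [_ ->] := is_derive_linear z w lf.
by apply: Cn_cst; exact: openT.
Qed.

End linear_forms.

Section coordinates.
Context {R : realType} {N : nat}.
Local Notation E := ('rV[R]_N * R)%type.
Local Notation lpt := (@Defs.lebesgue_pt R N).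
Implicit Types (z c w : E) (A U Omega K : set E).

Lemma Cn_x n (i : 'I_N) : Cn n setT (fun z : E => z.1 ord0 i).
Proof.
apply: Cn_linear_form => [z|a u v]; last by rewrite !mxE.
apply: (@continuous_comp _ _ _ (@fst 'rV[R]_N R) (fun x : 'rV[R]_N => x ord0 i)).
  exact: cvg_fst.
exact: coord_continuous.
Qed.

Lemma Cn_y n : Cn n setT (fun z : E => z.2).
Proof. by apply: Cn_linear_form => // z; exact: cvg_snd. Qed.

Definition sq c z : R := \sum_(i < N) (z.1 ord0 i - c.1 ord0 i) ^+ 2 + (z.2 - c.2) ^+ 2.

Lemma Cn_cstT n (c : R) : Cn n [set: E] (fun=> c).
Proof. by apply: Cn_cst; exact: openT. Qed.

Lemma Cn_addT n (f g : E -> R) : Cn n setT f -> Cn n setT g ->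
  Cn n setT (fun z => f z + g z).
Proof. by apply: Cn_add; exact: openT. Qed.

Lemma Cn_mulT n (f g : E -> R) : Cn n setT f -> Cn n setT g ->
  Cn n setT (fun z => f z * g z).
Proof. by apply: Cn_mul; exact: openT. Qed.

Lemma Cn_compT n (h : R -> R) (f : E -> R) : Cn n setT h -> Cn n setT f ->
  Cn n setT (fun z => h (f z)).
Proof. by move=> Ch Cf; apply: (@Cn_comp R _ n setT setT) => //; exact: openT. Qed.

Lemma Cn_sqr n (f : E -> R) : Cn n setT f -> Cn n setT (fun z => f z ^+ 2).
Proof.
move=> Cf; under eq_fun do rewrite expr2.
exact: Cn_mulT.
Qed.

Lemma Cn_sq n c : Cn n setT (sq c).
Proof.
apply: Cn_addT.
  apply: Cn_sum; first exact: openT.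
  move=> i; apply: Cn_sqr; apply: Cn_addT; [exact: Cn_x|exact: Cn_cstT].
apply: Cn_sqr; apply: Cn_addT; [exact: Cn_y|exact: Cn_cstT].
Qed.

Lemma Cn_prod n (I : Type) (s : seq I) (f : I -> E -> R) :
  (forall i, Cn n setT (f i)) -> Cn n setT (fun z => \prod_(i <- s) f i z).
Proof.
move=> Cf; elim: s => [|i s IHs].
  by under eq_fun do rewrite big_nil; exact: Cn_cstT.
by under eq_fun do rewrite big_cons; exact: Cn_mulT.
Qed.

Lemma smooth_continuous (f : E -> R) : smooth f -> continuous f.
Proof. by move=> sf; exact: (sf [::]).1. Qed.

Lemma smooth_derivable (f : E -> R) z w : smooth f -> derivable f z w.
Proof. by move=> sf; exact: (sf [::]).2. Qed.

Lemma smooth_D (f : E -> R) w : smooth f -> smooth ('D_w f).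
Proof. by move=> /smoothP sf; apply/smoothP => n; apply: CnD; exact: sf. Qed.

Lemma continuous_measurableT (f : E -> R) : continuous f -> measurable_fun setT f.
Proof. by move=> cf; apply: continuous_measurableE ; [exact: openT|move=> z _; exact: cf]. Qed.

Lemma compact_closedE K : compact K -> closed K.
Proof. by apply: compact_closed; exact: norm_hausdorff. Qed.

Lemma compact_measurableE K : compact K -> measurable K.
Proof. by move=> /compact_closedE; exact: closed_measurableE. Qed.

Lemma continuous_bounded K (f : E -> R) : compact K -> continuous f ->
  exists M : R, forall z, K z -> `|f z| <= M.
Proof.
move=> cK cf.
have /compact_bounded[M [_ h]] := continuous_compact (continuous_subspaceT cf) cK.
exists (`|M| + 1) => z Kz; apply: (h (`|M| + 1)); last by exists z.
by rewrite (le_lt_trans (ler_norm M)) ?ltrDl.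
Qed.

Lemma test_functionI Omega K phi : smooth phi -> compact K -> K `<=` Omega ->
  (forall z, ~ K z -> phi z = 0) -> test_function Omega phi.
Proof.
move=> sphi cK KO phi0.
have sK : closure [set z | phi z != 0] `<=` K.
  have -> : K = closure K by rewrite -closure_id; exact: compact_closedE.
  apply: closure_subset => z /= z0; apply: contrapT => nK.
  by move: z0; rewrite phi0// eqxx.
split=> //; last exact: subset_trans KO.
exact: (subclosed_compact (@closed_closure _ _) cK sK).
Qed.

Lemma test_functionE Omega phi : test_function Omega phi ->
  exists K, [/\ smooth phi, compact K, K `<=` Omega &
    forall z, ~ K z -> phi z = 0].
Proof.
move=> [sphi cK KO]; exists (closure [set z | phi z != 0]); split=> // z nK.
by apply/eqP; apply: contrapT => /negP h; apply: nK; exact: subset_closure.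
Qed.

Lemma D_zero K (phi : E -> R) w : closed K -> (forall z, ~ K z -> phi z = 0) ->
  forall z, ~ K z -> 'D_w phi z = 0.
Proof.
move=> cK phi0 z nK.
rewrite (@near_eq_derive _ _ _ phi (cst 0)) ?derive_cst//.
by apply: (open_near (closed_openC cK) nK) => x; exact: phi0.
Qed.

Lemma integrable_supp Omega K (f psi : E -> R) : measurable Omega ->
  compact K -> K `<=` Omega -> continuous psi -> (forall z, ~ K z -> psi z = 0) ->
  lpt.-integrable K (EFin \o f) ->
  lpt.-integrable Omega (EFin \o (fun z => f z * psi z)).
Proof.
move=> mO cK KO cpsi psi0 fi; have mK := compact_measurableE cK.
have [M hM] := continuous_bounded cK cpsi.
have fpi : lpt.-integrable K (EFin \o (fun z => f z * psi z)).
  have := @integrableMl _ _ _ lpt K mK (EFin \o f) psi fi.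
  apply; first by apply: measurable_funTS; exact: continuous_measurableT.
  exists M; split; first exact: num_real.
  by move=> x Mx z Kz; apply: (le_trans (hM _ Kz)); exact: ltW.
have /(@integrable_mkcond _ _ _ lpt K (EFin \o (fun z => f z * psi z)) mK) := fpi.
move=> H; have := @integrableS _ _ _ lpt setT Omega _ measurableT mO (@subsetT _ _) H; apply: eq_integrable => // z zO.
rewrite /patch; case: ifPn => // zK; rewrite /= psi0 ?mulr0//.
by move: zK; rewrite notin_setE.
Qed.

End coordinates.

(** * Functions with zero integral over all orthants *)

Section density.
Local Open Scope ereal_scope.
Context d (T : measurableType d) (R : realType) (mu : {measure set T -> \bar R}).

Definition density (f : T -> \bar R) of measurable_fun setT f
  & (forall x, 0 <= f x) := fun A : set T => \int[mu]_(x in A) f x.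

Section inst.
Context (f : T -> \bar R) (mf : measurable_fun setT f) (f0 : forall x, 0 <= f x).

Let nu := density mf f0.

Let nu0 : nu set0 = 0. Proof. exact: integral_set0. Qed.

Let nu_ge0 A : 0 <= nu A. Proof. by apply: integral_ge0 => x _; exact: f0. Qed.

Let nu_sigma : semi_sigma_additive nu.
Proof.
move=> F mF tF mUF; rewrite /nu /density ge0_integral_bigcup//; last first.
  exact: measurable_funTS.
by apply: is_cvg_ereal_nneg_natsum_cond => n _ _; apply: integral_ge0 => x _; exact: f0.
Qed.

HB.instance Definition _ := isMeasure.Build _ _ _ (density mf f0) nu0 nu_ge0 nu_sigma.
End inst.
End density.

(** The positive and negative parts of h are densities of two finite measures that
    agree on the pi-system G, hence everywhere. *)
Lemma pi_system_ae0 d (T : measurableType d) (R : realType)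
    (mu : {measure set T -> \bar R}) (G : set (set T)) (g : (set T)^nat)
    (h : T -> R) :
  @measurable _ T = <<s G >> -> setI_closed G -> (forall n, G (g n)) ->
  \bigcup_n g n = setT -> mu.-integrable setT (EFin \o h) ->
  (forall A, G A -> (\int[mu]_(z in A) (h z)%:E = 0)%E) ->
  ae_eq mu setT (EFin \o h) (cst 0%E).
Proof.
move=> mG IG Gg gT ih h0; have mh := measurable_int _ ih.
have GM A : G A -> measurable A by rewrite mG; exact: sub_sigma_algebra.
pose hp := ((EFin \o h)^\+)%E; pose hn := ((EFin \o h)^\-)%E.
have mp : measurable_fun setT hp by exact: measurable_funepos.
have mn : measurable_fun setT hn by exact: measurable_funeneg.
have p0 x : (0 <= hp x)%E by exact: funepos_ge0.
have n0 x : (0 <= hn x)%E by exact: funeneg_ge0.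
have ip := integrable_funepos measurableT ih.
have inn := integrable_funeneg measurableT ih.
have fin (f : T -> \bar R) A : measurable A -> mu.-integrable setT f ->
    (\int[mu]_(z in A) f z)%E \is a fin_num.
  move=> mA fi; apply: integrable_fin_num => //.
  exact: integrableS measurableT mA (@subsetT _ _) fi.
have E1 A : measurable A -> (\int[mu]_(z in A) (h z)%:E = 0)%E <->
    density mu mp p0 A = density mu mn n0 A.
  move=> mA; rewrite integralE /density -/hp -/hn.
  have fp := fin _ _ mA ip; have fn := fin _ _ mA inn.
  split=> [/eqP|->]; last by rewrite subee.
  by rewrite sube_eq ?fin_num_adde_defr// add0e => /eqP.
have E2 A : measurable A -> density mu mp p0 A = density mu mn n0 A.
  move=> mA; apply: (measure_unique G g) => //.
  - by move=> B GB; apply/E1; [exact: GM|exact: h0].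
  - move=> k; rewrite -ge0_fin_numE; last exact: measure_ge0.
    by apply: fin => //; exact: GM.
apply: integral_ae_eq => //.
move=> A _ mA; rewrite [RHS]integral0_eq//.
by apply/(E1 _ mA); exact: E2.
Qed.

Section orthants.
Context {R : realType} {N : nat}.
Local Notation E := ('rV[R]_N * R)%type.
Local Notation lpt := (@Defs.lebesgue_pt R N).

Definition orthant (b : E) : set E :=
  [set z : E | (forall i, z.1 ord0 i <= b.1 ord0 i) /\ z.2 <= b.2].

Definition orthants : set (set E) := [set A | exists b, A = orthant b].

Lemma measurable_orthant b : measurable (orthant b).
Proof.
apply: (@measurable_coords R N (fun i => [set t | t <= b.1 ord0 i]) [set t | t <= b.2]).
  by move=> i; rewrite -set_itvNyc; exact: measurable_itv.
by rewrite -set_itvNyc; exact: measurable_itv.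
Qed.

Lemma setI_orthants : setI_closed orthants.
Proof.
move=> _ _ [b ->] [c ->].
exists (\row_i Num.min (b.1 ord0 i) (c.1 ord0 i), Num.min b.2 c.2).
apply/seteqP; split=> z.
  move=> [[b1 b2] [c1 c2]]; split=> [i|] /=; last by rewrite le_min b2 c2.
  by rewrite mxE le_min b1 c1.
move=> [h1 h2]; move: h2; rewrite /= le_min => /andP[b2 c2].
by split; split=> // i; have := h1 i; rewrite /= mxE le_min => /andP[].
Qed.

Definition diag_pt (n : nat) : E := (\row_i n%:R, n%:R).

Lemma bound_nat (z : E) : exists n : nat, (forall i, z.1 ord0 i <= n%:R) /\ z.2 <= n%:R.
Proof.
pose M := `|z.2| + \sum_i `|z.1 ord0 i|.
have [n hn] : exists n : nat, M <= n%:R.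
  by exists (Num.truncn M).+1; apply: ltW; exact: truncnS_gt.
have S0 : 0 <= \sum_i `|z.1 ord0 i| by apply: sumr_ge0.
exists n; split=> [i|]; apply: le_trans hn.
  rewrite /M (bigD1 i)//=; apply: (le_trans (ler_norm _)).
  by rewrite addrCA lerDl addr_ge0// sumr_ge0.
by rewrite /M; apply: (le_trans (ler_norm _)); rewrite lerDl.
Qed.

Lemma orthants_cover : \bigcup_n orthant (diag_pt n) = setT.
Proof.
apply/seteqP; split=> // z _; have [n [h1 h2]] := bound_nat z.
by exists n => //; split=> [i|//]; rewrite mxE.
Qed.

Lemma measurable_orthantsE : @measurable _ E = <<s orthants >>.
Proof.
apply/seteqP; split; last first.
  apply: smallest_sub; first exact: sigma_algebra_measurable.
  by move=> _ [b ->]; exact: measurable_orthant.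
pose T' := g_sigma_algebraType orthants.
have mO b : measurable (orthant b : set T') by apply: sub_sigma_algebra; exists b.
have key (f : E -> R) :
    (forall r : R, exists c : nat -> E, [set z : E | f z <= r] = \bigcup_n orthant (c n)) ->
    measurable_fun setT (f : T' -> R).
  move=> hf; apply: (measurability _ (measurable_realfun.RGenOInfty.measurableE R)).
  move=> _ [_ [x ->] <-]; rewrite setTI.
  have [c hc] := hf x.
  have -> : f @^-1` `]x, +oo[%classic = ~` [set z : E | f z <= x].
    by apply/seteqP; split=> z /=; rewrite in_itv/= andbT ltNge => /negP.
  by rewrite hc; apply: measurableC; apply: bigcupT_measurable => n; exact: mO.
have m1 : measurable_fun setT (fun z : T' => (z : E).1).
  apply: measurable_fun_rVP => i; apply: key => r.
  exists (fun n => (\row_j (if j == i then r else n%:R), n%:R)).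
  apply/seteqP; split=> z /=.
    move=> zr; have [n [h1 h2]] := bound_nat z; exists n => //; split=> //= j.
    by rewrite mxE; case: eqP => [->|].
  by move=> [n _ [/(_ i)]]; rewrite mxE eqxx.
have m2 : measurable_fun setT (fun z : T' => (z : E).2).
  apply: key => r; exists (fun n => (\row_j n%:R, r)).
  apply/seteqP; split=> z /=.
    by move=> zr; have [n [h1 h2]] := bound_nat z; exists n => //; split=> //= j; rewrite mxE.
  by move=> [n _ []].
have mid : measurable_fun setT (fun z : T' => (z : E)).
  have := measurable_fun_pair m1 m2.
  rewrite (_ : (fun x : T' => _) = (fun z : T' => (z : E)))//.
  by apply/funext => -[].
by move=> A mA; have := mid measurableT A mA; rewrite setTI.
Qed.

(** The orthants form a pi-system that generates the Borel sets; their indicators are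
    limits of products of one-variable smooth steps (see ae_zero_test). *)
Lemma orthant_ae0 (h : E -> R) : lpt.-integrable setT (EFin \o h) ->
  (forall b, (\int[lpt]_(z in orthant b) (h z)%:E = 0)%E) ->
  ae_eq lpt setT (EFin \o h) (cst 0%E).
Proof.
move=> ih h0.
have mG : @measurable _ ('rV[R]_N * measurableTypeR R)%type = <<s orthants>>.
  exact: measurable_orthantsE.
apply: (@pi_system_ae0 _ _ R lpt orthants (fun n => orthant (diag_pt n)) h mG) => //.
- exact: setI_orthants.
- by move=> n; exists (diag_pt n).
- exact: orthants_cover.
- by move=> _ [b ->]; exact: h0.
Qed.

End orthants.

(** * Uniqueness of weak gradients *)

Lemma Rdominated d (T : measurableType d) (R : realType)
    (mu : {measure set T -> \bar R}) (D : set T) (mD : measurable D)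
    (F : nat -> T -> R) (f g : T -> R) :
  (forall n, measurable_fun D (F n)) -> measurable_fun D f ->
  (forall x, D x -> F n x @[n --> \oo] --> f x) ->
  mu.-integrable D (EFin \o g) ->
  (forall n x, D x -> `|F n x| <= g x) ->
  mu.-integrable D (EFin \o f) /\
  (\int[mu]_(x in D) F n x) @[n --> \oo] --> \int[mu]_(x in D) f x.
Proof.
move=> mF mf Ff ig Fg.
have FfE x : D x -> (F n x)%:E @[n --> \oo] --> (f x)%:E.
  move=> Dx; apply/fine_cvgP; split; first exact: nearW.
  exact: Ff.
have [fi _ lim] := @dominated_convergence _ _ R mu D mD (fun n => EFin \o F n)
  (EFin \o f) (EFin \o g)
  (fun n => (measurable_EFinP _ _).2 (mF n)) ((measurable_EFinP _ _).2 mf)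
  (aeW mu FfE) ig
  (aeW mu (fun x n Dx => Fg n x Dx)).
split=> //; apply: fine_cvg; rewrite fineK //.
exact: (@integrable_fin_num _ _ _ mu D mD).
Qed.

Section fund.
Context {R : realType} {N : nat}.
Local Notation E := ('rV[R]_N * R)%type.
Local Notation lpt := (@Defs.lebesgue_pt R N).
Implicit Types (Omega K : set E) (f u : E -> R) (g : E -> E).

Lemma step_gt0 (t : R) : 1 < t -> 0 < step t.
Proof.
by move=> t1; rewrite /step divr_gt0 ?step_den// ek_gt0// subr_gt0.
Qed.

Lemma Rintegral_sub (A B : set E) f : A `<=` B ->
  (forall z, B z -> ~ A z -> f z = 0) ->
  \int[lpt]_(z in A) f z = \int[lpt]_(z in B) f z.
Proof.
move=> AB f0; rewrite (@Rintegral_mkcond _ _ _ lpt A) (@Rintegral_mkcond _ _ _ lpt B).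
congr (Rintegral _ _ _); apply/funext => z; rewrite /patch.
case: ifPn => [zA|zA]; first by rewrite mem_set//; apply: AB; rewrite inE in zA.
case: ifPn => // zB; rewrite f0//; first by rewrite inE in zB.
by rewrite notin_setE in zA.
Qed.

Lemma Rintegral0P Omega f : lpt.-integrable Omega (EFin \o f) -> measurable Omega ->
  \int[lpt]_(z in Omega) f z = 0 -> (\int[lpt]_(z in Omega) (f z)%:E)%E = 0%E.
Proof.
move=> fi mO; rewrite /Rintegral => /eqP h0.
have fn : (\int[lpt]_(z in Omega) (f z)%:E)%E \is a fin_num.
  exact: (@integrable_fin_num _ _ _ lpt Omega mO _ fi).
by rewrite -(fineK fn); congr EFin; exact/eqP.
Qed.

(** Fundamental lemma of the calculus of variations, localised by zeta: the function
    f zeta is integrable on the whole space, and its integral over an orthant is the limit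
    of integrals of f against the test functions zeta psi_n. *)
Lemma ae_zero_test Omega f (zeta : E -> R) : measurable Omega ->
  loc_integrable Omega f ->
  (forall psi, test_function Omega psi ->
     \int[lpt]_(z in Omega) (f z * psi z) = 0) ->
  test_function Omega zeta ->
  {ae lpt, forall z, Omega z -> f z * zeta z = 0}.
Proof.
move=> mO lf f0 tz; have [K [sz cK KO z0]] := test_functionE tz.
pose h := (fun z => f z * zeta z) \_ Omega.
have fz : lpt.-integrable Omega (EFin \o (fun z => f z * zeta z)).
  by apply: (integrable_supp mO cK KO _ z0); [exact: smooth_continuous|exact: lf].
have hE : EFin \o h = (EFin \o (fun z => f z * zeta z)) \_ Omega.
  by apply/funext => z; rewrite /h /= /patch; case: ifP.
have ih : lpt.-integrable setT (EFin \o h).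
  by rewrite hE; exact: (@integrable_mkcond _ _ _ lpt Omega _ mO).1.
have h0 (b : E) : (\int[lpt]_(z in orthant b) (h z)%:E = 0)%E.
  (* Smooth approximations of the indicator of the orthant, equal to 1 on it because
     step is 1 from 2 on. *)
  pose psi (n : nat) (z : E) :=
    (\prod_(i < N) step (n%:R * (b.1 ord0 i - z.1 ord0 i) + 2)) *
    step (n%:R * (b.2 - z.2) + 2).
  have spsi n : smooth (psi n).
    apply/smoothP => m; apply: Cn_mulT.
      apply: Cn_prod => i; apply: Cn_compT; first exact: Cn_step.
      apply: Cn_addT; last exact: Cn_cstT.
      apply: Cn_mulT; first exact: Cn_cstT.
      apply: Cn_addT; first exact: Cn_cstT.
      by apply: Cn_opp; [exact: openT|exact: Cn_x].
    apply: Cn_compT; first exact: Cn_step.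
    apply: Cn_addT; last exact: Cn_cstT.
    apply: Cn_mulT; first exact: Cn_cstT.
    apply: Cn_addT; first exact: Cn_cstT.
    by apply: Cn_opp; [exact: openT|exact: Cn_y].
  have psi01 n z : 0 <= psi n z <= 1.
    apply/andP; split.
      by rewrite mulr_ge0 ?step_ge0// prodr_ge0// => i _; exact: step_ge0.
    rewrite mulr_ile1 ?step_ge0 ?step_le1//.
      by rewrite prodr_ge0// => i _; exact: step_ge0.
    by rewrite prodr_ile1// => i _; rewrite step_ge0 step_le1.
  have psi_lim z : (psi n z) @[n --> \oo] --> (\1_(orthant b) z : R).
    have far (t : R) : t < 0 -> \forall n \near \oo, step (n%:R * t + 2) = 0.
      move=> t0; near=> n; apply: step0.
      have : - t^-1 <= n%:R by near: n; exact: nbhs_infty_ger.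
      by rewrite -(ler_nM2r t0) mulNr mulVf ?lt_eqF//; lra.
    apply: cvg_near_cst.
    have [zO|zO] := pselect (orthant b z).
      apply: nearW => n; rewrite indicE mem_set// /psi step1; last first.
        by rewrite lerDr mulr_ge0// subr_ge0; exact: zO.2.
      rewrite mulr1 big1// => i _; rewrite step1//.
      by rewrite lerDr mulr_ge0// subr_ge0; exact: zO.1.
    rewrite indicE memNset//.
    have [z2|z2] := lerP z.2 b.2; last first.
      have /far : b.2 - z.2 < 0 by rewrite subr_lt0.
      by apply: filterS => n hn; rewrite /psi hn mulr0.
    have [i zi] : exists i, b.1 ord0 i < z.1 ord0 i.
      apply: contrapT => H; apply: zO; split=> // i.
      by rewrite leNgt; apply/negP => zi; apply: H; exists i.
    have /far : b.1 ord0 i - z.1 ord0 i < 0 by rewrite subr_lt0.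
    by apply: filterS => n hn; rewrite /psi (bigD1 i)//= hn mul0r mul0r.
  pose F n z := f z * zeta z * psi n z.
  pose F' z := f z * zeta z * \1_(orthant b) z.
  have Flim z : Omega z -> F n z @[n --> \oo] --> F' z.
    by move=> _; apply: cvgM; [exact: cvg_cst|exact: psi_lim].
  have domF n z : Omega z -> `|F n z| <= `|f z * zeta z|.
    move=> _; have /andP[p0 p1] := psi01 n z.
    by rewrite /F normrM (ger0_norm p0) ler_piMr.
  have mfz : measurable_fun Omega (fun z => f z * zeta z).
    by apply/measurable_EFinP; exact: (measurable_int _ fz).
  have mO1 : measurable_fun Omega (\1_(orthant b) : E -> R).
    by apply: measurable_funTS; apply: measurable_indic; exact: measurable_orthant.
  have [iF' lim] := @Rdominated _ _ R lpt Omega mO F F' (fun z => `|f z * zeta z|)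
    (fun n => measurable_funM mfz
        (measurable_funTS (continuous_measurableT (smooth_continuous (spsi n)))))
    (measurable_funM mfz mO1)
    Flim (integrable_norm fz) domF.
  have F0 n : \int[lpt]_(z in Omega) F n z = 0.
    rewrite -[RHS](f0 (fun z => zeta z * psi n z)).
      by congr (Rintegral _ _ _); apply/funext => z; rewrite /F mulrA.
    apply: (test_functionI (K := K)) => //; last by move=> z /z0 ->; rewrite mul0r.
    apply/smoothP => m; apply: Cn_mulT; first exact: (smoothP zeta).1 sz m.
    exact: (smoothP (psi n)).1 (spsi n) m.
  have F'0 : \int[lpt]_(z in Omega) F' z = 0.
    move: lim; under eq_cvg do rewrite F0.
    by move=> /(cvg_unique (@norm_hausdorff _ R^o)); apply; exact: cvg_cst.
  rewrite -(Rintegral0P iF' mO F'0) integral_mkcond [RHS]integral_mkcond.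
  apply: eq_integral => z _; rewrite /F' /h /patch /= indicE.
  by case: (z \in Omega); case: (z \in orthant b); rewrite ?mulr1 ?mulr0.
have := orthant_ae0 ih h0.
apply: filterS => z hz Oz; have := hz I.
by rewrite hE /= /patch mem_set// => -[].
Unshelve. all: by end_near. Qed.

Lemma ae_zero_exhaust Omega f (zeta : nat -> E -> R) : measurable Omega ->
  loc_integrable Omega f ->
  (forall psi, test_function Omega psi ->
     \int[lpt]_(z in Omega) (f z * psi z) = 0) ->
  (forall n, test_function Omega (zeta n)) ->
  (forall z, Omega z -> exists n, zeta n z != 0) ->
  {ae lpt, forall z, Omega z -> f z = 0}.
Proof.
move=> mO lf f0 tz zn0.
have H n := ae_zero_test mO lf f0 (tz n).
have /ae_foralln := H.
apply: filterS => z hz Oz; have [n zn] := zn0 z Oz.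
by have := hz n Oz => /eqP; rewrite mulf_eq0 (negbTE zn) orbF => /eqP.
Qed.

Lemma closed_ge_cont (F : E -> R) (c : R) : continuous F -> closed [set z | c <= F z].
Proof.
move=> cF; have -> : [set z | c <= F z] = F @^-1` [set t : R | c <= t] by [].
by apply: closed_comp; [move=> z _; exact: cF|exact: closed_ge].
Qed.

Lemma dot_sq (z : E) : dot z z = sq 0 z.
Proof.
rewrite /dot /sq /= subr0 expr2; congr (_ + _).
by apply: eq_bigr => i _; rewrite mxE subr0 expr2.
Qed.

Lemma sq_ge0 (c z : E) : 0 <= sq c z.
Proof. by rewrite addr_ge0 ?sqr_ge0// sumr_ge0// => i _; exact: sqr_ge0. Qed.

Lemma sq_ge_y (c z : E) : (z.2 - c.2) ^+ 2 <= sq c z.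
Proof. by rewrite lerDr sumr_ge0// => i _; exact: sqr_ge0. Qed.

Lemma sq_ge_x (c z : E) i : (z.1 ord0 i - c.1 ord0 i) ^+ 2 <= sq c z.
Proof.
rewrite /sq (bigD1 i)//= -addrA lerDl addr_ge0 ?sqr_ge0// sumr_ge0// => j _.
exact: sqr_ge0.
Qed.

Lemma half_ballE (r : R) : 0 < r -> half_ball r = [set z : E | 0 < z.2 /\ sq 0 z < r ^+ 2].
Proof.
move=> r0; apply/seteqP; split=> z [z2 zr]; split=> //; move: zr; rewrite /enorm dot_sq.
  rewrite -[in X in X -> _](ger0_norm (ltW r0)) -sqrtr_sqr ltr_sqrt//.
  by rewrite exprn_gt0.
by move=> zr; rewrite -[ltRHS](ger0_norm (ltW r0)) -sqrtr_sqr ltr_sqrt// exprn_gt0.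
Qed.

Lemma sq_cbox (z : E) (r : R) : 0 <= r -> sq 0 z <= r ^+ 2 -> cbox r z.
Proof.
move=> r0 zr; split=> [i|].
  rewrite -ler_sqr ?nnegrE// real_normK ?num_real//; apply: le_trans zr.
  by have := sq_ge_x 0 z i; rewrite mxE subr0.
rewrite -ler_sqr ?nnegrE// real_normK ?num_real//; apply: le_trans zr.
by have := sq_ge_y 0 z; rewrite subr0.
Qed.

(** The supports {n y >= 1, n (r^2 - |z|^2) >= 1} increase to the half ball. *)
Lemma half_ball_exhaust (r : R) : 0 < r -> exists zeta : nat -> E -> R,
  (forall n, test_function (half_ball r) (zeta n)) /\
  (forall z, half_ball r z -> exists n, zeta n z != 0).
Proof.
move=> r0; exists (fun n z => step (n%:R * z.2) * step (n%:R * (r ^+ 2 - sq 0 z))).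
have Cy n m : Cn m setT (fun z : E => n%:R * z.2).
  by apply: Cn_mulT; [exact: Cn_cstT|exact: Cn_y].
have Cs n m : Cn m setT (fun z : E => n%:R * (r ^+ 2 - sq 0 z)).
  apply: Cn_mulT; first exact: Cn_cstT.
  apply: Cn_addT; first exact: Cn_cstT.
  by apply: Cn_opp; [exact: openT|exact: Cn_sq].
rewrite half_ballE//; split=> [n|z [z2 zr]]; last first.
  have [n hn] : exists n : nat, z.2^-1 + (r ^+ 2 - sq 0 z)^-1 < n%:R.
    by exists (Num.truncn (z.2^-1 + (r ^+ 2 - sq 0 z)^-1)).+1; exact: truncnS_gt.
  have d0 : 0 < r ^+ 2 - sq 0 z by rewrite subr_gt0.
  have i1 : 0 < z.2^-1 by rewrite invr_gt0.
  have i2 : 0 < (r ^+ 2 - sq 0 z)^-1 by rewrite invr_gt0.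
  exists n; rewrite mulf_neq0// gt_eqF// step_gt0//.
    by rewrite -ltr_pdivrMr// div1r; lra.
  by rewrite -ltr_pdivrMr// div1r; lra.
pose K := [set z : E | 1 <= n%:R * z.2] `&` [set z : E | 1 <= n%:R * (r ^+ 2 - sq 0 z)].
have KO : K `<=` [set z : E | 0 < z.2 /\ sq 0 z < r ^+ 2].
  move=> z [/= k1 k2].
  have n0 : 0 < n%:R :> R.
    by rewrite lt_neqAle ler0n andbT; apply/eqP => n0; move: k1; rewrite -n0 mul0r; lra.
  split.
    by rewrite -(pmulr_rgt0 _ n0); lra.
  by rewrite -subr_gt0 -(pmulr_rgt0 _ n0); lra.
apply: (test_functionI (K := K)) => //.
- apply/smoothP => m; apply: Cn_mulT; apply: Cn_compT => //; exact: Cn_step.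
- apply: (subclosed_compact _ (@compact_cbox R N r)).
    apply: closedI; apply: closed_ge_cont => z.
      exact: (Cn_continuous (Cy n 0%N)).
    exact: (Cn_continuous (Cs n 0%N)).
  by move=> z /KO[_ /ltW]; apply: sq_cbox; exact: ltW.
- move=> z /not_andP[] /negP; rewrite -ltNge => /ltW h; first by rewrite step0// mul0r.
  by rewrite [X in _ * X]step0// mulr0.
Qed.

(** The weighted energy bound is stated for some weak gradient on each half ball and
    the equation for another one on the half space; they must be identified. *)
Lemma weak_grad_unique (r : R) u g g' : 0 < r ->
  weak_grad (half_ball r) u g -> weak_grad (half_ball r) u g' ->
  forall w, {ae lpt, forall z, half_ball r z -> dot (g z) w = dot (g' z) w}.
Proof.
move=> r0 [_ lg eg] [_ lg' eg'] w.
have mB : measurable (half_ball r : set E).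
  rewrite half_ballE//; apply: open_measurableE.
  have -> : [set z : E | 0 < z.2 /\ sq 0 z < r ^+ 2] =
     half_space `&` [set z : E | sq 0 z < r ^+ 2] by [].
  apply: openI; first exact: open_half_space.
  have -> : [set z : E | sq 0 z < r ^+ 2] = sq 0 @^-1` [set t : R | t < r ^+ 2] by [].
  apply: open_comp; last exact: open_lt.
  by move=> z _; exact: (Cn_continuous (Cn_sq 0 0)).
have [zeta [tz zn0]] := half_ball_exhaust r0.
pose f z := dot (g z) w - dot (g' z) w.
have lf : loc_integrable (half_ball r) f.
  move=> K cK KO; have mK := compact_measurableE cK.
  by have := @integrableB _ _ _ lpt K mK _ _ (lg w K cK KO) (lg' w K cK KO).
have f0 psi : test_function (half_ball r) psi ->
    \int[lpt]_(z in half_ball r) (f z * psi z) = 0.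
  move=> tp; have [K [sp cK KO p0]] := test_functionE tp.
  have i1 := integrable_supp mB cK KO (smooth_continuous sp) p0 (lg w K cK KO).
  have i2 := integrable_supp mB cK KO (smooth_continuous sp) p0 (lg' w K cK KO).
  rewrite (_ : (fun z => f z * psi z) =
     (fun z => dot (g z) w * psi z - dot (g' z) w * psi z)); last first.
    by apply/funext => z; rewrite /f mulrBl.
  rewrite (@RintegralB _ _ _ lpt)//.
  apply/eqP; rewrite subr_eq0 -eqr_opp; apply/eqP.
  by rewrite -(eg psi w tp) -(eg' psi w tp).
have [A [mA A0 sA]] := ae_zero_exhaust mB lf f0 tz zn0.
exists A; split=> //; apply: subset_trans sA => z /= nz hz; apply: nz => Bz.
by apply/eqP; rewrite -subr_eq0; apply/eqP; exact: hz.
Qed.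

Lemma weak_grad_sub Omega Omega' u g : Omega' `<=` Omega ->
  weak_grad Omega u g -> weak_grad Omega' u g.
Proof.
move=> sO [lu lg eg]; split.
- by move=> K cK KO; apply: lu => //; exact: subset_trans sO.
- by move=> w K cK KO; apply: lg => //; exact: subset_trans sO.
- move=> phi w tp; have [K [sp cK KO p0]] := test_functionE tp.
  have tp' : test_function Omega phi.
    by apply: (test_functionI (K := K)) => //; exact: subset_trans sO.
  have := eg phi w tp'.
  rewrite (Rintegral_sub sO); last first.
    by move=> z _ nz; rewrite (D_zero _ (compact_closedE cK) p0) ?mulr0// => /KO.
  move=> ->; congr (- _); apply/esym; apply: Rintegral_sub => //.
  by move=> z _ nz; rewrite p0 ?mulr0// => /KO.
Qed.

End fund.

(** * Integrability of the weight near the boundary *)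

Section power_weight.
Context {R : realType} {N : nat}.
Local Notation E := ('rV[R]_N * R)%type.
Local Notation lpt := (@Defs.lebesgue_pt R N).
Local Notation leb := (@lebesgue_measure R).

Lemma powR_cont (a t : R) : 0 < t -> {for t, continuous (fun y : R => y `^ a)}.
Proof.
move=> t0; apply: differentiable_continuous; apply/derivable1_diffP.
by have [] := is_derive1_powR a t0.
Qed.

Lemma integral_powR_itv (a c r : R) : -1 < a -> 0 < c -> c < r ->
  (\int[leb]_(y in `[c, r]) (y `^ a)%:E <= (r `^ (a + 1) / (a + 1))%:E)%E.
Proof.
move=> a1 c0 cr; have a0 : 0 < a + 1 by lra.
pose F (y : R) := (a + 1)^-1 * y `^ (a + 1).
have dF (y : R) : 0 < y -> is_derive y 1 F (y `^ a).
  move=> y0; have D := is_derive1_powR (a + 1) y0.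
  have := is_deriveZ (a + 1)^-1 D.
  by rewrite /GRing.scale/= mulrA mulVf ?gt_eqF// mul1r addrK.
have cF (y : R) : 0 < y -> {for y, continuous F}.
  by move=> y0; apply: differentiable_continuous; apply/derivable1_diffP; have [] := dF y y0.
rewrite (@continuous_FTC2 _ _ F)//.
- rewrite -EFinB lee_fin /F mulrC gerBl.
  by rewrite mulr_ge0 ?powR_ge0// invr_ge0 ltW.
- apply: continuous_in_subspaceT => y; rewrite inE/= in_itv/= => /andP[cy _].
  by apply: powR_cont; exact: lt_le_trans cy.
- split.
  + move=> y; rewrite in_itv/= => /andP[cy _].
    by have [] := dF y (lt_trans c0 cy).
  + by apply: cvg_at_right_filter; apply: cF.
  + by apply: cvg_at_left_filter; apply: cF; exact: lt_trans cr.
- move=> y; rewrite in_itv/= => /andP[cy _].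
  by rewrite derive1E; have [_ ->] := dF y (lt_trans c0 cy).
Qed.

(** Monotone convergence along the intervals [r/(n+2), r], on which the integral is at
    most r^(a+1)/(a+1). *)
Lemma integral_powR0 (a r : R) : -1 < a -> 0 < r ->
  (\int[leb]_(y in `]0%R, r]) (y `^ a)%:E < +oo)%E.
Proof.
move=> a1 r0.
pose c (n : nat) : R := r / n.+2%:R.
have c0 n : 0 < c n by rewrite divr_gt0.
have cr n : c n < r by rewrite ltr_pdivrMr// ltr_pMr// ltr1n.
pose F (n : nat) : set R := `[c n, r]%classic.
have FU : `]0, r]%classic = \bigcup_n F n.
  apply/seteqP; split=> [y|y [n _]]; rewrite /F /= ?in_itv/=; last first.
    by move=> /andP[cy ->]; rewrite (lt_le_trans (c0 n) cy).
  move=> /andP[y0 yr]; exists (Num.truncn (r / y)) => //; rewrite /F/= in_itv/= yr andbT.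
  rewrite ler_pdivrMr// mulrC -ler_pdivrMr//; apply: ltW.
  apply: (lt_le_trans (truncnS_gt _)); by rewrite ler_nat.
have mp D : measurable_fun D (fun y : R => (y `^ a)%:E).
  by apply: measurable_funTS; apply/measurable_EFinP; exact: measurable_powR.
have ndF : nondecreasing_seq F.
  move=> n m nm; apply/subsetPset => y; rewrite /F/= !in_itv/= => /andP[cy ->].
  rewrite andbT; apply: le_trans cy.
  by rewrite ler_pM2l// lef_pV2 ?posrE// ler_nat !ltnS.
have L := @ge0_nondecreasing_set_cvg_integral _ (measurableTypeR R) R F (fun y => (y `^ a)%:E) leb ndF
  (fun n => measurable_itv _) (fun n => mp _) (fun n x _ => powR_ge0 x a).
rewrite FU; apply: (@le_lt_trans _ _ (r `^ (a + 1) / (a + 1))%:E); last exact: ltry.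
rewrite -(cvg_lim _ L)//; apply: lime_le; first by apply/cvg_ex; eexists; exact: L.
by apply: nearW => n; exact: integral_powR_itv.
Qed.

Definition cyl (r : R) : set E := half_space `&` cbox r.

Lemma measurable_cyl r : measurable (cyl r).
Proof. by apply: measurableI; [exact: measurable_half_space|exact: measurable_cbox]. Qed.

Lemma measurable_wt (a : R) (D : set E) : measurable_fun D (fun z : E => z.2 `^ a).
Proof.
apply: measurable_funTS.
by apply: (measurableT_comp (@measurable_powR R a)); exact: measurable_coord2.
Qed.

Lemma integrable_wt (a r : R) : -1 < a -> 0 < r ->
  lpt.-integrable (cyl r) (EFin \o (fun z : E => z.2 `^ a)).
Proof.
move=> a1 r0; apply/integrableP; split.
  by apply/measurable_EFinP; exact: measurable_wt.
pose A := [set x : 'rV[R]_N | forall i, `[- r, r]%classic (x ord0 i)].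
pose B : set R := `]0, r]%classic.
have mA : measurable A by exact: (@measurable_box R N (fun=> `[- r, r]%classic)).
have mB : measurable B by exact: measurable_itv.
pose g (y : R) : \bar R := (\1_B y * y `^ a)%:E.
have mg : measurable_fun setT g.
  apply/measurable_EFinP; apply: measurable_funM; first exact: measurable_indic.
  exact: measurable_powR.
have g0 y : (0 <= g y)%E by rewrite lee_fin mulr_ge0 ?powR_ge0.
pose F (z : E) : \bar R := ((\1_A z.1)%:E * g z.2)%E.
have F0 z : (0 <= F z)%E by rewrite mule_ge0// lee_fin.
have mF : measurable_fun setT F.
  apply: emeasurable_funM.
    have mi : measurable_fun setT (\1_A : 'rV[R]_N -> R) by exact: measurable_indic.
    by apply/measurable_EFinP; apply: (measurableT_comp mi); exact: measurable_fst.
  by apply: (measurableT_comp mg); exact: measurable_snd.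
have -> : (\int[lpt]_(z in cyl r) `|(EFin \o (fun z : E => (z.2 `^ a)%R)) z| =
    \int[lebesgue_rV N \x leb]_z F z)%E.
  rewrite integral_mkcond; apply: eq_integral => z _.
  rewrite /patch /F /g /= !indicE.
  have -> : (z \in cyl r) = (z.1 \in A) && (z.2 \in B).
    apply/idP/idP; rewrite ?inE.
      rewrite /cyl cboxE => -[z0 [zA]]; rewrite /= in_itv/= => /andP[_ zr].
      by apply/andP; split; rewrite inE// /B/= in_itv/= z0.
    move=> /andP[]; rewrite !inE /B/= in_itv/= => zA /andP[z0 zr].
    split=> //; rewrite cboxE; split=> //; rewrite /= in_itv/= zr andbT; lra.
  case: (z.1 \in A); case: (z.2 \in B); rewrite ?mul0e ?mul1e ?mul0r ?mule0 ?mul1r//=.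
  by rewrite ger0_norm// powR_ge0.
rewrite fubini_tonelli2//.
have Ey y : (fubini_G (lebesgue_rV N) F y = lebesgue_rV N A * g y)%E.
  rewrite /fubini_G /F /=.
  rewrite ge0_integralZr//; last first.
    by apply/measurable_EFinP; exact: measurable_indic.
  by rewrite integral_indic// setIT.
rewrite (@eq_integral _ _ _ leb setT (fun y => (lebesgue_rV N A * g y)%E)); last first.
  by move=> y _; exact: Ey.
rewrite ge0_integralZl//.
have fA : lebesgue_rV N A \is a fin_num.
  have := @lebesgue_rV_box R N (fun=> `[- r, r]%classic) (fun=> measurable_itv _).
  move=> /= ->; rewrite prode_fin_num// => i _.
  by rewrite lebesgue_measure_itv; case: ifP.
apply: lte_mul_pinfty => //.
have := integral_powR0 a1 r0; congr (_ < _)%E; rewrite [LHS]integral_mkcond.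
apply: eq_integral => y _; rewrite /g /patch indicE /B.
by case: (y \in _); rewrite ?mul1r ?mul0r.
Qed.

Lemma integrable_wt_bounded (a r M : R) (D : set E) (f : E -> R) : -1 < a -> 0 < r ->
  measurable D -> D `<=` cyl r -> measurable_fun D f ->
  (forall z, D z -> `|f z| <= M) ->
  lpt.-integrable D (EFin \o (fun z => z.2 `^ a * f z)).
Proof.
move=> a1 r0 mD Dr mf fM.
have wi : lpt.-integrable D (EFin \o (fun z : E => z.2 `^ a)).
  exact: (@integrableS _ _ _ lpt (cyl r) D _ (measurable_cyl r) mD Dr (integrable_wt a1 r0)).
have := @integrableMl _ _ _ lpt D mD (EFin \o (fun z : E => z.2 `^ a)) f wi mf.
apply; exists M; split; first exact: num_real.
by move=> x Mx z Kz; apply: (le_trans (fM _ Kz)); exact: ltW.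
Qed.

End power_weight.

(** * The weighted Laplacian *)

Section basis.
Context {R : realType} {N : nat}.
Local Notation E := ('rV[R]_N * R)%type.
Implicit Types (f g phi psi : E -> R) (z w e : E).

Definition ey : E := (0, 1).
Definition ex (i : 'I_N) : E := (delta_mx ord0 i, 0).
Definition bas : seq E := ey :: [seq ex i | i <- index_enum 'I_N].

Lemma sum_bas (F : E -> R) : \sum_(e <- bas) F e = F ey + \sum_(i < N) F (ex i).
Proof. by rewrite /bas big_cons big_map. Qed.

Lemma dot_ey z : dot z ey = z.2.
Proof. by rewrite /dot /= mulr1 big1 ?add0r// => i _; rewrite mxE mulr0. Qed.

Lemma dot_ex z i : dot z (ex i) = z.1 ord0 i.
Proof.
rewrite /dot /= mulr0 addr0 (bigD1 i)//= mxE !eqxx mulr1 big1 ?addr0// => j ji.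
by rewrite mxE (negbTE ji) andbF mulr0.
Qed.

Lemma dot_grad z phi w : dot w (grad phi z) = \sum_(e <- bas) dot w e * 'D_e phi z.
Proof.
rewrite sum_bas dot_ey {1}/dot /= addrC; congr (_ + _).
by apply: eq_bigr => i _; rewrite dot_ex mxE.
Qed.

Lemma dot_bas w : dot w w = \sum_(e <- bas) dot w e ^+ 2.
Proof.
rewrite sum_bas dot_ey {1}/dot /= addrC expr2; congr (_ + _).
by apply: eq_bigr => i _; rewrite dot_ex expr2.
Qed.

Lemma derive_mul f g z w : derivable f z w -> derivable g z w ->
  'D_w (fun x => f x * g x) z = f z * 'D_w g z + g z * 'D_w f z.
Proof. by move=> df dg; apply: etrans (deriveM df dg) _. Qed.

Lemma is_derive_y z w : is_derive z w (fun z : E => z.2) w.2.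
Proof. exact: is_derive_linear. Qed.

Lemma is_derive_x i z w : is_derive z w (fun z : E => z.1 ord0 i) (w.1 ord0 i).
Proof. by apply: is_derive_linear => a u v; rewrite !mxE. Qed.

(** The operator y^-a div(y^a grad phi); the vectors bas are the coordinate directions. *)
Definition Lop (a : R) phi z : R :=
  \sum_(e <- bas) 'D_e ('D_e phi) z + a / z.2 * 'D_ey phi z.

End basis.

Section CT.
Context {R : realType} {V : normedModType R}.
Implicit Types (f : V -> R) (z w : V).

Lemma CT_continuous f z : (forall n, Cn n setT f) -> {for z, continuous f}.
Proof. by move=> /(_ 0%N) Cf; apply: (@Cn_continuous R V 0%N setT). Qed.

Lemma CT_derivable f z w : (forall n, Cn n setT f) -> derivable f z w.
Proof. by move=> /(_ 1%N) Cf; apply: (@Cn_derivable R V 0%N setT). Qed.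

Lemma CT_D f w : (forall n, Cn n setT f) -> forall n, Cn n setT ('D_w f).
Proof. by move=> Cf n; apply: CnD; exact: Cf. Qed.

Lemma CT_continuousD f w z : (forall n, Cn n setT f) -> {for z, continuous ('D_w f)}.
Proof. by move=> Cf; apply: CT_continuous; exact: CT_D. Qed.

End CT.

Section cutoff.
Context {R : realType}.
Implicit Types (a t y : R).

(** The weight y^a, made smooth across y = 0 by a step at height about 1/(n+1). *)
Definition wcut a (n : nat) y : R := if 0 < y then step (n.+1%:R * y) * y `^ a else 0.

Lemma wcut0 a n y : y <= n.+1%:R^-1 -> wcut a n y = 0.
Proof.
move=> yn; rewrite /wcut; case: ifPn => // y0; rewrite step0 ?mul0r//.
by rewrite mulrC -ler_pdivlMr// mul1r.
Qed.

Lemma wcutE a n y : 0 < y -> wcut a n y = step (n.+1%:R * y) * y `^ a.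
Proof. by rewrite /wcut => ->. Qed.

Lemma wcut_ge0 a n y : 0 <= wcut a n y.
Proof. by rewrite /wcut; case: ifP => // _; rewrite mulr_ge0 ?step_ge0 ?powR_ge0. Qed.

Lemma wcut_le a n y : 0 < y -> wcut a n y <= y `^ a.
Proof. by move=> y0; rewrite wcutE// ler_piMl ?powR_ge0 ?step_le1. Qed.

Lemma Cn_wcut a n m : Cn m setT (wcut a n).
Proof.
have -> : [set: R] = [set y : R | 0 < y] `|` [set y : R | y < n.+1%:R^-1].
  apply/esym/seteqP; split=> // y _; have [y0|y0] := ltrP 0 y; first by left.
  by right; rewrite /= (le_lt_trans y0)// invr_gt0.
apply: Cn_setU.
  apply: (@Cn_eq R R m _ (fun y => step (n.+1%:R * y) * y `^ a)); first exact: open_gt.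
    by move=> y y0; rewrite wcutE.
  apply: Cn_mul; first exact: open_gt.
    apply: (@Cn_sub _ _ m setT) => //.
    have := @Cn_affine R R m step n.+1%:R 0 (Cn_step m).
    by under eq_fun do rewrite addr0.
  by apply: Cn_powR => //; exact: open_gt.
apply: (@Cn_eq R R m _ (fun=> 0)); first exact: open_lt.
  by move=> y /= /ltW yn; rewrite wcut0.
by apply: Cn_cst; exact: open_lt.
Qed.

Lemma wcut_D a n y : 0 < y -> 'D_1 (wcut a n) y =
  n.+1%:R * 'D_1 step (n.+1%:R * y) * y `^ a + step (n.+1%:R * y) * (a * y `^ (a - 1)).
Proof.
move=> y0.
rewrite (@near_eq_derive _ _ _ _ (fun y => step (n.+1%:R * y) * y `^ a)); last first.
  by apply: (open_near (@open_gt R 0) y0) => t /= t0; rewrite wcutE.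
have [dp ep] := is_derive1_powR a y0.
have ds : derivable step (n.+1%:R *: y + 0) 1 by exact: (CT_derivable (fun n => Cn_step n)).
have [ds1 es] := is_derive_affine ds.
have E : (fun x : R => step (n.+1%:R *: x + 0)) = (fun x => step (n.+1%:R * x)).
  by apply/funext => x; rewrite addr0.
rewrite E in ds1 es.
apply: etrans (deriveM ds1 dp) _; rewrite ep es addr0.
by rewrite /GRing.scale/=; ring.
Qed.

Lemma step_D_bound : exists2 S : R, 0 <= S & forall t : R, 0 <= t -> t * `|'D_1 step t| <= S.
Proof.
have cD : continuous ('D_1 step : R -> R).
  by move=> t; exact: (CT_continuousD (fun n => Cn_step n)).
have /compact_bounded[M [_ h]] := continuous_compact (continuous_subspaceT cD) (@segment_compact R 0 2).
have hM t : 0 <= t <= 2 -> `|'D_1 step t| <= `|M| + 1.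
  move=> t02; apply: (h (`|M| + 1)); first by rewrite (le_lt_trans (ler_norm M)) ?ltrDl.
  by exists t => //; rewrite /= in_itv.
exists (2 * (`|M| + 1)) => [|t t0]; first by rewrite mulr_ge0// addr_ge0.
have [t2|t2] := lerP t 2.
  by apply: ler_pM => //; apply: hM; rewrite t0 t2.
rewrite (@near_eq_derive _ _ _ step (cst 1)) ?derive_cst ?normr0 ?mulr0 ?mulr_ge0 ?addr_ge0//.
by apply: (open_near (@open_gt R 2) t2) => x /= /ltW x2; rewrite step1.
Qed.

(** The derivative of the truncated weight is of order y^(a-1), uniformly in n.
    Multiplied by a function that is O(y) it is dominated by the integrable weight y^a. *)
Lemma wcut_D_bound a : exists2 S : R, 0 <= S &
  forall n y, 0 < y -> y * `|'D_1 (wcut a n) y| <= S * y `^ a.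
Proof.
have [S S0 hS] := step_D_bound.
exists (S + `|a|) => [|n y y0]; first by rewrite addr_ge0.
rewrite wcut_D//.
have pE : y `^ (a - 1) = y `^ a / y.
  by rewrite powRB ?powRr1 ?(ltW y0)// (gt_eqF y0) implybT.
rewrite pE; set s := step _; set d := 'D_1 step _; set p := y `^ a.
have p0 : 0 <= p by exact: powR_ge0.
have d1 : y * `|n.+1%:R * d * p| <= S * p.
  rewrite normrM (ger0_norm p0) mulrA ler_wpM2r// normrM ger0_norm// mulrA.
  by rewrite [y * _]mulrC; apply: hS; rewrite mulr_ge0// ltW.
have d2 : y * `|s * (a * (p / y))| <= `|a| * p.
  have -> : y * `|s * (a * (p / y))| = `|s| * (`|a| * p).
    rewrite !normrM (ger0_norm p0) (ger0_norm (ltW _ : 0 <= y^-1)) ?invr_gt0//.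
    by field; rewrite gt_eqF.
  by rewrite ler_piMl ?mulr_ge0// ger0_norm ?step_ge0// step_le1.
apply: le_trans (_ : y * (`|n.+1%:R * d * p| + `|s * (a * (p / y))|) <= _).
  by rewrite ler_pM2l// ler_normD.
by rewrite mulrDr mulrDl lerD.
Qed.

End cutoff.

(** * A positive solution tested against the weighted Laplacian *)

Section key.
Context {R : realType} {N : nat}.
Local Notation E := ('rV[R]_N * R)%type.
Local Notation lpt := (@Defs.lebesgue_pt R N).
Implicit Types (f u v phi psi : E -> R) (g : E -> E) (z w e : E).
Local Notation ey := (@ey R N).
Local Notation bas := (@bas R N).

Lemma Rintegral_sum (D : set E) (I : Type) (s : seq I) (F : I -> E -> R) :
  measurable D -> (forall i, lpt.-integrable D (EFin \o F i)) ->
  lpt.-integrable D (EFin \o (fun z => \sum_(i <- s) F i z)) /\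
  \int[lpt]_(z in D) (\sum_(i <- s) F i z) = \sum_(i <- s) \int[lpt]_(z in D) F i z.
Proof.
move=> mD Fi; elim: s => [|i s [IH1 IH2]].
  have -> : (fun z => \sum_(i <- [::]) F i z) = (fun=> 0) by apply/funext => z; rewrite big_nil.
  split; first exact: (@integrable0 _ _ _ lpt D).
  by rewrite big_nil /Rintegral integral0.
have -> : (fun z => \sum_(j <- i :: s) F j z) = (fun z => F i z + \sum_(j <- s) F j z).
  by apply/funext => z; rewrite big_cons.
split.
  have := @integrableD _ _ _ lpt D mD _ _ (Fi i) IH1.
  by apply: eq_integrable => // z _; rewrite /= EFinD.
by rewrite (@RintegralD _ _ _ lpt)// big_cons IH2.
Qed.

Lemma integrable_ext (A B : set E) f : measurable A -> measurable B -> A `<=` B ->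
  lpt.-integrable A (EFin \o f) -> (forall z, B z -> ~ A z -> f z = 0) ->
  lpt.-integrable B (EFin \o f).
Proof.
move=> mA mB AB /(@integrable_mkcond _ _ _ lpt A (EFin \o f) mA) H f0.
have := @integrableS _ _ _ lpt setT B _ measurableT mB (@subsetT _ _) H.
apply: eq_integrable => // z zB; rewrite /patch; case: ifPn => //= zA.
by rewrite f0//; [rewrite inE in zB|rewrite notin_setE in zA].
Qed.

Lemma half_ball_measurable (r : R) f : 0 < r -> loc_integrable (half_ball r) f ->
  measurable_fun (half_ball r) f.
Proof.
move=> r0 lf; have [zeta [tz zn0]] := @half_ball_exhaust R N r r0.
have [K hK] := choice (fun n => test_functionE (tz n)).
have -> : half_ball r = \bigcup_n K n.
  apply/seteqP; split=> [z Bz|z [n _ Kz]]; last by have [_ _ KB _] := hK n; exact: KB.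
  have [n zn] := zn0 z Bz; exists n => //; apply: contrapT => nK.
  by have [_ _ _ h] := hK n; rewrite h// eqxx in zn.
apply/measurable_fun_bigcup => n; first by have [_ cK _ _] := hK n; exact: compact_measurableE.
have [_ cK KB _] := hK n.
by apply/measurable_EFinP; have := lf _ cK KB; exact: measurable_int.
Qed.

Lemma measurable_half_ball (r : R) : 0 < r -> measurable (half_ball r : set E).
Proof.
move=> r0; rewrite half_ballE//; apply: open_measurableE.
have -> : [set z : E | 0 < z.2 /\ sq 0 z < r ^+ 2] =
   half_space `&` [set z : E | sq 0 z < r ^+ 2] by [].
apply: openI; first exact: open_half_space.
have -> : [set z : E | sq 0 z < r ^+ 2] = sq 0 @^-1` [set t : R | t < r ^+ 2] by [].
apply: open_comp; last exact: open_lt.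
by move=> z _; exact: (Cn_continuous (Cn_sq 0 0)).
Qed.

Lemma cyl_half_ball (r : R) : 0 < r -> exists2 rho, 0 < rho & cyl r `<=` (half_ball rho : set E).
Proof.
move=> r0; exists (N.+2%:R * r); first by rewrite mulr_gt0.
rewrite half_ballE ?mulr_gt0// => z [z0 [z1 z2]]; split=> //.
have sq_le (t : R) : `|t| <= r -> t ^+ 2 <= r ^+ 2.
  by move=> tr; rewrite -real_normK ?num_real// ler_sqr ?nnegrE// ltW.
have h : sq 0 z <= N%:R * r ^+ 2 + r ^+ 2.
  rewrite /sq lerD//; last by rewrite subr0; exact: sq_le.
  have -> : N%:R * r ^+ 2 = \sum_(i < N) r ^+ 2 by rewrite sumr_const card_ord mulr_natl.
  by apply: ler_sum => i _; rewrite mxE subr0; exact: sq_le.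
apply: (le_lt_trans h); rewrite exprMn -[N.+2]addn2 natrD.
have n0 : 0 <= N%:R :> R by [].
have : 0 < r ^+ 2 by rewrite exprn_gt0.
set k : R := N%:R in n0 *; set q := r ^+ 2; nra.
Qed.

(** By |t| <= t^2 + 1, applied to the components of the gradient, the product is dominated
    by a multiple of the energy density and of the weight. The energy bound concerns another weak gradient, equal to g
    almost everywhere. *)
Lemma energy_integrable (a r : R) u g : 0 < r -> -1 < a ->
  H1a a (half_ball r) u -> weak_grad (half_ball r) u g ->
  forall (D : set E) phi (M : R), measurable D -> D `<=` half_ball r ->
  (exists2 r', 0 < r' & D `<=` cyl r') ->
  smooth phi -> (forall e z, e \in bas -> D z -> `|'D_e phi z| <= M) ->
  lpt.-integrable D (EFin \o (fun z => z.2 `^ a * dot (g z) (grad phi z))).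
Proof.
move=> r0 a1 [g' [wg' Efin]] wg D phi M mD DB [r' r'0 Dr'] sphi hM.
have mB := measurable_half_ball r0.
have mu' : measurable_fun (half_ball r) u by apply: half_ball_measurable => //; case: wg.
have mdot g0 : weak_grad (half_ball r) u g0 -> forall e, measurable_fun D (fun z => dot (g0 z) e).
  move=> [_ lg _] e; apply: measurable_funS mB DB _.
  by apply: half_ball_measurable => //; exact: lg.
have mw : measurable_fun D (fun z : E => z.2 `^ a) by exact: measurable_wt.
have mDphi e : measurable_fun D ('D_e phi).
  by apply: measurable_funTS; apply: continuous_measurableT; apply: smooth_continuous; exact: smooth_D.
have mF g0 : weak_grad (half_ball r) u g0 ->
    measurable_fun D (fun z => z.2 `^ a * dot (g0 z) (grad phi z)).
  move=> wg0; apply: measurable_funM => //.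
  under eq_fun do rewrite dot_grad.
  by apply: measurable_sum => e; apply: measurable_funM => //; exact: mdot.
pose Q z := z.2 `^ a * (u z ^+ 2 + dot (g' z) (g' z)).
have Q0 z : 0 <= Q z.
  by rewrite mulr_ge0 ?powR_ge0// addr_ge0 ?sqr_ge0// dot_sq sq_ge0.
have iQ : lpt.-integrable D (EFin \o Q).
  apply/integrableP; split.
    apply/measurable_EFinP; apply: measurable_funM => //; apply: measurable_funD.
      by apply: measurable_funX; apply: measurable_funS mB DB mu'.
    under eq_fun do rewrite dot_bas.
    by apply: measurable_sum => e; apply: measurable_funX; exact: mdot.
  apply: le_lt_trans Efin.
  rewrite (_ : (\int[lpt]_(z in D) `|(EFin \o Q) z|)%E = (\int[lpt]_(z in D) (Q z)%:E)%E); last first.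
    by apply: eq_integral => z _; rewrite /= ger0_norm.
  apply: (@ge0_subset_integral _ _ _ lpt) => //; last by move=> z _; rewrite lee_fin.
  apply/measurable_EFinP; apply: measurable_funM; first exact: measurable_wt.
  apply: measurable_funD; first exact: measurable_funX.
  under eq_fun do rewrite dot_bas.
  apply: measurable_sum => e; apply: measurable_funX.
  by apply: half_ball_measurable => //; case: wg'.
have iW : lpt.-integrable D (EFin \o (fun z : E => z.2 `^ a)).
  exact: (@integrableS _ _ _ lpt (cyl r') D _ (measurable_cyl r') mD Dr' (integrable_wt a1 r'0)).
pose C : R := `|M|.
have i' : lpt.-integrable D (EFin \o (fun z => z.2 `^ a * dot (g' z) (grad phi z))).
  have iG : lpt.-integrable D (EFin \o (fun z => C * Q z + C * N.+1%:R * z.2 `^ a)).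
    have := @integrableD _ _ _ lpt D mD _ _ (@integrableZl _ _ _ lpt D mD C _ iQ)
      (@integrableZl _ _ _ lpt D mD (C * N.+1%:R) _ iW).
    by apply: eq_integrable => // z _; rewrite /= EFinD !EFinM.
  apply: (@le_integrable _ _ _ lpt D mD _ _ _ _ iG).
    by apply/measurable_EFinP; exact: mF.
  move=> z Dz; rewrite /= lee_fin.
  rewrite [leRHS]ger0_norm; last first.
    have C0 : 0 <= C by exact: normr_ge0.
    apply: addr_ge0; apply: mulr_ge0 => //; [exact: mulr_ge0|exact: powR_ge0].
  rewrite normrM (ger0_norm (powR_ge0 _ _)) /Q dot_grad dot_bas.
  have p0 : 0 <= z.2 `^ a by exact: powR_ge0.
  suff h : `|\sum_(e <- bas) dot (g' z) e * 'D_e phi z| <=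
      C * (u z ^+ 2 + \sum_(e <- bas) dot (g' z) e ^+ 2) + C * N.+1%:R.
    apply: le_trans (ler_wpM2l p0 h) _.
    by rewrite le_eqVlt; apply/orP; left; apply/eqP; ring.
  have sN : \sum_(e <- bas) (1 : R) = N.+1%:R.
    by rewrite sum_bas sumr_const card_ord -natr1 addrC.
  have h1 : `|\sum_(e <- bas) dot (g' z) e * 'D_e phi z| <=
      \sum_(e <- bas) C * (dot (g' z) e ^+ 2 + 1).
    apply: le_trans (ler_norm_sum _ _ _) _.
    rewrite big_seq [leRHS]big_seq; apply: ler_sum => e eb.
    rewrite normrM mulrC; apply: ler_pM => //.
      by apply: le_trans (hM _ _ eb Dz) _; exact: ler_norm.
    rewrite -[in leRHS]real_normK ?num_real//.
    have := sqr_ge0 (`|dot (g' z) e| - 1); rewrite sqrrB1; have := normr_ge0 (dot (g' z) e); nra.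
  apply: (le_trans h1); rewrite -mulr_sumr big_split/= sN mulrDr lerD2r.
  by apply: ler_wpM2l; [exact: normr_ge0|rewrite lerDr sqr_ge0].
have aeq : ae_eq lpt D (fun z => (`|z.2 `^ a * dot (g z) (grad phi z)|)%:E)
                      (fun z => (`|z.2 `^ a * dot (g' z) (grad phi z)|)%:E).
  have H (n : nat) := weak_grad_unique r0 wg wg' (nth 0 bas n).
  have [A [mA A0 sA]] : {ae lpt, forall z, D z -> forall e, e \in bas -> dot (g z) e = dot (g' z) e}.
    have /ae_foralln := H.
    apply: filterS => z hz Dz e eb; have := hz (index e bas) (DB _ Dz).
    by rewrite nth_index.
  exists A; split=> //; apply: subset_trans sA => z /= nz hz; apply: nz => Dz.
  congr (`| _ * _|)%:E; rewrite !dot_grad big_seq [RHS]big_seq.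
  by apply: eq_bigr => e eb; rewrite hz.
apply/integrableP; split; first by apply/measurable_EFinP; exact: mF.
have /integrableP[_] := i'.
rewrite (_ : (\int[lpt]_(z in D) `|(EFin \o (fun z => (z.2 `^ a * dot (g' z) (grad phi z))%R)) z|)%E =
  (\int[lpt]_(z in D) `|(EFin \o (fun z => (z.2 `^ a * dot (g z) (grad phi z))%R)) z|)%E)//.
apply: (@ae_eq_integral _ _ _ lpt D _ _ mD).
- by apply/measurable_EFinP; apply: measurableT_comp => //; exact: mF.
- by apply/measurable_EFinP; apply: measurableT_comp => //; exact: mF.
- exact: ae_eq_sym.
Qed.

Lemma is_derive_line (f : E -> R) (t : R) (w z : E) :
  derivable f (t *: w + z) w ->
  is_derive t 1 (fun s : R => f (s *: w + z)) ('D_w f (t *: w + z)).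
Proof.
move=> df.
have Eq : (fun h : R => h^-1 *: (((fun s : R => f (s *: w + z)) \o shift t) (h *: 1) - f (t *: w + z))) =
    (fun h : R => h^-1 *: ((f \o shift (t *: w + z)) (h *: w) - f (t *: w + z))).
  by apply/funext => h /=; rewrite [_%:A]mulr1 scalerDl addrA.
by apply: DeriveDef; rewrite ?/derivable ?/derive Eq.
Qed.

(** The normal derivative vanishes on the boundary, so it is O(y) by the mean value
    theorem; this makes (a/y) phi_y bounded. *)
Lemma Dy_small (r M : R) phi : smooth phi -> (forall x, 'D_ey phi (x, 0) = 0) ->
  (forall z, cbox r z -> `|'D_ey ('D_ey phi) z| <= M) ->
  forall z, cyl r z -> `|'D_ey phi z| <= M * z.2.
Proof.
move=> sphi D0 hM [x y] [/= y0 [x1 /= y1]].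
have sD := smooth_D ey sphi.
pose h (t : R) := 'D_ey phi (t *: ey + (x, 0)).
have pE (t : R) : t *: ey + (x, 0) = (x, t) :> E.
  by rewrite /ey; congr pair => /=; rewrite ?scaler0 ?add0r// addr0 [_ *: _]mulr1.
have dh (t : R) : is_derive t 1 h ('D_ey ('D_ey phi) (t *: ey + (x, 0))).
  by apply: (is_derive_line (f := 'D_ey phi)); exact: smooth_derivable.
have [c /[!in_itv]/= /andP[c0 cy]] := @MVT R h _ 0 y y0 (fun t _ => dh t)
   (continuous_subspaceT (fun t => differentiable_continuous ((derivable1_diffP _ _).1 (@ex_derive _ _ _ _ _ _ _ (dh t))))).
rewrite /h !pE D0 !subr0 => ->.
rewrite normrM (gtr0_norm y0) ler_pM2r//; apply: hM; split=> //=.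
rewrite gtr0_norm//; apply: ltW; apply: (lt_le_trans cy).
by move: y1; rewrite gtr0_norm.
Qed.

(** The definition of the weak gradient moves derivatives onto test functions supported
    in the open half space. It is applied to the truncated weight times each derivative of
    phi; as the truncation is removed, the left-hand sides converge to the integral of
    u y^a L phi, because phi_y = O(y), and the right-hand sides to minus the integral of
    y^a grad u . grad phi. The equation turns the latter into the integral of u v^2 phi over
    the boundary, which is nonnegative. *)
Theorem subsolution_test (a : R) u v phi : -1 < a ->
  {within closed_half_space, continuous u} -> H1a_loc a u -> weak_equation a u v ->
  (forall z, closed_half_space z -> 0 < u z) ->
  test_function setT phi -> (forall x, 0 <= phi (x, 0)) ->
  (forall x, 'D_ey phi (x, 0) = 0) ->
  lpt.-integrable half_space (EFin \o (fun z => u z * (z.2 `^ a * Lop a phi z))) /\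
  0 <= \int[lpt]_(z in half_space) (u z * (z.2 `^ a * Lop a phi z)).
Proof.
move=> a1 cu Hu [g [wg eqg]] u0 tphi phi0 D0.
have [K [sphi cK _ K0]] := test_functionE tphi.
have clK := compact_closedE cK.
have [r r0 Kr] := compact_sub_cbox cK.
have mH := @measurable_half_space R N.
have mC := @measurable_cyl R N r.
have CH : cyl r `<=` (half_space : set E) by move=> z [].
have offK z : half_space z -> ~ cyl r z -> ~ K z.
  by move=> hz nz /Kr Kz; apply: nz; split.
have [Mu hMu] := within_bounded r cu.
pose lap z := \sum_(e <- bas) 'D_e ('D_e phi) z.
have clap : continuous lap.
  have H : Cn 0 setT lap.
    by apply: Cn_sum; [exact: openT|move=> e; exact: (smoothP _).1 (smooth_D e (smooth_D e sphi)) 0%N].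
  by move=> z; exact: (@Cn_continuous R _ 0%N setT).
have [M1 hM1] := continuous_bounded (@compact_cbox R N r) clap.
have [M2 hM2] := continuous_bounded (@compact_cbox R N r)
  (smooth_continuous (smooth_D ey (smooth_D ey sphi))).
have hDy := Dy_small sphi D0 hM2.
have [S S0 hS] := wcut_D_bound a.
(* The e-th component of the truncated field y^a grad phi. *)
pose Phi n e z := wcut a n z.2 * 'D_e phi z.
have sPhi n e : smooth (Phi n e).
  apply/smoothP => m; apply: Cn_mulT.
    by apply: Cn_compT; [exact: Cn_wcut|exact: Cn_y].
  exact: (smoothP _).1 (smooth_D e sphi) m.
have Phi0 n e z : ~ K z -> Phi n e z = 0.
  by move=> nK; rewrite /Phi (D_zero _ clK K0)// mulr0.
have tPhi n e : test_function half_space (Phi n e).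
  pose Kn := K `&` [set z : E | n.+1%:R^-1 <= z.2].
  have clKn : closed Kn.
    by apply: closedI => //; apply: closed_ge_cont => z; exact: cvg_snd.
  apply: (test_functionI (K := Kn)) => //.
  - by apply: (subclosed_compact clKn cK) => z [].
  - by move=> z [_ /=]; apply: lt_le_trans; rewrite invr_gt0.
  - move=> z /not_andP[nK|/negP]; first exact: Phi0.
    by rewrite -ltNge => /ltW zn; rewrite /Phi wcut0// mul0r.
pose A n z := \sum_(e <- bas) u z * 'D_e (Phi n e) z.
pose B n z := \sum_(e <- bas) dot (g z) e * Phi n e z.
have [lu lg eg] := wg.
have iA n e : lpt.-integrable half_space (EFin \o (fun z => u z * 'D_e (Phi n e) z)).
  have [K' [_ cK' K'H K'0]] := test_functionE (tPhi n e).
  apply: (integrable_supp mH cK' K'H) => //.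
  - by apply: smooth_continuous; exact: smooth_D.
  - exact: D_zero (compact_closedE cK') K'0.
  - exact: lu.
have iB n e : lpt.-integrable half_space (EFin \o (fun z => dot (g z) e * Phi n e z)).
  have [K' [_ cK' K'H K'0]] := test_functionE (tPhi n e).
  apply: (integrable_supp mH cK' K'H) => //.
  - exact: smooth_continuous.
  - exact: lg.
have AB n : \int[lpt]_(z in cyl r) A n z = - \int[lpt]_(z in cyl r) B n z.
  rewrite (Rintegral_sub CH); last first.
    move=> z hz /(offK _ hz) nK; rewrite /A big1// => e _.
    by rewrite (D_zero _ clK (Phi0 n e))// mulr0.
  rewrite (Rintegral_sub CH (f := B n)); last first.
    by move=> z hz /(offK _ hz) nK; rewrite /B big1// => e _; rewrite Phi0// mulr0.
  rewrite (Rintegral_sum bas mH (iA n)).2 (Rintegral_sum bas mH (iB n)).2 -sumrN.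
  by apply: eq_bigr => e _; exact: eg.
have AE n z : half_space z -> A n z =
    u z * (wcut a n z.2 * lap z + 'D_1 (wcut a n) z.2 * 'D_ey phi z).
  move=> hz; rewrite /A -mulr_sumr; congr (_ * _).
  have dw e : is_derive z e (fun z : E => wcut a n z.2) ('D_1 (wcut a n) z.2 * e.2).
    have [dy ey'] := is_derive_y z e.
    have := @is_derive_comp1 R _ (wcut a n) (fun z : E => z.2) z e dy
       (CT_derivable (fun m => Cn_wcut a n m)).
    by rewrite ey'.
  have E1 e : 'D_e (Phi n e) z = wcut a n z.2 * 'D_e ('D_e phi) z +
      'D_1 (wcut a n) z.2 * (e.2 * 'D_e phi z).
    have [d1 e1] := dw e.
    rewrite /Phi (derive_mul d1 (smooth_derivable (smooth_D e sphi))) e1.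
    by ring.
  under eq_bigr do rewrite E1.
  rewrite big_split/= -mulr_sumr -mulr_sumr; congr (_ + _ * _).
  by rewrite sum_bas /= mul1r big1 ?addr0// => i _; rewrite mul0r.
pose Ainf z := u z * (z.2 `^ a * Lop a phi z).
pose Binf z := z.2 `^ a * dot (g z) (grad phi z).
have mu_ : measurable_fun (cyl r) u.
  apply: (measurable_funS mH CH); apply: continuous_measurableE.
    exact: open_half_space.
  by move=> z hz; exact: within_half_space.
have cD e : continuous ('D_e phi) by apply: smooth_continuous; exact: smooth_D.
have mLop : measurable_fun (cyl r) (Lop a phi).
  apply: measurable_funD.
    by apply: measurable_funTS; exact: continuous_measurableT.
  apply: measurable_funM; last by apply: measurable_funTS; exact: continuous_measurableT.
  apply: measurable_funM; first exact: measurable_cst.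
  apply: (measurable_funS mH CH); apply: continuous_measurableE.
    exact: open_half_space.
  move=> z hz; apply: (@continuous_comp _ _ _ snd (fun t : R => t^-1)); first exact: cvg_snd.
  by apply: inv_continuous; rewrite gt_eqF.
have far (y : R) : 0 < y -> \forall n \near \oo, 2 < n.+1%:R * y.
  move=> y0; near=> n.
  have : 2 / y <= n%:R by near: n; exact: nbhs_infty_ger.
  rewrite ler_pdivrMr// => /le_lt_trans; apply.
  by rewrite ltr_pM2r// ltr_nat.
have [iAinf limA] : lpt.-integrable (cyl r) (EFin \o Ainf) /\
    (\int[lpt]_(z in cyl r) A n z) @[n --> \oo] --> \int[lpt]_(z in cyl r) Ainf z.
  apply: (@Rdominated _ _ R lpt (cyl r) mC A Ainf
    (fun z => `|Mu| * (`|M1| + `|M2| * S) * z.2 `^ a)).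
  - move=> n; apply/measurable_EFinP; apply: (measurable_funS mH CH).
    exact: measurable_int (Rintegral_sum bas mH (iA n)).1.
  - by apply: measurable_funM => //; apply: measurable_funM => //; exact: measurable_wt.
  - move=> z [hz _]; apply: cvg_near_cst.
    have := far _ hz; apply: filterS => n hn; rewrite AE//.
    rewrite wcut_D// wcutE// step1 ?(ltW hn)// !mul1r.
    rewrite (@near_eq_derive _ _ _ step (cst 1)) ?derive_cst; last first.
      by apply: (open_near (@open_gt R 2) hn) => x /= /ltW x2; rewrite step1.
    rewrite mulr0 mul0r add0r /Ainf /Lop -/(lap z); congr (_ * _).
    have -> : z.2 `^ (a - 1) = z.2 `^ a / z.2.
      by rewrite powRB ?powRr1 ?(ltW hz)// (gt_eqF hz) implybT.
    by ring.
  - have := @integrableZl _ _ _ lpt (cyl r) mC (`|Mu| * (`|M1| + `|M2| * S)) _ (integrable_wt a1 r0).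
    by apply: eq_integrable => // z _; rewrite /= EFinM.
  - move=> n z cz; have [hz bz] := cz; rewrite AE//.
    have p0 : 0 <= z.2 `^ a by exact: powR_ge0.
    rewrite normrM -mulrA; apply: ler_pM => //.
      by apply: le_trans (hMu z bz (ltW hz)) _; exact: ler_norm.
    apply: (le_trans (ler_normD _ _)); rewrite mulrDl; apply: lerD.
      rewrite normrM mulrC; apply: ler_pM => //.
        by apply: le_trans (hM1 z bz) _; exact: ler_norm.
      by rewrite ger0_norm ?wcut_ge0//; exact: wcut_le.
    rewrite normrM -mulrA; apply: (@le_trans _ _ (`|'D_1 (wcut a n) z.2| * (`|M2| * z.2))).
      apply: ler_wpM2l => //; apply: (le_trans (hDy z cz)).
      by rewrite ler_pM2r// ler_norm.
    rewrite mulrCA ler_wpM2l// mulrC; exact: hS.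
have [rho rho0 Crho] := @cyl_half_ball r r0.
have wgr : weak_grad (half_ball rho) u g.
  by apply: weak_grad_sub wg => z [].
have iBinf : lpt.-integrable (cyl r) (EFin \o Binf).
  pose F z := \sum_(e <- bas) `|'D_e phi z|.
  have cF : continuous F.
    have H : Cn 0 setT F.
      apply: Cn_sum; [exact: openT|move=> e; split=> // z _].
      by apply: cvg_norm; exact: cD.
    by move=> z; exact: (@Cn_continuous R _ 0%N setT).
  have [M hM] := continuous_bounded (@compact_cbox R N r) cF.
  apply: (energy_integrable (M := M) rho0 a1 (Hu rho rho0) wgr mC Crho) => //.
    by exists r.
  move=> e z eb [_ bz]; apply: le_trans (hM z bz).
  have F0 : 0 <= F z by apply: sumr_ge0.
  by rewrite (ger0_norm F0) /F (big_rem e)//= lerDl sumr_ge0.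
have BE n z : B n z = wcut a n z.2 * dot (g z) (grad phi z).
  by rewrite /B dot_grad mulr_sumr; apply: eq_bigr => e _; rewrite /Phi mulrCA.
have [_ limB] : lpt.-integrable (cyl r) (EFin \o Binf) /\
    (\int[lpt]_(z in cyl r) B n z) @[n --> \oo] --> \int[lpt]_(z in cyl r) Binf z.
  apply: (@Rdominated _ _ R lpt (cyl r) mC B Binf (fun z => `|Binf z|)).
  - move=> n; apply/measurable_EFinP; apply: (measurable_funS mH CH).
    exact: measurable_int (Rintegral_sum bas mH (iB n)).1.
  - by apply/measurable_EFinP; exact: measurable_int iBinf.
  - move=> z [hz _]; apply: cvg_near_cst.
    have := far _ hz; apply: filterS => n hn; rewrite BE wcutE// step1 ?(ltW hn)// mul1r.
    by [].
  - exact: (@integrable_norm _ _ _ lpt).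
  - move=> n z [hz _]; rewrite BE /Binf !normrM ler_wpM2r//.
    by rewrite !ger0_norm ?powR_ge0 ?wcut_ge0//; exact: wcut_le.
have AB' : \int[lpt]_(z in cyl r) Ainf z = - \int[lpt]_(z in cyl r) Binf z.
  move: limA; under eq_cvg do rewrite AB.
  by move=> /(cvg_unique (@norm_hausdorff _ R^o)); apply; exact: cvgN limB.
have A0 z : half_space z -> ~ cyl r z -> Ainf z = 0.
  move=> hz /(offK _ hz) nK; rewrite /Ainf /Lop big1 ?add0r => [|e _]; last first.
    by rewrite (D_zero _ clK (D_zero _ clK K0)).
  by rewrite (D_zero _ clK K0)// !mulr0.
have B0 z : half_space z -> ~ cyl r z -> Binf z = 0.
  move=> hz /(offK _ hz) nK; rewrite /Binf dot_grad big1 ?mulr0// => e _.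
  by rewrite (D_zero _ clK K0)// mulr0.
split; first exact: (integrable_ext mC mH CH iAinf A0).
have := eqg phi tphi; rewrite -(Rintegral_sub CH A0) AB' -(Rintegral_sub CH B0).
move=> /eqP; rewrite addr_eq0 => /eqP ->; rewrite opprK.
apply: Rintegral_ge0 => x _; rewrite mulr_ge0// mulr_ge0 ?sqr_ge0//.
by apply: ltW; apply: u0; rewrite /closed_half_space/=.
Unshelve. all: by end_near. Qed.

End key.

(** * Comparison of weighted masses *)

Section comparison.
Context {R : realType} {N : nat}.
Local Notation E := ('rV[R]_N * R)%type.
Local Notation lpt := (@Defs.lebesgue_pt R N).
Implicit Types (u v phi : E -> R) (z w e : E) (S T : set E).
Local Notation ey := (@ey R N).
Local Notation bas := (@bas R N).

Lemma derive_scale (c : R) (f : E -> R) z w : derivable f z w ->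
  'D_w (fun x => c * f x) z = c * 'D_w f z.
Proof.
move=> df; have E1 := derive_mul (derivable_cst c z w) df.
have E2 : 'D_w (cst c : E -> R) z = 0 by exact: derive_cst.
by move: E1; rewrite E2 mulr0 addr0.
Qed.

Definition mass (a : R) u S : R := \int[lpt]_(z in S) (z.2 `^ a * u z).

(** The inverse of w |-> x0 + l w, so that scaled x0 l S is the set x0 + l S. *)
Definition dil (x0 : 'rV[R]_N) (l : R) z : E := l^-1 *: z + (- (l^-1 *: x0), 0).

Definition scaled (x0 : 'rV[R]_N) (l : R) S : set E := [set z | S (dil x0 l z)].

Lemma dil1 x0 l z i : (dil x0 l z).1 ord0 i = l^-1 * (z.1 ord0 i - x0 ord0 i).
Proof. by rewrite /dil /= !mxE mulrBr. Qed.

Lemma dil2 x0 l z : (dil x0 l z).2 = l^-1 * z.2.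
Proof. by rewrite /dil /= addr0. Qed.

Lemma continuous_dil x0 l : continuous (dil x0 l).
Proof.
by move=> z; apply: cvgD; [apply: cvgZl_tmp; exact: cvg_id|exact: cvg_cst].
Qed.

Lemma open_scaled x0 l S : open S -> open (scaled x0 l S).
Proof.
move=> oS; have -> : scaled x0 l S = dil x0 l @^-1` S by [].
by apply: open_comp => // z _; exact: continuous_dil.
Qed.

Lemma scaled_half x0 l S : 0 < l -> S `<=` half_space -> scaled x0 l S `<=` half_space.
Proof.
by move=> l0 SH z /SH; rewrite /half_space /mkset dil2 pmulr_rgt0 ?invr_gt0.
Qed.

Lemma scaled_cbox x0 l r S : 0 < l -> S `<=` cbox r ->
  exists2 r', 0 < r' & scaled x0 l S `<=` cbox r'.
Proof.
move=> l0 Sr; pose X := \sum_i `|x0 ord0 i|.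
have X0 : 0 <= X by apply: sumr_ge0.
exists (l * `|r| + X + 1); first by rewrite ltr_pwDr// addr_ge0// mulr_ge0// ltW.
move=> z /Sr[h1 h2]; split=> [i|].
  have := h1 i; rewrite dil1 normrM gtr0_norm ?invr_gt0// ler_pdivrMl// => h.
  have xi : `|x0 ord0 i| <= X by rewrite /X (bigD1 i)//= lerDl sumr_ge0.
  have lr : l * r <= l * `|r| by rewrite ler_pM2l// ler_norm.
  have : `|z.1 ord0 i| <= `|z.1 ord0 i - x0 ord0 i| + `|x0 ord0 i|.
    by rewrite -[in leLHS](subrK (x0 ord0 i) (z.1 ord0 i)) ler_normD.
  by move=> ?; lra.
move: h2; rewrite dil2 normrM gtr0_norm ?invr_gt0// ler_pdivrMl// => h.
have lr : l * r <= l * `|r| by rewrite ler_pM2l// ler_norm.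
by lra.
Qed.

Lemma integrable_mass (a : R) u S r : -1 < a -> {within closed_half_space, continuous u} ->
  measurable S -> S `<=` half_space -> S `<=` cbox r ->
  lpt.-integrable S (EFin \o (fun z => z.2 `^ a * u z)).
Proof.
move=> a1 cu mS SH Sr.
have [M hM] := within_bounded r cu.
have Sc : S `<=` cyl (`|r| + 1).
  move=> z Sz; split; first exact: SH.
  have [h1 h2] := Sr z Sz; have rr : r <= `|r| + 1 by have := ler_norm r; lra.
  by split=> [i|]; [exact: le_trans (h1 i) rr|exact: le_trans h2 rr].
apply: (@integrable_wt_bounded _ _ a (`|r| + 1) M S u) => //.
- apply: (measurable_funS (@measurable_half_space R N) SH); apply: continuous_measurableE.
    exact: open_half_space.
  by move=> z hz; exact: within_half_space.
- by move=> z Sz; apply: hM; [exact: Sr|apply: ltW; exact: SH].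
Qed.

Lemma mass_ge0 (a : R) u S : S `<=` closed_half_space ->
  (forall z, closed_half_space z -> 0 < u z) -> 0 <= mass a u S.
Proof.
move=> SH u0; apply: Rintegral_ge0 => z Sz.
by rewrite mulr_ge0 ?powR_ge0// ltW// u0//; exact: SH.
Qed.

Lemma mass_le (a : R) u S T r : -1 < a -> {within closed_half_space, continuous u} ->
  (forall z, closed_half_space z -> 0 < u z) ->
  measurable S -> measurable T -> S `<=` T -> T `<=` half_space -> T `<=` cbox r ->
  mass a u S <= mass a u T.
Proof.
move=> a1 cu u0 mS mT ST TH Tr.
have iT := integrable_mass a1 cu mT TH Tr.
have iS := integrable_mass a1 cu mS (subset_trans ST TH) (subset_trans ST Tr).
rewrite /mass /Rintegral fine_le//.
- exact: (@integrable_fin_num _ _ _ lpt S mS).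
- exact: (@integrable_fin_num _ _ _ lpt T mT).
- apply: (@ge0_subset_integral _ _ _ lpt) => //; first exact: measurable_int iT.
  by move=> z Tz; rewrite lee_fin mulr_ge0 ?powR_ge0// ltW// u0//; apply: ltW; exact: TH.
Qed.

Lemma derive_dil phi x0 l w z : smooth phi ->
  'D_w (fun z => phi (dil x0 l z)) z = l^-1 * 'D_w phi (dil x0 l z).
Proof.
move=> sphi; have [_ ->//] := @is_derive_affine R _ phi l^-1 (- (l^-1 *: x0), 0) z w
  (smooth_derivable sphi).
Qed.

Lemma smooth_dil phi x0 l : smooth phi -> smooth (fun z => phi (dil x0 l z)).
Proof. by move=> /smoothP sphi; apply/smoothP => n; apply: Cn_affine. Qed.

Lemma Lop_dil (a : R) phi x0 l z : smooth phi -> 0 < l -> half_space z ->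
  Lop a (fun z => phi (dil x0 l z)) z = l^-1 ^+ 2 * Lop a phi (dil x0 l z).
Proof.
move=> sphi l0 hz; rewrite /Lop mulrDr mulr_sumr derive_dil//; congr (_ + _).
  apply: eq_bigr => e _.
  have -> : 'D_e (fun z => phi (dil x0 l z)) = (fun z => l^-1 * 'D_e phi (dil x0 l z)).
    by apply/funext => w; rewrite derive_dil.
  rewrite (derive_scale l^-1 (smooth_derivable (smooth_dil x0 l (smooth_D e sphi)))).
  by rewrite (derive_dil x0 l e z (smooth_D e sphi)) mulrA expr2.
by rewrite dil2; field; rewrite !gt_eqF.
Qed.

(** The inequality is tested with phi composed with dil; L is homogeneous of degree -2,
    which rescales both sides by the same factor. *)
Theorem mass_comparison (a : R) u v phi (K c : R) S T r : -1 < a ->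
  {within closed_half_space, continuous u} -> H1a_loc a u -> weak_equation a u v ->
  (forall z, closed_half_space z -> 0 < u z) ->
  test_function setT phi -> (forall x, 0 <= phi (x, 0)) ->
  (forall x, 'D_ey phi (x, 0) = 0) ->
  open S -> open T -> S `<=` half_space -> T `<=` half_space ->
  S `<=` cbox r -> T `<=` cbox r ->
  (forall z, half_space z -> Lop a phi z <= K * \1_S z - c * \1_T z) ->
  forall x0 l, 0 < l -> c * mass a u (scaled x0 l T) <= K * mass a u (scaled x0 l S).
Proof.
move=> a1 cu Hu wu u0 tphi phi0 D0 oS oT SH TH Sr Tr hL x0 l l0.
have [Q [sphi cQ _ Q0]] := test_functionE tphi.
pose psi z := phi (dil x0 l z).
have li0 : 0 < l^-1 by rewrite invr_gt0.
have spsi : smooth psi by exact: smooth_dil.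
have tpsi : test_function setT psi.
  pose b : E := (- (l^-1 *: x0), 0).
  apply: (test_functionI (K := (fun z => l *: (z - b)) @` Q)) => //.
    apply: continuous_compact => //; apply: continuous_subspaceT => z.
    by apply: cvgZl_tmp; apply: cvgB; [exact: cvg_id|exact: cvg_cst].
  move=> z nz; apply: Q0 => Qz; apply: nz; exists (dil x0 l z) => //.
  by rewrite /dil addrK scalerA mulfV ?gt_eqF// scale1r.
have dil0 x : dil x0 l (x, 0) = (l^-1 *: x - l^-1 *: x0, 0).
  by rewrite /dil; congr pair => /=; rewrite ?addr0// [_ *: _]mulr0.
have [iL L0] := subsolution_test a1 cu Hu wu u0 tpsi
  (fun x => eq_ind_r (fun t => 0 <= phi t) (phi0 _) (dil0 x))
  (fun x => etrans (derive_dil x0 l ey (x, 0) sphi)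
     (etrans (congr1 (fun t => l^-1 * 'D_ey phi t) (dil0 x))
        (etrans (congr1 (fun t => l^-1 * t) (D0 _)) (mulr0 _)))).
have mH := @measurable_half_space R N.
have side X : open X -> X `<=` half_space -> X `<=` cbox r ->
    lpt.-integrable half_space (EFin \o (fun z => z.2 `^ a * u z * \1_(scaled x0 l X) z)) /\
    \int[lpt]_(z in half_space) (z.2 `^ a * u z * \1_(scaled x0 l X) z) =
      mass a u (scaled x0 l X).
  move=> oX XH Xr; have [r' r'0 Xr'] := scaled_cbox x0 l0 Xr.
  have mX : measurable (scaled x0 l X) by apply: open_measurableE; exact: open_scaled.
  have XH' := scaled_half (x0 := x0) l0 XH.
  have iX := integrable_mass a1 cu mX XH' Xr'.
  have z0 z : half_space z -> ~ scaled x0 l X z -> z.2 `^ a * u z * \1_(scaled x0 l X) z = 0.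
    by move=> _ nX; rewrite indicE memNset// mulr0.
  split.
    apply: (integrable_ext mX mH XH' _ z0).
    by apply: eq_integrable iX => // z zX; rewrite /= indicE zX mulr1.
  rewrite -(Rintegral_sub XH' z0); apply: eq_Rintegral => z zX.
  by rewrite indicE zX mulr1.
have [iS eS] := side S oS SH Sr; have [iT eT] := side T oT TH Tr.
have iD : lpt.-integrable half_space (EFin \o (fun z =>
    K * (z.2 `^ a * u z * \1_(scaled x0 l S) z) - c * (z.2 `^ a * u z * \1_(scaled x0 l T) z))).
  have := @integrableB _ _ _ lpt half_space mH _ _ (@integrableZl _ _ _ lpt _ mH K _ iS)
    (@integrableZl _ _ _ lpt _ mH c _ iT).
  by apply: eq_integrable => // z _; rewrite /= EFinB !EFinM.
have le1 : \int[lpt]_(z in half_space) (u z * (z.2 `^ a * Lop a psi z)) <=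
   \int[lpt]_(z in half_space) (l^-1 ^+ 2 *
    (K * (z.2 `^ a * u z * \1_(scaled x0 l S) z) - c * (z.2 `^ a * u z * \1_(scaled x0 l T) z))).
  apply: (@le_Rintegral _ _ _ lpt) => //.
    have := @integrableZl _ _ _ lpt _ mH (l^-1 ^+ 2) _ iD.
    by apply: eq_integrable => // z _; rewrite /= EFinM.
  move=> z hz; rewrite Lop_dil//.
  have hd : half_space (dil x0 l z) by rewrite /half_space /mkset dil2 mulr_gt0.
  have uz : 0 <= z.2 `^ a * u z.
    by rewrite mulr_ge0 ?powR_ge0// ltW// u0//; exact: ltW.
  have -> : u z * (z.2 `^ a * (l^-1 ^+ 2 * Lop a phi (dil x0 l z))) =
     l^-1 ^+ 2 * (z.2 `^ a * u z * Lop a phi (dil x0 l z)) by ring.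
  rewrite ler_pM2l ?exprn_gt0//.
  have := ler_wpM2l uz (hL _ hd).
  have ind X : \1_X (dil x0 l z) = \1_(scaled x0 l X) z :> R.
    by rewrite !indicE; congr (_ %:R); apply/idP/idP; rewrite !inE.
  rewrite !ind => /le_trans; apply; rewrite le_eqVlt; apply/orP; left; apply/eqP; ring.
move: (le_trans L0 le1); rewrite (@RintegralZl _ _ _ lpt)//.
rewrite pmulr_rge0 ?exprn_gt0//.
have iKS : lpt.-integrable half_space (EFin \o (fun z => K * (z.2 `^ a * u z * \1_(scaled x0 l S) z))).
  have := @integrableZl _ _ _ lpt _ mH K _ iS.
  by apply: eq_integrable => // z _; rewrite /= EFinM.
have icT : lpt.-integrable half_space (EFin \o (fun z => c * (z.2 `^ a * u z * \1_(scaled x0 l T) z))).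
  have := @integrableZl _ _ _ lpt _ mH c _ iT.
  by apply: eq_integrable => // z _; rewrite /= EFinM.
rewrite (@RintegralB _ _ _ lpt)// subr_ge0.
by rewrite (@RintegralZl _ _ _ lpt)// (@RintegralZl _ _ _ lpt)// eS eT.
Qed.

End comparison.

(** * Diffusion calculus *)

Local Opaque derive Cn.

Ltac ring_derive := repeat match goal with
  | |- context [@derive ?K ?V ?W ?f ?z ?e] => generalize (@derive K V W f z e : (K : Type)) => ?
  end; ring.

Section calculus.
Context {R : realType} {N : nat}.
Local Notation E := ('rV[R]_N * R)%type.
Implicit Types (f g phi : E -> R) (z w e c : E) (U : set E) (h : R -> R).
Local Notation ey := (@ey R N).
Local Notation bas := (@bas R N).

Lemma sum_lin2 (J : Type) (r : seq J) (p q : R) (A B : J -> R) :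
  \sum_(i <- r) (p * A i + q * B i) = p * \sum_(i <- r) A i + q * \sum_(i <- r) B i.
Proof. by rewrite big_split /= -!mulr_sumr. Qed.

Lemma sum_lin3 (J : Type) (r : seq J) (p q t : R) (A B C : J -> R) :
  \sum_(i <- r) (p * A i + q * B i + t * C i) =
  p * \sum_(i <- r) A i + q * \sum_(i <- r) B i + t * \sum_(i <- r) C i.
Proof. by rewrite !big_split /= -!mulr_sumr. Qed.

(** The carre du champ grad f . grad g. *)
Definition Gam f g z : R := \sum_(e <- bas) 'D_e f z * 'D_e g z.

Lemma GamC f g z : Gam f g z = Gam g f z.
Proof. by apply: eq_bigr => e _; rewrite mulrC. Qed.

Lemma D_mul U f g e z : U z -> Cn 1 U f -> Cn 1 U g ->
  'D_e (fun x => f x * g x) z = f z * 'D_e g z + g z * 'D_e f z.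
Proof. by move=> Uz Cf Cg; rewrite derive_mul//; apply: (@Cn_derivable R _ 0%N U). Qed.

Lemma D_add U f g e z : U z -> Cn 1 U f -> Cn 1 U g ->
  'D_e (fun x => f x + g x) z = 'D_e f z + 'D_e g z.
Proof.
by move=> Uz Cf Cg; rewrite -(@deriveD _ _ _ f g)//; apply: (@Cn_derivable R _ 0%N U).
Qed.

Lemma D_comp U (W : set R) h f e z : U z -> (forall x, U x -> W (f x)) ->
  Cn 1 W h -> Cn 1 U f -> 'D_e (fun x => h (f x)) z = 'D_1 h (f z) * 'D_e f z.
Proof.
move=> Uz UI Ch Cf; have df : derivable f z e by apply: (@Cn_derivable R _ 0%N U).
have dh : derivable h (f z) 1 by apply: (@Cn_derivable R R 0%N W) => //; exact: UI.
by have [_ ->] := is_derive_comp1 df dh.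
Qed.

Lemma D_near U f g e z : open U -> U z -> (forall x, U x -> f x = g x) ->
  'D_e f z = 'D_e g z.
Proof. by move=> oU Uz fg; apply: near_eq_derive; exact: open_near fg. Qed.

Lemma D2_near U f g e z : open U -> U z -> (forall x, U x -> f x = g x) ->
  'D_e ('D_e f) z = 'D_e ('D_e g) z.
Proof. by move=> oU Uz fg; apply: (D_near e oU Uz) => x Ux; exact: (D_near e oU Ux fg). Qed.

Lemma Lop_eq (a : R) f z F k : (forall e, 'D_e ('D_e f) z = F e) -> 'D_ey f z = k ->
  Lop a f z = \sum_(e <- bas) F e + a / z.2 * k.
Proof. by move=> h <-; rewrite /Lop (eq_bigr _ (fun e _ => h e)). Qed.

Lemma Lop_near (a : R) U f g z : open U -> U z -> (forall x, U x -> f x = g x) ->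
  Lop a f z = Lop a g z.
Proof.
move=> oU Uz fg; rewrite (Lop_eq a (fun e => D2_near e oU Uz fg) (D_near ey oU Uz fg)).
by [].
Qed.

Lemma Lop_add (a : R) U f g z : open U -> U z -> Cn 2 U f -> Cn 2 U g ->
  Lop a (fun x => f x + g x) z = Lop a f z + Lop a g z.
Proof.
move=> oU Uz Cf Cg; have [Cf1 Cg1] := (CnW Cf, CnW Cg).
have D2 e : 'D_e ('D_e (fun x => f x + g x)) z = 'D_e ('D_e f) z + 'D_e ('D_e g) z.
  rewrite (@D_near U _ (fun x => 'D_e f x + 'D_e g x) e z oU Uz); last first.
    by move=> x Ux; rewrite (D_add e Ux Cf1 Cg1).
  exact: (D_add e Uz (CnD e Cf) (CnD e Cg)).
apply: etrans (Lop_eq a D2 (D_add ey Uz Cf1 Cg1)) _.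
rewrite big_split /=; have alg (A B k v w : R) : A + B + k * (v + w) =
  (A + k * v) + (B + k * w) by ring.
exact: alg.
Qed.

Lemma Lop_mul (a : R) U f g z : open U -> U z -> Cn 2 U f -> Cn 2 U g ->
  Lop a (fun x => f x * g x) z = f z * Lop a g z + g z * Lop a f z + 2 * Gam f g z.
Proof.
move=> oU Uz Cf Cg; have [Cf1 Cg1] := (CnW Cf, CnW Cg).
have D2 e : 'D_e ('D_e (fun x => f x * g x)) z =
    f z * 'D_e ('D_e g) z + g z * 'D_e ('D_e f) z + 2 * ('D_e f z * 'D_e g z).
  rewrite (@D_near U _ (fun x => f x * 'D_e g x + g x * 'D_e f x) e z oU Uz); last first.
    by move=> x Ux; rewrite (D_mul e Ux Cf1 Cg1).
  have [Df Dg] := (CnD e Cf, CnD e Cg).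
  rewrite (D_add e Uz (Cn_mul oU Cf1 Dg) (Cn_mul oU Cg1 Df)).
  rewrite (D_mul e Uz Cf1 Dg) (D_mul e Uz Cg1 Df).
  have alg (p q r t v w : R) : (p * q + r * t) + (v * w + t * r) = p * q + v * w + 2 * (t * r) by ring.
  exact: alg.
apply: etrans (Lop_eq a D2 (D_mul ey Uz Cf1 Cg1)) _.
apply: etrans (congr1 (+%R^~ _) _) _; first exact: (sum_lin3 bas (f z) (g z) 2
  (fun e => 'D_e ('D_e g) z) (fun e => 'D_e ('D_e f) z) (fun e => 'D_e f z * 'D_e g z)).
have alg (p q A B C k v w : R) : p * A + q * B + 2 * C + k * (p * v + q * w) =
  p * (A + k * v) + q * (B + k * w) + 2 * C by ring.
exact: alg.
Qed.

Lemma Lop_comp (a : R) U (W : set R) h f z : open U -> open W -> U z ->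
  (forall x, U x -> W (f x)) -> Cn 2 W h -> Cn 2 U f ->
  Lop a (fun x => h (f x)) z =
    'D_1 h (f z) * Lop a f z + 'D_1 ('D_1 h) (f z) * Gam f f z.
Proof.
move=> oU oW Uz UI Ch Cf; have [Ch1 Cf1] := (CnW Ch, CnW Cf).
have D2 e : 'D_e ('D_e (fun x => h (f x))) z =
    'D_1 h (f z) * 'D_e ('D_e f) z + 'D_1 ('D_1 h) (f z) * ('D_e f z * 'D_e f z).
  rewrite (@D_near U _ (fun x => 'D_1 h (f x) * 'D_e f x) e z oU Uz); last first.
    by move=> x Ux; rewrite (D_comp e Ux UI Ch1 Cf1).
  have Dh : Cn 1 W ('D_1 h) := @CnD R R 1 W h 1 Ch.
  have Df := CnD e Cf.
  have Chf : Cn 1 U (fun x => 'D_1 h (f x)) by apply: (Cn_comp oU oW Dh).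
  rewrite (D_mul e Uz Chf Df) (D_comp e Uz UI Dh Cf1).
  have alg (p q r t : R) : p * q + r * (t * r) = p * q + t * (r * r) by ring.
  exact: alg.
apply: etrans (Lop_eq a D2 (D_comp ey Uz UI Ch1 Cf1)) _.
apply: etrans (congr1 (+%R^~ _) _) _; first exact: (sum_lin2 bas ('D_1 h (f z)) ('D_1 ('D_1 h) (f z))
  (fun e => 'D_e ('D_e f) z) (fun e => 'D_e f z * 'D_e f z)).
have alg (p q A B k v : R) : p * A + q * B + k * (p * v) = p * (A + k * v) + q * B by ring.
exact: alg.
Qed.

Lemma Gam_compr U (W : set R) h f g z : open U -> U z ->
  (forall x, U x -> W (f x)) -> Cn 1 W h -> Cn 1 U f ->
  Gam g (fun x => h (f x)) z = 'D_1 h (f z) * Gam g f z.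
Proof.
move=> oU Uz UI Ch Cf; rewrite /Gam mulr_sumr; apply: eq_bigr => e _.
by rewrite (D_comp e Uz UI Ch Cf); ring_derive.
Qed.

Lemma Gam_mulr U f g k z : U z -> Cn 1 U f -> Cn 1 U g ->
  Gam k (fun x => f x * g x) z = f z * Gam k g z + g z * Gam k f z.
Proof.
move=> Uz Cf Cg; rewrite /Gam !mulr_sumr -big_split/=; apply: eq_bigr => e _.
by rewrite (D_mul e Uz Cf Cg); ring_derive.
Qed.

Lemma Lop_cst (a k : R) z : Lop a (fun=> k) z = 0.
Proof.
have D0 e x : 'D_e (fun=> k : R) x = 0 by exact: (@derive_cst _ E R k x e).
rewrite /Lop D0 mulr0 addr0 big1// => e _.
rewrite (@D_near setT _ (fun=> 0) e z openT I); last by move=> x _; exact: D0.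
exact: (@derive_cst _ E R 0 z e).
Qed.

Lemma Lop_scale (a k : R) U f z : open U -> U z -> Cn 2 U f ->
  Lop a (fun x => k * f x) z = k * Lop a f z.
Proof.
move=> oU Uz Cf; rewrite (Lop_mul a oU Uz (Cn_cst 2 k oU) Cf) Lop_cst mulr0 addr0.
rewrite /Gam big1 ?mulr0 ?addr0// => e _.
by rewrite (@derive_cst _ E R k z e) mul0r.
Qed.

Lemma Gam_CS f g z : Gam f g z ^+ 2 <= Gam f f z * Gam g g z.
Proof.
rewrite /Gam; elim: bas => [|e s IH]; first by rewrite !big_nil expr0n mulr0.
rewrite !big_cons; set A := \sum_(_ <- _) _ * _ in IH *.
set B := \sum_(_ <- _) _ in IH *; set C := \sum_(_ <- _) _ in IH *.
set p := 'D_e f z; set q := 'D_e g z.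
have B0 : 0 <= B by apply: sumr_ge0 => i _; rewrite -expr2 sqr_ge0.
have C0 : 0 <= C by apply: sumr_ge0 => i _; rewrite -expr2 sqr_ge0.
suff h : 2 * (p * q * A) <= p ^+ 2 * C + q ^+ 2 * B.
  have -> : (p * q + A) ^+ 2 = p ^+ 2 * q ^+ 2 + 2 * (p * q * A) + A ^+ 2 by ring.
  have -> : (p * p + B) * (q * q + C) = p ^+ 2 * q ^+ 2 + (p ^+ 2 * C + q ^+ 2 * B) + B * C by ring.
  by rewrite lerD// lerD2l.
have X0 : 0 <= p ^+ 2 * C + q ^+ 2 * B by rewrite addr_ge0// mulr_ge0// sqr_ge0.
apply: le_trans (ler_norm _) _.
rewrite -ler_sqr ?nnegrE// real_normK ?num_real//.
have -> : (2 * (p * q * A)) ^+ 2 = 4 * (p ^+ 2 * q ^+ 2) * A ^+ 2 by ring.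
apply: (@le_trans _ _ (4 * (p ^+ 2 * q ^+ 2) * (B * C))).
  by rewrite ler_wpM2l// mulr_ge0// mulr_ge0// sqr_ge0.
rewrite -subr_ge0.
have -> : (p ^+ 2 * C + q ^+ 2 * B) ^+ 2 - 4 * (p ^+ 2 * q ^+ 2) * (B * C) =
  (p ^+ 2 * C - q ^+ 2 * B) ^+ 2 by ring.
exact: sqr_ge0.
Qed.

(** With al = 1 the squared distance to c, with al = 0 the squared horizontal distance;
    the condition al^2 = al of Gam_quad covers both. *)
Definition quad (al : R) c z : R :=
  \sum_(i < N) (z.1 ord0 i - c.1 ord0 i) ^+ 2 + al * (z.2 - c.2) ^+ 2.

Lemma Cn_quad n al c : Cn n setT (quad al c).
Proof.
apply: Cn_addT.
  apply: Cn_sum; first exact: openT.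
  move=> i; apply: Cn_sqr; apply: Cn_addT; [exact: Cn_x|exact: Cn_cstT].
apply: Cn_mulT; first exact: Cn_cstT.
apply: Cn_sqr; apply: Cn_addT; [exact: Cn_y|exact: Cn_cstT].
Qed.

Lemma D_sqr_sub f (k : R) e z : Cn 1 setT f ->
  'D_e (fun x => (f x - k) ^+ 2) z = 2 * (f z - k) * 'D_e f z.
Proof.
move=> Cf; have Cfk : Cn 1 setT (fun x => f x - k) := Cn_addT Cf (Cn_cstT 1 (- k)).
have -> : (fun x => (f x - k) ^+ 2) = (fun x => (f x - k) * (f x - k)).
  by apply/funext => x; rewrite expr2.
rewrite (@D_mul setT _ _ e z I Cfk Cfk) (@D_add setT _ _ e z I Cf (Cn_cstT 1 (- k))).
by rewrite (@derive_cst _ E R (- k) z e); ring_derive.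
Qed.

Lemma D_sum (J : Type) (s : seq J) (F : J -> E -> R) e z : (forall i, Cn 1 setT (F i)) ->
  'D_e (fun x => \sum_(i <- s) F i x) z = \sum_(i <- s) 'D_e (F i) z.
Proof.
move=> CF; elim: s => [|i s IH].
  rewrite big_nil (@D_near setT _ (fun=> 0) e z openT I); last by move=> x _; rewrite big_nil.
  exact: (@derive_cst _ E R 0 z e).
have CS : Cn 1 setT (fun x => \sum_(j <- s) F j x) by apply: Cn_sum => //; exact: openT.
rewrite big_cons -IH -(@D_add setT _ _ e z I (CF i) CS).
by apply: (@D_near setT _ _ e z openT I) => x _; rewrite big_cons.
Qed.

Lemma D_quad al c e z : 'D_e (quad al c) z =
  2 * (\sum_(i < N) (z.1 ord0 i - c.1 ord0 i) * e.1 ord0 i + al * (z.2 - c.2) * e.2).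
Proof.
have Cxi i : Cn 1 setT (fun x : E => (x.1 ord0 i - c.1 ord0 i) ^+ 2).
  by apply: Cn_sqr; apply: Cn_addT; [exact: Cn_x|exact: Cn_cstT].
have Cy2 : Cn 1 setT (fun x : E => (x.2 - c.2) ^+ 2).
  by apply: Cn_sqr; apply: Cn_addT; [exact: Cn_y|exact: Cn_cstT].
have CS : Cn 1 setT (fun x : E => \sum_(i < N) (x.1 ord0 i - c.1 ord0 i) ^+ 2).
  by apply: Cn_sum => //; exact: openT.
have CY : Cn 1 setT (fun x : E => al * (x.2 - c.2) ^+ 2).
  exact: (Cn_mulT (Cn_cstT 1 al) Cy2).
rewrite /quad (@D_add setT _ _ e z I CS CY).
rewrite (derive_scale al (@Cn_derivable R _ 0%N setT _ z e Cy2 I)).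
rewrite (D_sum _ e z Cxi) (D_sqr_sub c.2 e z (Cn_y 1)).
have [_ ->] := is_derive_y z e.
rewrite [RHS]mulrDr [X in _ = X + _]mulr_sumr; congr (_ + _); last by ring.
apply: eq_bigr => i _; rewrite (D_sqr_sub _ e z (Cn_x 1 i)).
by have [_ ->] := is_derive_x i z e; ring.
Qed.

Lemma D2_quad al c e z : 'D_e ('D_e (quad al c)) z =
  2 * (\sum_(i < N) e.1 ord0 i ^+ 2 + al * e.2 ^+ 2).
Proof.
pose L (x : E) : R := 2 * (\sum_(i < N) x.1 ord0 i * e.1 ord0 i + al * x.2 * e.2).
rewrite (@D_near setT _ (fun x => L x + - L c) e z openT I); last first.
  move=> x _; rewrite D_quad /L -mulrN -mulrDr opprD addrACA -sumrN -big_split/=.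
  by congr (2 * (_ + _)); [apply: eq_bigr => i _|]; ring.
have lL : forall k u v, L (k *: u + v) = k * L u + L v.
  move=> k u v; rewrite /L /= !mulrDr -!addrA.
  have -> : \sum_(i < N) (k *: u.1 + v.1) ord0 i * e.1 ord0 i =
     k * (\sum_(i < N) u.1 ord0 i * e.1 ord0 i) + \sum_(i < N) v.1 ord0 i * e.1 ord0 i.
    by rewrite mulr_sumr -big_split/=; apply: eq_bigr => i _; rewrite !mxE; ring.
  by rewrite [k *: u.2]/GRing.scale/=; ring.
have [dL eL] := is_derive_linear z e lL.
rewrite (@deriveD _ _ _ L (fun=> - L c))// (@derive_cst _ E R (- L c) z e) addr0 eL /L.
by congr (2 * (_ + _)); rewrite expr2 mulrA.
Qed.

Lemma Lop_quad (a al : R) c z : Lop a (quad al c) z =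
  2 * N%:R + 2 * al + a / z.2 * (2 * al * (z.2 - c.2)).
Proof.
rewrite /Lop sum_bas D_quad D2_quad (eq_bigr _ (fun i _ => D2_quad al c (ex i) z)).
rewrite /= big1 ?add0r => [|i _]; last by rewrite mxE expr0n.
have -> : \sum_(i < N) (z.1 ord0 i - c.1 ord0 i) * (0 : 'rV[R]_N) ord0 i = 0.
  by apply: big1 => i _; rewrite mxE mulr0.
rewrite add0r.
have -> : \sum_(i < N) 2 * (\sum_(j < N) (delta_mx ord0 i : 'rV[R]_N) ord0 j ^+ 2 + al * 0 ^+ 2) = 2 * N%:R.
  rewrite -mulr_sumr; congr (_ * _).
  rewrite -[N in RHS]card_ord -sumr_const; apply: eq_bigr => i _.
  rewrite expr0n mulr0 addr0 (bigD1 i)//= mxE !eqxx expr1n big1 ?addr0// => j ji.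
  by rewrite mxE (negbTE ji) andbF expr0n.
by ring.
Qed.

Lemma Gam_quad al c z : al * al = al -> Gam (quad al c) (quad al c) z = 4 * quad al c z.
Proof.
move=> al2; rewrite /Gam sum_bas !D_quad.
rewrite /= big1 ?add0r => [|i _]; last by rewrite mxE mulr0.
rewrite /quad [RHS]mulrDr addrC; congr (_ + _).
  rewrite mulr_sumr; apply: eq_bigr => i _; rewrite D_quad /= mulr0 addr0.
  rewrite (bigD1 i)//= mxE !eqxx /= mulr1 big1 ?addr0 => [|j ji]; first by ring.
  by rewrite mxE (negbTE ji) andbF mulr0.
by rewrite -{3}al2; ring.
Qed.

Definition ycoord z : R := z.2.

Lemma Cn_ycoord n : Cn n setT ycoord. Proof. exact: Cn_y. Qed.

Lemma D_ycoord e z : 'D_e ycoord z = e.2.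
Proof. by have [_ ->] := is_derive_y z e. Qed.

Lemma Gam_y f z : Gam f ycoord z = 'D_ey f z.
Proof.
rewrite /Gam sum_bas D_ycoord /= mulr1 big1 ?addr0// => i _.
by rewrite D_ycoord /= mulr0.
Qed.

Lemma Lop_y (a : R) z : Lop a ycoord z = a / z.2.
Proof.
rewrite /Lop D_ycoord /= mulr1 big1 ?add0r// => e _.
rewrite (@D_near setT _ (fun=> e.2) e z openT I); last by move=> x _; exact: D_ycoord.
exact: (@derive_cst _ E R e.2 z e).
Qed.

Lemma Dy_quad al c z : 'D_ey (quad al c) z = 2 * al * (z.2 - c.2).
Proof.
rewrite D_quad /= big1 ?add0r => [|i _]; last by rewrite mxE mulr0.
by ring.
Qed.

End calculus.

(** * Radial profiles *)

Section radial.
Context {R : realType} {N : nat}.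
Local Notation E := ('rV[R]_N * R)%type.
Implicit Types (f g phi : E -> R) (z w e c : E) (U : set E) (h : R -> R) (t p k : R).
Local Notation ey := (@ey R N).
Local Notation bas := (@bas R N).
Local Notation pos := [set t : R | 0 < t].

Definition plateau t : R := 1 - step t.

Lemma Cn_plateau n : Cn n setT plateau.
Proof.
have C1 : Cn n [set: R] (fun=> 1 : R) by apply: Cn_cst; exact: openT.
exact: (Cn_add openT C1 (Cn_opp openT (Cn_step n))).
Qed.

Lemma plateau1 t : t <= 1 -> plateau t = 1.
Proof. by move=> t1; rewrite /plateau step0// subr0. Qed.

Lemma plateau0 t : 2 <= t -> plateau t = 0.
Proof. by move=> t1; rewrite /plateau step1// subrr. Qed.

Lemma plateau_ge0 t : 0 <= plateau t.
Proof. by rewrite subr_ge0 step_le1. Qed.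

Lemma quadE al c z : quad al c z = quad 0 c z + al * (z.2 - c.2) ^+ 2.
Proof. by rewrite /quad mul0r addr0. Qed.

Lemma quad_ge0 al c z : 0 <= al -> 0 <= quad al c z.
Proof.
move=> al0; rewrite addr_ge0//; last by rewrite mulr_ge0// sqr_ge0.
by apply: sumr_ge0 => i _; rewrite sqr_ge0.
Qed.

Lemma sq_quad c z : sq c z = quad 1 c z.
Proof. by rewrite /sq /quad mul1r. Qed.

Lemma D_shift U f k e z : U z -> Cn 1 U f -> 'D_e (fun x => f x + k) z = 'D_e f z.
Proof.
move=> Uz Cf; have df : derivable f z e by apply: (@Cn_derivable R _ 0%N U).
apply: etrans (@deriveD _ _ _ f (fun=> k) z e df _) _; first exact: derivable_cst.
by rewrite (@derive_cst _ E R k z e) addr0.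
Qed.

Lemma Lop_shift (a : R) U f k z : open U -> U z -> Cn 2 U f ->
  Lop a (fun x => f x + k) z = Lop a f z.
Proof.
move=> oU Uz Cf; rewrite (Lop_add a oU Uz Cf (Cn_cst 2 k oU)) Lop_cst.
exact: addr0.
Qed.

Lemma Gam_shift U f k z : U z -> Cn 1 U f ->
  Gam (fun x => f x + k) (fun x => f x + k) z = Gam f f z.
Proof.
by move=> Uz Cf; apply: eq_bigr => e _; congr (_ * _); exact: (D_shift k e Uz Cf).
Qed.

Lemma D1_powR p t : 0 < t -> 'D_1 (fun t : R => t `^ p) t = p * t `^ (p - 1).
Proof. by move=> t0; have [_ ->] := is_derive1_powR p t0. Qed.

Lemma D2_powR p t : 0 < t ->
  'D_1 ('D_1 (fun t : R => t `^ p)) t = p * (p - 1) * t `^ (p - 2).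
Proof.
move=> t0; rewrite (@near_eq_derive _ _ _ _ (fun t => p * t `^ (p - 1))); last first.
  by apply: (open_near (@open_gt R 0) t0) => x /= x0; rewrite D1_powR.
have [d _] := is_derive1_powR (p - 1) t0.
apply: etrans (@deriveZ R R R _ p t 1 d) _.
rewrite D1_powR// /GRing.scale /= mulrA; congr (_ * _ `^ _).
by lra.
Qed.

Lemma powR_S p t : 0 < t -> t `^ (p - 1) = t * t `^ (p - 2).
Proof.
move=> t0; rewrite -[X in X * _]powRr1 ?ltW// -powRD; last by rewrite (gt_eqF t0) implybT.
by congr (_ `^ _); lra.
Qed.

Lemma Cn_pow n p : Cn n pos (fun t : R => t `^ p).
Proof. by apply: Cn_powR => //; exact: open_gt. Qed.

Lemma Lop_radial (a : R) c k h z : 0 < k -> Cn 2 pos h ->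
  let q := quad 1 c z + k in
  Lop a (fun x => h (quad 1 c x + k)) z =
    'D_1 h q * (2 * N%:R + 2 + a / z.2 * (2 * (z.2 - c.2))) +
    'D_1 ('D_1 h) q * (4 * quad 1 c z).
Proof.
move=> k0 Ch q.
have Cq n : Cn n setT (fun x : E => quad 1 c x + k) := Cn_addT (Cn_quad n 1 c) (Cn_cstT n k).
have q0 (x : E) : setT x -> pos (quad 1 c x + k) by move=> _; rewrite /= ltr_wpDl ?quad_ge0.
apply: etrans (Lop_comp a openT (@open_gt R 0) I q0 Ch (Cq 2)) _.
rewrite (Lop_shift a k openT I (Cn_quad 2 1 c)) (Gam_shift k I (Cn_quad 1 1 c)).
by rewrite Lop_quad Gam_quad ?mulr1.
Qed.

(** The bracket vanishes for c on the boundary and 2 p = 2 - (N + 1 + a): a power of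
    |z|^2 + k is then L-superharmonic, and its L is concentrated at distance sqrt k from c. *)
Lemma Lop_power (a p : R) c k z : 0 < k ->
  let q := quad 1 c z + k in
  Lop a (fun x => (quad 1 c x + k) `^ p) z =
    2 * p * q `^ (p - 1) * (N%:R + 1 + 2 * (p - 1) + a / z.2 * (z.2 - c.2))
    - 4 * p * (p - 1) * k * q `^ (p - 2).
Proof.
move=> k0 q; have q0 : 0 < q by rewrite ltr_wpDl ?quad_ge0.
apply: etrans (Lop_radial a c z k0 (Cn_pow 2 p)) _.
rewrite -/q D1_powR// D2_powR// powR_S//.
have -> : quad 1 c z = q - k by rewrite addrK.
by ring.
Qed.

Definition cutoff h (l : R) t : R := h t * plateau (l * t).

Lemma Cn_cutoff n h l : Cn n pos h -> Cn n pos (cutoff h l).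
Proof.
move=> Ch; apply: (Cn_mul (@open_gt R 0) Ch).
apply: (@Cn_sub _ _ n setT) => //.
have := @Cn_affine R R n plateau l 0 (Cn_plateau n).
by under eq_fun do rewrite addr0.
Qed.

Lemma cutoffE h l t : 0 < l -> t < l^-1 -> cutoff h l t = h t.
Proof.
by move=> l0 tl; rewrite /cutoff plateau1 ?mulr1// mulrC -ler_pdivlMr// mul1r ltW.
Qed.

Lemma cutoff0 h l t : 0 < l -> 2 * l^-1 <= t -> cutoff h l t = 0.
Proof. by move=> l0 tl; rewrite /cutoff plateau0 ?mulr0// mulrC -ler_pdivrMr. Qed.

Lemma Dcutoff0 h l t : 0 < l -> 2 * l^-1 < t ->
  'D_1 (cutoff h l) t = 0 /\ 'D_1 ('D_1 (cutoff h l)) t = 0.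
Proof.
move=> l0 tl; have D0 x : 2 * l^-1 < x -> 'D_1 (cutoff h l) x = 0.
  move=> xl; apply: etrans (@near_eq_derive _ _ _ _ (fun=> 0) _ _ _) _.
    by apply: (open_near (@open_gt R _) xl) => y /= /ltW ly; exact: cutoff0.
  exact: derive_cst.
split; first exact: D0.
apply: etrans (@near_eq_derive _ _ _ _ (fun=> 0) _ _ _) _.
  by apply: (open_near (@open_gt R _) tl) => y /= ly; exact: D0.
exact: derive_cst.
Qed.

Lemma Cn_itv_bounded h (lo hi : R) : 0 < lo -> Cn 0 pos h ->
  exists2 M, 0 <= M & forall t, lo <= t <= hi -> `|h t| <= M.
Proof.
move=> lo0 Ch.
have cD : {within `[lo, hi], continuous h}.
  apply: continuous_in_subspaceT => t; rewrite inE/= in_itv/= => /andP[lt _].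
  by apply: (Cn_continuous Ch); rewrite /= (lt_le_trans lo0).
have /compact_bounded[M [_ H]] := continuous_compact cD (@segment_compact R lo hi).
exists (`|M| + 1) => [|t tl]; first by rewrite addr_ge0.
apply: (H (`|M| + 1)); first by rewrite (le_lt_trans (ler_norm M)) ?ltrDl.
by exists t => //; rewrite /= in_itv.
Qed.

Lemma cutoff_bound h l : 0 < l -> Cn 2 pos h ->
  exists2 M, 0 <= M & forall t, l^-1 <= t ->
    `|'D_1 (cutoff h l) t| <= M /\ `|'D_1 ('D_1 (cutoff h l)) t| <= M.
Proof.
move=> l0 Ch; have l10 : 0 < l^-1 by rewrite invr_gt0.
have C2 := Cn_cutoff l Ch.
have C1 : Cn 1 pos ('D_1 (cutoff h l)) := @CnD R R 1 pos _ 1 C2.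
have C0 : Cn 0 pos ('D_1 ('D_1 (cutoff h l))) := @CnD R R 0 pos _ 1 C1.
have [M1 M10 H1] := Cn_itv_bounded (2 * l^-1) l10 (CnW C1).
have [M2 M20 H2] := Cn_itv_bounded (2 * l^-1) l10 C0.
exists (M1 + M2) => [|t lt]; first exact: addr_ge0.
have [tl|tl] := lerP t (2 * l^-1).
  have tt : l^-1 <= t <= 2 * l^-1 by rewrite lt tl.
  by split; [apply: le_trans (H1 t tt) _; rewrite lerDl|apply: le_trans (H2 t tt) _; rewrite lerDr].
have [-> ->] := Dcutoff0 h l0 tl.
by rewrite normr0 addr_ge0.
Qed.

(** Beyond the plateau q >= 1/l the profile no longer sees how singular it is at the
    pole: the bound K depends neither on the centre c nor on the regularisation k. *)
Lemma Lop_cutoff (a l B : R) h : 0 < l -> 0 <= B -> Cn 2 pos h ->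
  exists2 K, 0 <= K & forall c k z, 0 < k -> l^-1 <= quad 1 c z + k ->
    (quad 1 c z + k <= 2 * l^-1 ->
      `|2 * N%:R + 2 + a / z.2 * (2 * (z.2 - c.2))| <= B) ->
    Lop a (fun x => cutoff h l (quad 1 c x + k)) z <= K.
Proof.
move=> l0 B0 Ch; have [M M0 HM] := cutoff_bound l0 Ch.
have l10 : 0 < l^-1 by rewrite invr_gt0.
exists (M * B + M * (4 * (2 * l^-1))) => [|c k z k0 ql qB].
  by rewrite addr_ge0// mulr_ge0// mulr_ge0// mulr_ge0// ltW.
rewrite (Lop_radial a c z k0 (Cn_cutoff l Ch)).
have [q2|q2] := lerP (quad 1 c z + k) (2 * l^-1); last first.
  have [-> ->] := Dcutoff0 h l0 q2; rewrite !mul0r addr0.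
  by rewrite addr_ge0// mulr_ge0// mulr_ge0// mulr_ge0// ltW.
have [H1 H2] := HM _ ql; apply: le_trans (ler_norm _) _.
apply: le_trans (ler_normD _ _) _; rewrite !normrM; apply: lerD.
  by apply: ler_pM => //; exact: qB.
have Q0 := @quad_ge0 1 c z ler01.
apply: ler_pM => //; rewrite -normrM ger0_norm ?mulr_ge0//.
by rewrite ler_pM2l//; lra.
Qed.

Lemma Lop_cutoff0 (a l : R) h c k z : 0 < l -> 0 < k -> Cn 2 pos h ->
  2 * l^-1 < quad 1 c z + k -> Lop a (fun x => cutoff h l (quad 1 c x + k)) z = 0.
Proof.
move=> l0 k0 Ch q2; rewrite (Lop_radial a c z k0 (Cn_cutoff l Ch)).
by have [-> ->] := Dcutoff0 h l0 q2; rewrite !mul0r addr0.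
Qed.

Lemma open_quad_lt al c t : open [set z : E | quad al c z < t].
Proof.
have cq : continuous (quad al c : E -> R).
  by move=> z; exact: (Cn_continuous (Cn_quad 0 al c) I).
have -> : [set z : E | quad al c z < t] = (quad al c) @^-1` [set s : R | s < t] by [].
by apply: open_comp; [move=> z _; exact: cq|exact: open_lt].
Qed.

Lemma open_quad_gt al c t : open [set z : E | t < quad al c z].
Proof.
have cq : continuous (quad al c : E -> R).
  by move=> z; exact: (Cn_continuous (Cn_quad 0 al c) I).
have -> : [set z : E | t < quad al c z] = (quad al c) @^-1` [set s : R | t < s] by [].
by apply: open_comp; [move=> z _; exact: cq|exact: open_gt].
Qed.

Lemma Lop_cutoffE (a l : R) h c k z : 0 < l -> quad 1 c z + k < l^-1 ->
  Lop a (fun x => cutoff h l (quad 1 c x + k)) z = Lop a (fun x => h (quad 1 c x + k)) z.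
Proof.
move=> l0 ql; apply: (@Lop_near R N a [set x : E | quad 1 c x < l^-1 - k]).
- exact: open_quad_lt.
- by rewrite /= ltrBrDr.
- by move=> x /=; rewrite ltrBrDr => xl; rewrite cutoffE.
Qed.

Lemma Cn_radial n h c k : 0 < k -> Cn n pos h -> Cn n setT (fun x : E => h (quad 1 c x + k)).
Proof.
move=> k0 Ch.
have Cq : Cn n setT (fun x : E => quad 1 c x + k) := Cn_addT (Cn_quad n 1 c) (Cn_cstT n k).
apply: (Cn_comp openT (@open_gt R 0) Ch Cq) => x _.
by rewrite /= ltr_wpDl ?quad_ge0.
Qed.

Lemma quad_compact c t : compact [set z : E | quad 1 c z <= t].
Proof.
have cq : continuous (fun z : E => - quad 1 c z).
  by move=> z; apply: cvgN; exact: (Cn_continuous (Cn_quad 0 1 c) I).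
set r := `|t| + 1 + `|c|.
apply: (subclosed_compact _ (@compact_cbox R N r)).
  have -> : [set z : E | quad 1 c z <= t] = [set z | - t <= - quad 1 c z].
    by apply/seteqP; split=> z /=; rewrite lerN2.
  exact: closed_ge_cont.
have t1 : t <= (`|t| + 1) ^+ 2.
  have := ler_norm t; have : 0 <= `|t| by []. by nra.
have [c1 c2] : `|c.1| <= `|c| /\ `|c.2| <= `|c|.
  by rewrite {2 4}/Num.Def.normr/= !le_max !lexx orbT.
move=> z /= zt; split=> [i|].
- have h : `|z.1 ord0 i - c.1 ord0 i| <= `|t| + 1.
    rewrite -ler_sqr ?nnegrE ?addr_ge0// real_normK ?num_real//.
    by apply: le_trans (le_trans zt t1); rewrite -sq_quad; exact: sq_ge_x.
  rewrite -[z.1 ord0 i](subrK (c.1 ord0 i)) (le_trans (ler_normD _ _))// lerD//.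
  apply: le_trans c1; rewrite [leRHS]/Num.Def.normr/= mx_normrE.
  by apply: (le_bigmax _ (fun ij => `|c.1 ij.1 ij.2|) (ord0, i)).
- have h : `|z.2 - c.2| <= `|t| + 1.
    rewrite -ler_sqr ?nnegrE ?addr_ge0// real_normK ?num_real//.
    by apply: le_trans (le_trans zt t1); rewrite -sq_quad; exact: sq_ge_y.
  by rewrite -[z.2](subrK c.2) (le_trans (ler_normD _ _))// lerD.
Qed.

Lemma powR_eps p k t : 0 <= k -> 0 < t ->
  t ^+ 2 * (k * t ^+ 2) `^ (p - 2) = k `^ (p - 2) * t `^ (2 * p - 2).
Proof.
move=> k0 t0; rewrite powRM// ?sqr_ge0// mulrCA; congr (_ * _).
rewrite -powR_mulrn ?ltW// -powRrM -powRD ?(gt_eqF t0) ?implybT//.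
by congr (_ `^ _); lra.
Qed.

Lemma Lop_bounded (a : R) phi (lo r : R) : 0 < lo -> (forall n, Cn n setT phi) ->
  exists2 C, 0 <= C & forall z, lo <= z.2 -> quad 1 0 z <= r -> `|Lop a phi z| <= C.
Proof.
move=> lo0 Cphi.
have cDD : continuous (fun z => \sum_(e <- bas) 'D_e ('D_e phi) z).
  have CS : Cn 0 setT (fun z => \sum_(e <- bas) 'D_e ('D_e phi) z).
    by apply: (Cn_sum bas openT) => e; exact: (CnD e (CnD e (Cphi 2))).
  by move=> z; exact: (Cn_continuous CS I).
have cDy : continuous ('D_ey phi).
  by move=> z; exact: (Cn_continuous (CnD ey (Cphi 1)) I).
have [M1 H1] := continuous_bounded (@quad_compact 0 r) cDD.
have [M2 H2] := continuous_bounded (@quad_compact 0 r) cDy.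
exists (`|M1| + `|a| / lo * `|M2|) => [|z zlo zr].
  by rewrite addr_ge0// mulr_ge0// divr_ge0// ltW.
apply: le_trans (ler_normD _ _) _; apply: lerD.
  exact: le_trans (H1 z zr) (ler_norm _).
rewrite normrM; apply: ler_pM => //; last exact: le_trans (H2 z zr) (ler_norm _).
have z0 : 0 < z.2 := lt_le_trans lo0 zlo.
by rewrite normrM ler_wpM2l// normfV (gtr0_norm z0) lef_pV2 ?posrE.
Qed.

Lemma powR_antitone p s t : p <= 0 -> 0 < s -> s <= t -> t `^ p <= s `^ p.
Proof.
move=> p0 s0 st; have t0 := lt_le_trans s0 st.
rewrite -[p]opprK !(powRN _ (- p)) lef_pV2 ?posrE ?powR_gt0//.
by apply: ge0_ler_powR; rewrite ?nnegrE ?oppr_ge0 ?(ltW s0) ?(ltW t0).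
Qed.

End radial.

(** * A kernel centred on the boundary *)

Section boundary.
Context {R : realType} {N : nat}.
Local Notation E := ('rV[R]_N * R)%type.
Implicit Types (f g phi : E -> R) (z w e c : E) (U : set E) (h : R -> R) (t p k : R).
Local Notation ey := (@ey R N).
Local Notation bas := (@bas R N).
Local Notation pos := [set t : R | 0 < t].

(** A smooth function of x supported in |x| <= 3. *)
Definition bump z : R := ek 0 (- 9^-1 * quad 0 0 z + 1).

Lemma Cn_bump n : Cn n setT bump.
Proof.
have C1 : Cn n setT (fun z : E => - 9^-1 * quad 0 0 z + 1).
  exact: (Cn_addT (Cn_mulT (Cn_cstT n (- 9^-1)) (Cn_quad n 0 0)) (Cn_cstT n 1)).
exact: (Cn_compT (Cn_ek n 0) C1).
Qed.

Lemma bump_ge0 z : 0 <= bump z. Proof. exact: ek_ge0. Qed.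

Lemma D1_ek0 t : 'D_1 (ek 0) t = ek 2 t.
Proof. by have [_ ->] := is_derive_ek 0 t; rewrite mul0r subr0. Qed.

Lemma ek0_homo (s t : R) : 0 < s -> s <= t -> ek 0 s <= ek 0 t.
Proof.
move=> s0 st; have t0 := lt_le_trans s0 st; rewrite /ek s0 t0 !expr0 !mul1r ler_expR.
by rewrite lerN2 lef_pV2 ?posrE.
Qed.

Lemma D2_ek0 t : 'D_1 ('D_1 (ek 0)) t = ek 4 t - 2 * ek 3 t.
Proof.
have -> : 'D_1 (ek 0) = ek 2 :> (R -> R) by apply/funext => x; exact: D1_ek0.
by have [_ ->] := is_derive_ek 2 t.
Qed.

Lemma Gam_scale k U f z : U z -> Cn 1 U f ->
  Gam (fun x => k * f x) (fun x => k * f x) z = k ^+ 2 * Gam f f z.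
Proof.
move=> Uz Cf; rewrite /Gam mulr_sumr; apply: eq_bigr => e _.
rewrite (derive_scale k (@Cn_derivable R _ 0%N U f z e Cf Uz)).
have alg (x y : R) : (x * y) * (x * y) = x ^+ 2 * (y * y) by ring.
exact: alg.
Qed.

Definition bump_rate : R := 2 / 9 * (9 / 4 * (2 + 2 * N%:R / 9)) ^+ 2.

Lemma bump_rate_ge0 : 0 <= bump_rate.
Proof. by rewrite mulr_ge0 ?sqr_ge0//; lra. Qed.

(** In terms of t = 1/v, v = 1 - |x|^2/9, the quotient of L bump by bump is the quartic
    (4/9)(t^4 - 3 t^3 + 2 t^2) - (2N/9) t^2, bounded below after completing squares. *)
Lemma Lop_bump (a : R) z : - bump_rate * bump z <= Lop a bump z.
Proof.
pose f (x : E) : R := - 9^-1 * quad 0 0 x.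
have Cf n : Cn n setT f := Cn_mulT (Cn_cstT n (- 9^-1)) (Cn_quad n 0 0).
have Cf1 n : Cn n setT (fun x => f x + 1) := Cn_addT (Cf n) (Cn_cstT n 1).
have L := Lop_comp a openT openT (I : setT z) (fun _ _ => I) (Cn_ek 2 0) (Cf1 2).
have -> : Lop a bump z = ek 2 (f z + 1) * (- 9^-1 * (2 * N%:R)) +
    (ek 4 (f z + 1) - 2 * ek 3 (f z + 1)) * ((- 9^-1) ^+ 2 * (4 * quad 0 0 z)).
  apply: etrans L _; rewrite D1_ek0 D2_ek0; congr (_ * _ + _ * _).
    rewrite (Lop_shift a 1 openT I (Cf 2)).
    rewrite (Lop_scale a (- 9^-1) openT I (Cn_quad 2 0 0)) Lop_quad; congr (_ * _).
    by ring.
  rewrite (Gam_shift 1 I (Cf 1)) (Gam_scale _ I (Cn_quad 1 0 0)).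
  by rewrite Gam_quad// mulr0.
set v := f z + 1; have -> : quad 0 0 z = 9 * (1 - v) by rewrite /v /f; lra.
have -> : bump z = ek 0 v by [].
have [v0|v0] := lerP v 0; first by rewrite !ek_le0// !(mulr0, mul0r, subr0, addr0).
rewrite /ek v0; set x := expR _; have x0 : 0 <= x by exact: expR_ge0.
set t := v^-1; have -> : v = t^-1 by rewrite invrK.
have t0 : t != 0 by rewrite invr_eq0 gt_eqF.
set n : R := N%:R; rewrite -subr_ge0.
(* Chosen so that (2/9)(t^2 - gm)^2 has the t^2-coefficient -(2 + 2N/9). *)
pose gm : R := 9 / 4 * (2 + 2 * n / 9).
have -> : t ^+ 2 * x * (- 9^-1 * (2 * n)) + (t ^+ 4 * x - 2 * (t ^+ 3 * x)) *
    ((- 9^-1) ^+ 2 * (4 * (9 * (1 - t^-1)))) - - bump_rate * (t ^+ 0 * x) =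
    x * (2 / 9 * (t ^+ 2 * (t - 3) ^+ 2) + 2 / 9 * (t ^+ 2 - gm) ^+ 2 + 8 / 9 * t ^+ 2).
  by rewrite /bump_rate -/n /gm; field.
apply: mulr_ge0 => //; have := sqr_ge0 (t * (t - 3)); have := sqr_ge0 (t ^+ 2 - gm).
by have := sqr_ge0 t; rewrite exprMn; lra.
Qed.

Definition Y2 z : R := ycoord z * ycoord z.

Lemma Cn_Y2 n : Cn n setT Y2.
Proof. exact: (Cn_mulT (Cn_ycoord n) (Cn_ycoord n)). Qed.

Lemma D_Y2 e z : 'D_e Y2 z = 2 * z.2 * e.2.
Proof.
apply: etrans (D_mul e (I : setT z) (Cn_ycoord 1) (Cn_ycoord 1)) _.
by rewrite D_ycoord /ycoord; ring.
Qed.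

Lemma Lop_Y2 (a : R) z : 0 < z.2 -> Lop a Y2 z = 2 + 2 * a.
Proof.
move=> z0; apply: etrans (Lop_mul a openT (I : setT z) (Cn_ycoord 2) (Cn_ycoord 2)) _.
rewrite Gam_y D_ycoord Lop_y /ycoord /=.
by field; rewrite gt_eqF.
Qed.

Lemma Dy_bump z : 'D_ey bump z = 0.
Proof.
pose f (x : E) : R := - 9^-1 * quad 0 0 x.
have Cf n : Cn n setT f := Cn_mulT (Cn_cstT n (- 9^-1)) (Cn_quad n 0 0).
have Cf1 n : Cn n setT (fun x => f x + 1) := Cn_addT (Cf n) (Cn_cstT n 1).
apply: etrans (D_comp ey (I : setT z) (fun _ _ => I) (Cn_ek 1 0) (Cf1 1)) _.
rewrite (D_shift 1 ey I (Cf 1)).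
rewrite (derive_scale (- 9^-1) (@Cn_derivable R _ 0%N setT _ z ey (Cn_quad 1 0 0) I)).
by rewrite Dy_quad !(mulr0, mul0r).
Qed.

(** L y^2 = 2 + 2a is positive, and near the boundary the factor y^2 makes the negative
    part of L bump harmless. *)
Lemma Lop_Y2bump (a : R) z : 0 < z.2 -> z.2 ^+ 2 * bump_rate <= 1 + a ->
  (1 + a) * bump z <= Lop a (fun x => Y2 x * bump x) z.
Proof.
move=> z0 hz; rewrite (Lop_mul a openT (I : setT z) (Cn_Y2 2) (Cn_bump 2)).
have -> : Gam Y2 bump z = 0.
  rewrite GamC (Gam_mulr bump I (Cn_ycoord 1) (Cn_ycoord 1)) Gam_y Dy_bump.
  by rewrite !mulr0 addr0.
rewrite Lop_Y2// mulr0 addr0.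
have := Lop_bump a z; have := bump_ge0 z; rewrite /Y2 /ycoord.
move: (Lop a bump z) (bump z) => L b b0 Lb.
have : 0 <= z.2 ^+ 2 * (L - - bump_rate * b) by rewrite mulr_ge0 ?sqr_ge0 ?subr_ge0.
have : 0 <= (1 + a - z.2 ^+ 2 * bump_rate) * b by rewrite mulr_ge0 ?subr_ge0.
by nra.
Qed.

(** Subtracting a multiple of this function makes a kernel superharmonic in the layer
    {0 < y <= dl}, at the cost of a bounded error where y > dl. *)
Definition layer (dl : R) z : R := Y2 z * (plateau ((4 * dl ^+ 2)^-1 * Y2 z) * bump z).

Lemma Cn_layer dl n : Cn n setT (layer dl).
Proof.
have Ca : Cn n setT (fun z => (4 * dl ^+ 2)^-1 * Y2 z) := Cn_mulT (Cn_cstT n _) (Cn_Y2 n).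
exact: (Cn_mulT (Cn_Y2 n) (Cn_mulT (Cn_compT (Cn_plateau n) Ca) (Cn_bump n))).
Qed.

Lemma layer_near dl z : 0 < dl -> Y2 z <= 4 * dl ^+ 2 -> layer dl z = Y2 z * bump z.
Proof.
move=> dl0 zl; rewrite /layer plateau1 ?mul1r// ler_pdivrMl ?mulr_gt0 ?exprn_gt0//.
by rewrite mulr1.
Qed.

Lemma Lop_layer_near (a : R) dl z : 0 < dl -> Y2 z < 4 * dl ^+ 2 ->
  Lop a (layer dl) z = Lop a (fun x => Y2 x * bump x) z.
Proof.
move=> dl0 zl; apply: (@Lop_near R N a [set x : E | Y2 x < 4 * dl ^+ 2]) => //.
  have -> : [set x : E | Y2 x < 4 * dl ^+ 2] = Y2 @^-1` [set s : R | s < 4 * dl ^+ 2] by [].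
  by apply: open_comp; [move=> x _; exact: (Cn_continuous (Cn_Y2 0) I)|exact: open_lt].
by move=> x /= /ltW; exact: layer_near.
Qed.

Lemma layer_far dl z : 0 < dl -> dl <= 1 / 4 -> 10 < quad 1 0 z -> layer dl z = 0.
Proof.
move=> dl0 dl4; rewrite quadE mul1r subr0 => z10.
have [z1|z1] := lerP 1 (z.2 ^+ 2).
  rewrite /layer plateau0 ?mul0r ?mulr0//.
  rewrite ler_pdivlMl ?mulr_gt0 ?exprn_gt0// /Y2 /ycoord; nra.
by rewrite /layer /bump ek_le0 ?mulr0//; lra.
Qed.

Lemma layer0 dl z : z.2 = 0 -> layer dl z = 0 /\ 'D_ey (layer dl) z = 0.
Proof.
move=> z0; split; first by rewrite /layer /Y2 /ycoord z0 !mul0r.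
pose g x := plateau ((4 * dl ^+ 2)^-1 * Y2 x) * bump x.
have Ca : Cn 1 setT (fun z => (4 * dl ^+ 2)^-1 * Y2 z) := Cn_mulT (Cn_cstT 1 _) (Cn_Y2 1).
have Cg : Cn 1 setT g := Cn_mulT (Cn_compT (Cn_plateau 1) Ca) (Cn_bump 1).
apply: etrans (D_mul ey (I : setT z) (Cn_Y2 1) Cg) _.
by rewrite D_Y2 /Y2 /ycoord z0 !(mulr0, mul0r) addr0.
Qed.

Definition shell (dl t : R) : set E := [set z | dl < z.2 /\ quad 1 0 z < t].
Definition upper_ball (t : R) : set E := [set z | 0 < z.2 /\ quad 1 0 z < t].

(** The cut-off fundamental solution has L <= 0 where it is not cut off, and L of size
    -eps^-d on the half ball of radius eps. Its error on the annulus 1 <= q <= 2 reaches the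
    boundary; the layer function moves it to heights y > dl, where the mass is bounded by
    means of the third kernel. *)
Lemma boundary_kernel (a : R) : (2 <= N)%N -> -1 < a < 1 ->
  exists (dl k0 K : R), [/\ 0 < dl <= 1, 0 < k0 & forall eps : R, 0 < eps < dl ->
    exists phi, [/\ test_function setT phi,
      forall x, 0 <= phi (x, 0) /\ 'D_ey phi (x, 0) = 0 &
      forall z, half_space z -> Lop a phi z <= K * \1_(shell dl 16) z -
        (k0 * eps `^ (- (N%:R + 1 + a))) * \1_(upper_ball (eps ^+ 2)) z]].
Proof.
move=> N2 /andP[a1 a2].
have n2 : 2 <= N%:R :> R by rewrite ler_nat.
(* The exponent for which the bracket of Lop_power vanishes. *)
pose d : R := N%:R + 1 + a; pose p : R := 1 - d / 2.
have p0 : p < 0 by rewrite /p /d; lra.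
have pp : 0 < p * (p - 1) by rewrite nmulr_rgt0//; lra.
pose h (t : R) : R := t `^ p.
have Ch n : Cn n pos h := Cn_pow n p.
have [K1 K10 HK1] := Lop_cutoff (N := N) a ltr01 (ltac:(lra) : 0 <= 2 * N%:R + 4 :> R) (Ch 2).
have [dl [dl0 dl4 dlb]] : exists dl : R, [/\ 0 < dl, dl <= 1 / 4 & dl ^+ 2 * bump_rate <= 1 + a].
  have b0 := bump_rate_ge0.
  pose dl : R := (1 + a) / (8 * (1 + bump_rate)); exists dl.
  have dlB : dl * (1 + bump_rate) = (1 + a) / 8 by rewrite /dl; field; lra.
  have dl0 : 0 < dl by rewrite divr_gt0//; lra.
  have dl4 : dl <= 1 / 4 by nra.
  split=> //; have : 0 <= dl * (1 / 4 - dl) by rewrite mulr_ge0 ?subr_ge0 ?(ltW dl0).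
  nra.
have g0 : 0 < ek 0 (7 / 9 : R) by rewrite ek_gt0//; lra.
have [C C0 HC] := Lop_bounded a 16 dl0 (Cn_layer dl).
(* On 1 <= q <= 2 one has |x|^2 <= 2, so the bump is at least ek 0 (7/9). *)
pose M : R := K1 / ((1 + a) * ek 0 (7 / 9)).
have M0 : 0 <= M by rewrite divr_ge0// mulr_ge0 ?(ltW g0)//; lra.
pose k0 : R := 4 * (p * (p - 1)) * 2 `^ (p - 2).
have k00 : 0 < k0 by apply: mulr_gt0; [exact: mulr_gt0|exact: powR_gt0].
exists dl, k0, (K1 + M * C); split=> [|//|eps]; first by rewrite dl0 /=; lra.
move=> /andP[e0 edl].
have e20 : 0 < eps ^+ 2 by rewrite exprn_gt0.
pose f1 (x : E) : R := cutoff h 1 (quad 1 0 x + eps ^+ 2).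
pose f2 (x : E) : R := - M * layer dl x.
have C1 n : Cn n setT f1 := Cn_radial 0 e20 (Cn_cutoff 1 (Ch n)).
have C2 n : Cn n setT f2 := Cn_mulT (Cn_cstT n (- M)) (Cn_layer dl n).
exists (fun x => f1 x + f2 x); split.
- apply: (@test_functionI _ _ _ [set z : E | quad 1 0 z <= 10]) => //.
  + by apply/smoothP => n; exact: (Cn_addT (C1 n) (C2 n)).
  + exact: quad_compact.
  + move=> z /= /negP; rewrite -ltNge => z10.
    by rewrite /f1 /f2 layer_far// mulr0 addr0 cutoff0// invr1; lra.
- move=> x; split.
    rewrite /f2 (layer0 dl (z := (x, 0)) erefl).1 mulr0 addr0.
    by rewrite /f1 /cutoff mulr_ge0 ?powR_ge0 ?plateau_ge0.
  apply: etrans (D_add ey (I : setT (x, 0)) (C1 1) (C2 1)) _.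
  rewrite (derive_scale (- M) (@Cn_derivable R _ 0%N setT _ (x, 0) ey (Cn_layer dl 1) I)).
  rewrite (layer0 dl (z := (x, 0)) erefl).2 mulr0 addr0.
  have Cq : Cn 1 setT (fun x : E => quad 1 0 x + eps ^+ 2).
    exact: (Cn_addT (Cn_quad 1 1 0) (Cn_cstT 1 _)).
  have q0 (y : E) : setT y -> pos (quad 1 0 y + eps ^+ 2) by move=> _; rewrite /= ltr_wpDl ?quad_ge0.
  apply: etrans (D_comp ey (I : setT (x, 0)) q0 (Cn_cutoff 1 (Ch 1)) Cq) _.
  rewrite (D_shift _ ey I (Cn_quad 1 1 0)) Dy_quad.
  by rewrite subr0 !mulr0.
move=> z z0; have z0' : 0 < z.2 by [].
apply: le_trans (_ : Lop a f1 z - M * Lop a (layer dl) z <= _).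
  rewrite (Lop_add a openT I (C1 2) (C2 2)) (Lop_scale a (- M) openT I (Cn_layer dl 2)).
  by rewrite mulNr.
set q := quad 1 0 z.
have q0 : 0 <= q by exact: quad_ge0.
have y2q : z.2 ^+ 2 <= q by rewrite /q -sq_quad; have := sq_ge_y 0 z; rewrite subr0.
have L1in : q + eps ^+ 2 < 1 -> Lop a f1 z = - (4 * (p * (p - 1)) * (eps ^+ 2 * (q + eps ^+ 2) `^ (p - 2))).
  move=> q1; rewrite /f1 (Lop_cutoffE a h ltr01) ?invr1// (Lop_power a p 0 z e20) -/q.
  rewrite subr0 divfK ?gt_eqF//.
  have -> : N%:R + 1 + 2 * (p - 1) + a = 0 by rewrite /p /d; lra.
  by ring.
have L1le : Lop a f1 z <= K1.
  have [q1|q1] := lerP 1 (q + eps ^+ 2).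
    apply: HK1 => //; first by rewrite invr1.
    move=> _; rewrite subr0 mulrCA divfK ?gt_eqF//.
    by rewrite ger0_norm; lra.
  rewrite L1in//; apply: le_trans K10; rewrite oppr_le0.
  by apply: mulr_ge0; [exact/ltW/mulr_gt0|exact: mulr_ge0 (ltW e20) (powR_ge0 _ _)].
have L10 : 2 < q + eps ^+ 2 -> Lop a f1 z = 0.
  by move=> q2; apply: Lop_cutoff0 => //; rewrite ?invr1 ?mulr1.
have edl2 : eps ^+ 2 < dl ^+ 2 by rewrite ltr_pXn2r// nnegrE ltW.
have dl21 : dl ^+ 2 <= 1 / 16 by have := dl0; nra.
have [zdl|zdl] := lerP z.2 dl.
  have nS : ~ shell dl 16 z by move=> [+ _]; rewrite ltNge zdl.
  rewrite [\1_(shell dl 16) z]indicE memNset// mulr0 add0r.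
  have L2 : (1 + a) * bump z <= Lop a (layer dl) z.
    rewrite Lop_layer_near//; last by rewrite /Y2 /ycoord; nra.
    apply: Lop_Y2bump => //; apply: le_trans dlb; rewrite ler_wpM2r ?bump_rate_ge0//.
    by rewrite ler_pXn2r// nnegrE ltW.
  have ML : M * ((1 + a) * bump z) <= M * Lop a (layer dl) z by rewrite ler_wpM2l.
  have ML0 : 0 <= M * ((1 + a) * bump z).
    by rewrite mulr_ge0// mulr_ge0 ?bump_ge0//; lra.
  clear L2 dlb dl4 edl y2q C0 HC n2 a2 K10 dl0 zdl.
  have [q1|q1] := lerP 1 (q + eps ^+ 2).
    rewrite indicE memNset ?mulr0 ?oppr0; last by move=> [_]; rewrite -/q; lra.
    have [q2|q2] := lerP (q + eps ^+ 2) 2; last by rewrite L10//; lra.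
    suff : K1 <= M * ((1 + a) * bump z) by lra.
    have -> : K1 = M * ((1 + a) * ek 0 (7 / 9)).
      by rewrite /M divfK// gt_eqF// mulr_gt0//; lra.
    rewrite ler_wpM2l// ler_wpM2l//; first by lra.
    apply: ek0_homo; first by lra.
    have := quadE 1 0 z; rewrite -/q subr0 mul1r.
    have := sqr_ge0 z.2; have := @quad_ge0 R N 0 0 z (lexx 0).
    by lra.
  rewrite L1in//.
  suff : k0 * eps `^ (- (N%:R + 1 + a)) * \1_(upper_ball (eps ^+ 2)) z <=
      4 * (p * (p - 1)) * (eps ^+ 2 * (q + eps ^+ 2) `^ (p - 2)) by lra.
  rewrite indicE; case: (pselect (upper_ball (eps ^+ 2) z)) => [zu|nzu].
    rewrite mem_set// mulr1 /k0 -[leLHS]mulrA ler_pM2l; last exact: mulr_gt0.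
    have -> : - (N%:R + 1 + a) = 2 * p - 2 by rewrite /p /d; lra.
    rewrite -powR_eps ?ler0n// ler_pM2l//.
    apply: powR_antitone; [by lra|by lra|].
    by case: zu => _; rewrite -/q; lra.
  by rewrite memNset// mulr0; apply: mulr_ge0; [exact/ltW/mulr_gt0|exact: mulr_ge0 (ltW e20) (powR_ge0 _ _)].
have nU : ~ upper_ball (eps ^+ 2) z.
  move=> [_]; rewrite -/q => qe; have : dl ^+ 2 < z.2 ^+ 2 by rewrite ltr_pXn2r// nnegrE ltW.
  by lra.
rewrite [\1_(upper_ball _) z]indicE memNset// mulr0 subr0.
clear a1 a2 n2 p0 pp dlb edl y2q edl2 k00 g0.
have [q16|q16] := ltrP q 16.
  rewrite indicE mem_set ?mulr1; last by split.
  have := HC z (ltW zdl) (ltW q16); rewrite ler_norml => /andP[H _].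
  have : 0 <= M * (C + Lop a (layer dl) z) by rewrite mulr_ge0//; lra.
  by move: L1le; lra.
have -> : Lop a (layer dl) z = 0.
  rewrite (@Lop_near R N a [set x : E | 10 < quad 1 0 x] _ (fun=> 0)) ?Lop_cst//.
  - exact: open_quad_gt.
  - by rewrite /= -/q; lra.
  - by move=> x /= x10; rewrite layer_far.
rewrite L10 ?mulr0 ?subr0; last by lra.
apply: mulr_ge0; last by rewrite indicE; case: (_ \in _).
by apply: addr_ge0 => //; exact: mulr_ge0.
Qed.

End boundary.

(** * A kernel centred at height one *)

Section interior.
Context {R : realType} {N : nat}.
Local Notation E := ('rV[R]_N * R)%type.
Implicit Types (f g phi : E -> R) (z w e c : E) (U : set E) (h : R -> R) (t p k : R).
Local Notation ey := (@ey R N).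
Local Notation bas := (@bas R N).
Local Notation pos := [set t : R | 0 < t].

Definition unit_ball (t : R) : set E := [set z | quad 1 ey z < t].

(** Here n = N - 1, e is the drift (a/y)(y - 1), r the fourth root of the regularised
    squared distance to the pole and X a power of that distance.
    The drift, of order r^2, is beaten by the strictly superharmonic second power, of
    relative size r. *)
Lemma interior_alg (n r e X : R) : 1 <= n -> 0 <= r <= 1 / 3 -> 0 <= X ->
  `|e| <= 2 * r ^+ 2 ->
  - n * X * e + 16 * (- (n - 1 / 2) * (X * r) * (1 / 2 + e)) <= 0.
Proof.
move=> n1 /andP[r0 r3] X0; rewrite ler_norml => /andP[e1 e2].
have e14 : 1 / 4 <= 1 / 2 + e by nra.
have H : - n * e - 16 * (n - 1 / 2) * r * (1 / 2 + e) <= 0.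
  have : 0 <= n * (2 * r ^+ 2 + e) by rewrite mulr_ge0//; lra.
  have : 0 <= (n - 1 / 2) * r * ((1 / 2 + e) - 1 / 4) by rewrite !mulr_ge0//; lra.
  have : 0 <= (n - 1) * r by rewrite mulr_ge0//; lra.
  have : 0 <= n * r * (1 - r) by rewrite !mulr_ge0//; lra.
  nra.
have -> : - n * X * e + 16 * (- (n - 1 / 2) * (X * r) * (1 / 2 + e)) =
  X * (- n * e - 16 * (n - 1 / 2) * r * (1 / 2 + e)) by ring.
by rewrite mulr_ge0_le0.
Qed.

(** In terms of the squared distance the Newtonian potential of R^(N+1) is this power. *)
Definition newton_exp : R := (1 - N%:R) / 2.
Local Notation p1 := newton_exp.
Local Notation p2 := (newton_exp + 1 / 4).

(** L differs from the Laplacian by the drift (a/y) phi_y, whose sign is not controlled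
    near the pole. The second power is less singular and strictly superharmonic; it absorbs
    the drift of the first. *)
Definition interior_profile t : R := t `^ p1 + 16 * t `^ p2.

Lemma Cn_interior_profile n : Cn n pos interior_profile.
Proof.
apply: (Cn_add (@open_gt R 0) (Cn_pow n p1)).
exact: (Cn_mul (@open_gt R 0) (Cn_cst n 16 (@open_gt R 0)) (Cn_pow n p2)).
Qed.

Lemma newton_exp_lt0 : (2 <= N)%N -> p1 < 0 /\ p2 < 0.
Proof.
move=> N2; have n2 : 2 <= N%:R :> R by rewrite ler_nat.
by rewrite /newton_exp; split; lra.
Qed.

Lemma drift_le (a y : R) : -1 < a < 1 -> `|y - 1| <= 1 / 4 -> `|a / y| <= 2.
Proof.
move=> /andP[a1 a2]; rewrite ler_norml => /andP[h _].
have y0 : 0 < y by lra.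
rewrite normrM normfV (gtr0_norm y0) ler_pdivrMr// ler_norml.
by apply/andP; split; lra.
Qed.

(** The right-hand side is the Laplacian of the first power alone, the regularisation k
    spreading the pole; the rest is nonpositive by interior_alg. *)
Lemma Lop_interior_profile (a k : R) z : (2 <= N)%N -> -1 < a < 1 -> 0 < k ->
  quad 1 ey z + k < 1 / 128 ->
  Lop a (fun x => interior_profile (quad 1 ey x + k)) z <=
    - (4 * (p1 * (p1 - 1)) * (k * (quad 1 ey z + k) `^ (p1 - 2))).
Proof.
move=> N2 a12 k0; set X := quad 1 ey z + k => X1.
have n2 : 2 <= N%:R :> R by rewrite ler_nat.
have X0 : 0 < X by rewrite ltr_wpDl ?quad_ge0.
have yX : (z.2 - 1) ^+ 2 <= X.
  by have := sq_ge_y ey z; rewrite sq_quad => h; apply: le_trans h _; rewrite lerDl ltW.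
have C1 : Cn 2 setT (fun x : E => (quad 1 ey x + k) `^ p1) := Cn_radial ey k0 (Cn_pow 2 p1).
have C2 : Cn 2 setT (fun x : E => (quad 1 ey x + k) `^ p2) := Cn_radial ey k0 (Cn_pow 2 p2).
rewrite (Lop_add a openT (I : setT z) C1 (Cn_mulT (Cn_cstT 2 16) C2)).
rewrite (Lop_scale a 16 openT (I : setT z) C2).
rewrite (Lop_power a p1 ey z k0) (Lop_power a p2 ey z k0) -/X /=.
set e := a / z.2 * (z.2 - 1).
pose r : R := X `^ (1 / 4).
have r0 : 0 <= r by exact: powR_ge0.
have r4 : r ^+ 4 = X by rewrite /r -powR_mulrn// -powRrM divfK// powRr1// ltW.
have r3 : r <= 1 / 3.
  rewrite leNgt; apply/negP => r3.
  have h2 : 1 / 9 <= r ^+ 2 by clear -r3; nra.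
  have : 1 / 81 <= (r ^+ 2) ^+ 2 by clear -h2; nra.
  by rewrite -exprM r4; clear -X1; lra.
have Xr : X `^ (p2 - 1) = X `^ (p1 - 1) * r.
  by rewrite /r -powRD ?(gt_eqF X0) ?implybT//; congr (_ `^ _); lra.
have er : `|e| <= 2 * r ^+ 2.
  have yr : `|z.2 - 1| <= r ^+ 2.
    by rewrite -ler_sqr ?nnegrE ?sqr_ge0// real_normK ?num_real// -exprM r4.
  have r9 : r ^+ 2 <= 1 / 4 by clear -r0 r3; nra.
  rewrite /e normrM; apply: ler_pM => //.
  by apply: drift_le => //; exact: le_trans yr r9.
have n1 : 1 <= N%:R - 1 :> R by clear -n2; lra.
have := interior_alg n1 (introT andP (conj r0 r3)) (powR_ge0 X (p1 - 1)) er.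
have [p10 p20] := newton_exp_lt0 N2.
have pp2 : 0 <= p2 * (p2 - 1) by rewrite mulr_le0 ?subr_le0 ?(ltW p20)// (le_trans (ltW p20)).
rewrite Xr.
have -> : N%:R + 1 + 2 * (p1 - 1) + e = e by rewrite /newton_exp; field.
have -> : N%:R + 1 + 2 * (p2 - 1) + e = 1 / 2 + e by rewrite /newton_exp; field.
have -> : 2 * p1 = - (N%:R - 1) by rewrite /newton_exp; field.
have -> : 2 * p2 = - (N%:R - 1 - 1 / 2) by rewrite /newton_exp; field.
have : 0 <= (p2 * (p2 - 1)) * (k * X `^ (p2 - 2)).
  by apply: mulr_ge0 => //; exact: mulr_ge0 (ltW k0) (powR_ge0 _ _).
move: (X `^ (p1 - 1)) (X `^ (p1 - 2)) (X `^ (p2 - 2)) (N%:R : R) p1 => A B C n p.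
by clear; lra.
Qed.

(** The bound eps^-(N+1) on a box of size eps is the inverse of its volume up to a
    constant, so that the mass of the box yields a value of u as eps tends to 0. *)
Lemma interior_kernel (a : R) : (2 <= N)%N -> -1 < a < 1 ->
  exists (dl k0 K : R), [/\ 0 < dl, 0 < k0 & forall eps : R, 0 < eps < dl ->
    (forall z, obox ey eps z -> unit_ball (1 / 64) z) /\
    exists phi, [/\ test_function setT phi,
      forall x, 0 <= phi (x, 0) /\ 'D_ey phi (x, 0) = 0 &
      forall z, half_space z -> Lop a phi z <= K * \1_(unit_ball (1 / 64)) z -
        (k0 * eps `^ (- (N%:R + 1))) * \1_(obox ey eps) z]].
Proof.
move=> N2 a12.
have n2 : 0 <= N%:R :> R by [].
have [p10 _] := newton_exp_lt0 N2.
have pp1 : 0 < p1 * (p1 - 1) by rewrite nmulr_rgt0//; lra.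
have Ch n := Cn_interior_profile n.
have l0 : 0 < 128 :> R by lra.
have [K K0 HK] := Lop_cutoff (N := N) a l0 (ltac:(lra) : 0 <= 2 * N%:R + 3 :> R) (Ch 2).
pose m : R := N%:R + 2.
pose dl : R := 1 / (128 * m).
have m0 : 0 < m by rewrite /m; lra.
have dlm : dl * m = 1 / 128 by rewrite /dl; field; rewrite gt_eqF.
have dl0 : 0 < dl by rewrite divr_gt0// mulr_gt0.
have dl1 : dl <= 1 by rewrite /m in dlm; nra.
pose k0 : R := 4 * (p1 * (p1 - 1)) * m `^ (p1 - 2).
have k00 : 0 < k0 by apply: mulr_gt0; [exact: mulr_gt0|exact: powR_gt0].
exists dl, k0, K; split=> // eps /andP[e0 edl].
have e20 : 0 < eps ^+ 2 by rewrite exprn_gt0.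
have boxq z : obox ey eps z -> quad 1 ey z + eps ^+ 2 < m * eps ^+ 2.
  have small (t : R) : `|t| < eps -> t ^+ 2 < eps ^+ 2.
    by move=> te; rewrite -[t ^+ 2]real_normK ?num_real// ltr_pXn2r// nnegrE ltW.
  move=> [z1 z2]; rewrite /m -addn1 mulrDl.
  have -> : 2 * eps ^+ 2 = eps ^+ 2 + eps ^+ 2 by ring.
  rewrite addrA ltrD2r /quad mul1r; apply: ler_ltD; last exact: small.
  apply: (@le_trans _ _ (\sum_(i < N) eps ^+ 2)); last by rewrite sumr_const card_ord mulr_natl.
  by apply: ler_sum => i _; apply/ltW/small.
have em : m * eps ^+ 2 < 1 / 128.
  rewrite -dlm mulrC ltr_pM2r// expr2; apply: (@lt_le_trans _ _ (dl * eps)); first by rewrite ltr_pM2r.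
  by rewrite ler_piMr ?(ltW dl0)// (le_trans (ltW edl)).
clear dlm dl1 edl.
split=> [z /boxq|].
  by rewrite /unit_ball /=; clear -em e20; lra.
pose phi (x : E) : R := cutoff interior_profile 128 (quad 1 ey x + eps ^+ 2).
have Cphi n : Cn n setT phi := Cn_radial ey e20 (Cn_cutoff 128 (Ch n)).
have phi0 z : 1 / 64 <= quad 1 ey z -> phi z = 0.
  by move=> z64; rewrite /phi cutoff0//; clear -z64 e20; lra.
exists phi; split.
- apply: (@test_functionI _ _ _ [set z : E | quad 1 ey z <= 1 / 64]) => //.
  + exact/smoothP.
  + exact: quad_compact.
  + by move=> z /= /negP; rewrite -ltNge => z64; rewrite phi0// ltW.
- have U0 x : 1 / 64 < quad 1 ey ((x, 0) : E).
    have := quadE 1 ey ((x, 0) : E); rewrite /=.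
    by have := @quad_ge0 R N 0 ey (x, 0) (lexx 0); clear; lra.
  move=> x; split; first by rewrite phi0// ltW.
  apply: etrans (@D_near R N [set z | 1 / 64 < quad 1 ey z] phi (fun=> 0) ey (x, 0) _ _ _) _.
  + exact: open_quad_gt.
  + exact: U0.
  + by move=> z /= /ltW; exact: phi0.
  + exact: (@derive_cst _ E R 0 (x, 0) ey).
move=> z z0; have z0' : 0 < z.2 by [].
set q := quad 1 ey z.
have q0 : 0 <= q by exact: quad_ge0.
have y2q : (z.2 - 1) ^+ 2 <= q by have := sq_ge_y ey z; rewrite sq_quad.
have Lin : q + eps ^+ 2 < 1 / 128 -> Lop a phi z <=
   - (4 * (p1 * (p1 - 1)) * (eps ^+ 2 * (q + eps ^+ 2) `^ (p1 - 2))).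
  move=> q1; rewrite /phi Lop_cutoffE//; last by rewrite -/q; clear -q1; lra.
  exact: Lop_interior_profile.
have LleK : Lop a phi z <= K.
  have [q1|q1] := lerP (1 / 128) (q + eps ^+ 2).
    apply: HK => //; first by rewrite -/q; clear -q1; lra.
    rewrite -/q => q2.
    have yr : `|z.2 - 1| <= 1 / 4.
      rewrite -ler_sqr ?nnegrE ?divr_ge0//.
      by rewrite real_normK ?num_real//; clear -y2q q2 e20; lra.
    have ay := drift_le a12 yr.
    apply: le_trans (ler_normD _ _) _; rewrite ger0_norm; last by clear -n2; lra.
    suff : `|a / z.2 * (2 * (z.2 - 1))| <= 1 by clear; rewrite /=; lra.
    have h2 : `|2 * (z.2 - 1)| <= 2 * (1 / 4) by rewrite normrM ger0_norm// ler_pM2l.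
    rewrite normrM; apply: le_trans (ler_pM (normr_ge0 _) (normr_ge0 _) ay h2) _.
    by clear; lra.
  apply: le_trans (Lin q1) _; apply: le_trans K0; rewrite oppr_le0.
  by apply: mulr_ge0; [exact/ltW/mulr_gt0|exact: mulr_ge0 (ltW e20) (powR_ge0 _ _)].
rewrite [\1_(obox _ _) z]indicE; case: (pselect (obox ey eps z)) => [zb|nzb].
  have qm := boxq z zb; rewrite -/q in qm.
  rewrite mem_set// mulr1 indicE mem_set; last first.
    by rewrite /unit_ball /= -/q; clear -qm em e20; lra.
  rewrite mulr1; have := Lin (lt_trans qm em).
  suff : k0 * eps `^ (- (N%:R + 1)) <= 4 * (p1 * (p1 - 1)) * (eps ^+ 2 * (q + eps ^+ 2) `^ (p1 - 2)).
    by clear -K0; lra.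
  rewrite /k0 -[leLHS]mulrA ler_pM2l; last exact: mulr_gt0.
  have -> : - (N%:R + 1) = 2 * p1 - 2 by rewrite /newton_exp; field.
  rewrite -powR_eps ?(ltW m0)// ler_pM2l//.
  by apply: powR_antitone; [clear -p10; lra|clear -q0 e20; lra|exact: ltW].
rewrite memNset// mulr0 subr0 indicE; have [q64|q64] := ltrP q (1 / 64).
  by rewrite mem_set ?mulr1.
rewrite memNset ?mulr0; last by rewrite /unit_ball /= -/q => /lt_geF; rewrite q64.
by rewrite /phi Lop_cutoff0//; rewrite -/q; clear -q64 e20; lra.
Qed.

End interior.

(** * A kernel from the Kelvin transform of y^(2s) *)

Section decay.
Context {R : realType} {N : nat}.
Local Notation E := ('rV[R]_N * R)%type.
Implicit Types (f g phi : E -> R) (z w e c : E) (U : set E) (h : R -> R) (t p k : R).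
Local Notation ey := (@ey R N).
Local Notation bas := (@bas R N).
Local Notation pos := [set t : R | 0 < t].
Local Notation half_space := (@half_space R N).

(** Minus a convex nondecreasing function that vanishes on t <= 0 and has slope at most 1;
    it truncates a function smoothly below a level. *)
Definition kink t : R := - (t * ek 0 t).

Lemma D1_ek (n : nat) t : 'D_1 (ek n) t = ek n.+2 t - n%:R * ek n.+1 t.
Proof. by have [_ ->] := is_derive_ek n t. Qed.

Lemma Cn_kink n : Cn n setT kink.
Proof. exact: (Cn_opp openT (Cn_mul openT (Cn_id n openT) (Cn_ek n 0))). Qed.

Lemma derive1_opp h t : derivable h t 1 -> 'D_1 (fun x => - h x) t = - 'D_1 h t.
Proof. by move=> dh; exact: (@deriveN _ _ _ h t 1 dh). Qed.

Lemma D1_kink t : 'D_1 kink t = - (ek 0 t + ek 1 t).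
Proof.
have de : derivable (ek 0) t 1 by have [d _] := is_derive_ek 0 t.
have di : derivable (fun x : R => x) t 1 by exact: derivable_id.
have dm : derivable (fun x : R => x * ek 0 x) t 1 := derivableM di de.
apply: etrans (derive1_opp dm) _; congr (- _).
apply: etrans (deriveM di de) _.
by rewrite D1_ek mul0r subr0 derive_id /GRing.scale /= ekS mulr1 addrC.
Qed.

Lemma D2_kink t : 'D_1 ('D_1 kink) t = - ek 3 t.
Proof.
have -> : 'D_1 kink = (fun t => - (ek 0 t + ek 1 t)) :> (R -> R).
  by apply/funext => x; exact: D1_kink.
have [d0 e0] := is_derive_ek 0 t; have [d1 e1] := is_derive_ek 1 t.
apply: etrans (derive1_opp (derivableD d0 d1)) _; congr (- _).
apply: etrans (deriveD d0 d1) _; rewrite e0 e1.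
by ring.
Qed.

Lemma slope_le1 t : ek 0 t + ek 1 t <= 1.
Proof.
have [t0|t0] := lerP t 0; first by rewrite !ek_le0// addr0.
rewrite /ek t0 expr0 expr1 -mulrDl expRN ler_pdivrMr ?expR_gt0// mul1r.
exact: expR_ge1Dx.
Qed.

Context (s tau : R).
Context (s0 : 0 < s) (s1 : s < 1) (tau0 : 0 < tau) (tau1 : tau <= 1).

(** Multiplication by y^(2s) turns L with weight y^(1-2s) into the operator with weight
    y^(1+2s), whose effective dimension is N + 1 + (1 + 2s). *)
Definition kdim : R := N%:R + 2 + 2 * s.
Definition kexp1 : R := (2 - kdim) / 2.
Definition kexp2 : R := (1 - kdim) / 2.
Local Notation a := (1 - 2 * s).
Local Notation D := kdim.
Local Notation p1 := kexp1.
Local Notation p2 := kexp2.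
Local Notation k := (tau ^+ 2).

(** In t = |z|^2 + tau^2 the first power is the fundamental solution in dimension kdim;
    the second, smaller by the factor tau / sqrt t, makes the sum subharmonic as soon
    as |z| exceeds a multiple of tau. *)
Definition kelvin_profile t : R := t `^ p1 + tau * t `^ p2.
Local Notation H := kelvin_profile.
Definition ypow z : R := ycoord z `^ (2 * s).
Definition kelvin z : R := ypow z * H (quad 1 0 z + k).

Lemma tau_sqr_gt0 : 0 < k. Proof. by rewrite exprn_gt0. Qed.

Lemma ycoord_half_space z : half_space z -> pos (ycoord z). Proof. by []. Qed.

Lemma Cn_ypow n : Cn n half_space ypow.
Proof.
apply: (Cn_comp open_half_space (@open_gt R 0) (Cn_pow n (2 * s)) _ ycoord_half_space).
exact: (@Cn_sub _ _ n setT) (Cn_ycoord n).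
Qed.

Lemma Cn_profile n : Cn n pos H.
Proof.
apply: (Cn_add (@open_gt R 0) (Cn_pow n p1)).
exact: (Cn_mul (@open_gt R 0) (Cn_cst n tau (@open_gt R 0)) (Cn_pow n p2)).
Qed.

Lemma D1_profile t : 0 < t -> 'D_1 H t = p1 * t `^ (p1 - 1) + tau * (p2 * t `^ (p2 - 1)).
Proof.
move=> t0; have [d1 e1] := is_derive1_powR p1 t0; have [d2 e2] := is_derive1_powR p2 t0.
have d3 : derivable (fun t => tau * t `^ p2) t 1 := @derivableZ R R R _ tau t 1 d2.
apply: etrans (deriveD d1 d3) _; rewrite e1; congr (_ + _).
by apply: etrans (@deriveZ R R R _ tau t 1 d2) _; rewrite e2.
Qed.

Lemma D2_profile t : 0 < t -> 'D_1 ('D_1 H) t =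
  p1 * (p1 - 1) * t `^ (p1 - 2) + tau * (p2 * (p2 - 1) * t `^ (p2 - 2)).
Proof.
move=> t0.
have e p : 'D_1 (fun t : R => t `^ (p - 1)) t = (p - 1) * t `^ (p - 2).
  by rewrite D1_powR//; congr (_ * _ `^ _); lra.
have [d1 _] := is_derive1_powR (p1 - 1) t0; have [d2 _] := is_derive1_powR (p2 - 1) t0.
have d1' : derivable (fun t => p1 * t `^ (p1 - 1)) t 1 := @derivableZ R R R _ p1 t 1 d1.
have d2' : derivable (fun t => p2 * t `^ (p2 - 1)) t 1 := @derivableZ R R R _ p2 t 1 d2.
have d3 : derivable (fun t => tau * (p2 * t `^ (p2 - 1))) t 1 := @derivableZ R R R _ tau t 1 d2'.
apply: etrans (@near_eq_derive _ _ _ _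
  (fun t => p1 * t `^ (p1 - 1) + tau * (p2 * t `^ (p2 - 1))) _ _ _) _.
  by apply: (open_near (@open_gt R 0) t0) => x /= x0; exact: D1_profile.
apply: etrans (deriveD d1' d3) _; congr (_ + _).
  by apply: etrans (@deriveZ R R R _ p1 t 1 d1) _; rewrite e /GRing.scale/= mulrA.
apply: etrans (@deriveZ R R R _ tau t 1 d2') _; congr (_ * _).
by apply: etrans (@deriveZ R R R _ p2 t 1 d2) _; rewrite e /GRing.scale/= mulrA.
Qed.

Lemma powR_p1 p t : 0 < t -> t `^ (p - 1) * t = t `^ p.
Proof.
move=> t0; rewrite -{2}[t]powRr1 ?ltW// -powRD; last by rewrite (gt_eqF t0) implybT.
by rewrite subrK.
Qed.

Lemma Cn_half_space f : (forall n, Cn n setT f) -> forall n, Cn n half_space f.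
Proof. by move=> Cf n; exact: (@Cn_sub _ _ n setT _ _ _ (Cf n)). Qed.

Lemma Gam_ypow f z : half_space z -> Gam f ypow z = 2 * s * ycoord z `^ (2 * s - 1) * 'D_ey f z.
Proof.
move=> z0; apply: etrans (Gam_compr f open_half_space z0 ycoord_half_space (Cn_pow 1 (2 * s))
  (Cn_half_space Cn_ycoord 1)) _.
by rewrite Gam_y D1_powR.
Qed.

(** The flux y^a (y^(2s))' is the constant 2s. *)
Lemma Lop_ypow z : half_space z -> Lop a ypow z = 0.
Proof.
move=> z0; apply: etrans (Lop_comp a open_half_space (@open_gt R 0) z0 ycoord_half_space
  (Cn_pow 2 (2 * s)) (Cn_half_space Cn_ycoord 2)) _.
rewrite D1_powR// D2_powR// Lop_y Gam_y D_ycoord powR_S// /ycoord /=.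
have z1 : z.2 != 0 by rewrite gt_eqF.
by field.
Qed.

Lemma Cn_kelvin n : Cn n half_space kelvin.
Proof.
exact: (Cn_mul open_half_space (Cn_ypow n) (Cn_half_space (fun m => Cn_radial 0 tau_sqr_gt0 (Cn_profile m)) n)).
Qed.

Lemma Lop_kelvin z : half_space z -> let q := quad 1 0 z + k in
  Lop a kelvin z = ypow z * (- (D * (D - 2)) * k * q `^ (p1 - 2) +
    tau * ((D - 1) * q `^ (p2 - 1) - (D - 1) * (D + 1) * k * q `^ (p2 - 2))).
Proof.
move=> z0 q.
have q0 : 0 < q by rewrite ltr_wpDl ?quad_ge0 ?tau_sqr_gt0.
have CH n : Cn n half_space (fun x => H (quad 1 0 x + k)).
  exact: (Cn_half_space (fun m => Cn_radial 0 tau_sqr_gt0 (Cn_profile m))).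
have Cq n : Cn n half_space (fun x => quad 1 0 x + k).
  exact: (Cn_half_space (fun m => Cn_addT (Cn_quad m 1 0) (Cn_cstT m k))).
have posq (x : E) : half_space x -> pos (quad 1 0 x + k).
  by move=> _; rewrite /= ltr_wpDl ?quad_ge0 ?tau_sqr_gt0.
apply: etrans (Lop_mul a open_half_space z0 (Cn_ypow 2) (CH 2)) _.
have Dy : 'D_ey (fun x => H (quad 1 0 x + k)) z = 'D_1 H q * (2 * z.2).
  apply: etrans (D_comp ey z0 posq (Cn_profile 1) (Cq 1)) _; rewrite -/q; congr (_ * _).
  by rewrite (D_shift k ey z0 (Cn_half_space (fun m => Cn_quad m 1 0) 1)) Dy_quad subr0 mulr1.
rewrite Lop_ypow// mulr0 addr0 GamC Gam_ypow// Dy.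
rewrite (Lop_radial a 0 z tau_sqr_gt0 (Cn_profile 2)) -/q D1_profile// D2_profile//.
have -> : ypow z = ycoord z `^ (2 * s - 1) * z.2 by rewrite powR_p1.
have -> : quad 1 0 z = q - k by rewrite addrK.
rewrite !powR_S// /ycoord /=.
have z1 : z.2 != 0 by rewrite gt_eqF.
by rewrite /kexp1 /kexp2 /kdim; field.
Qed.

Lemma ypow_le z : half_space z -> ypow z <= (quad 1 0 z + k) `^ s.
Proof.
move=> z0; have z0' : 0 <= z.2 := ltW z0.
rewrite /ypow /ycoord powRrM powR_mulrn//.
have Q0 := @quad_ge0 R N 1 0 z ler01.
apply: ge0_ler_powR; rewrite ?nnegrE ?sqr_ge0//; first exact: ltW.
- by rewrite addr_ge0// sqr_ge0.
- have := sq_ge_y 0 z; rewrite sq_quad subr0 => h.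
  by apply: le_trans h _; rewrite lerDl sqr_ge0.
Qed.

Context (N2 : (2 <= N)%N).

Lemma natr_ge2 : 2 <= (N%:R : R). Proof. by rewrite ler_nat. Qed.

Lemma profile_split q : 0 < q -> let r := q `^ (1 / 2) in
  [/\ 0 < r, r ^+ 2 = q, q `^ (p2 - 1) = q `^ (p1 - 2) * r & q `^ (p2 - 2) = q `^ (p1 - 2) / r].
Proof.
move=> q0 r; have r0 : 0 < r by exact: powR_gt0.
split=> //.
- by rewrite /r -powR_mulrn ?powR_ge0// -powRrM divfK// powRr1// ltW.
- rewrite /r -powRD; last by rewrite (gt_eqF q0) implybT.
  by congr (_ `^ _); rewrite /kexp1 /kexp2; lra.
- rewrite /r -powRN -powRD; last by rewrite (gt_eqF q0) implybT.
  by congr (_ `^ _); rewrite /kexp1 /kexp2; lra.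
Qed.

(** The bracket of Lop_kelvin divided by t^(p1 - 2), with r the square root of t. *)
Lemma kelvin_alg (d r : R) : 4 <= d -> tau <= r ->
  - (2 * d ^+ 2) * k <= - (d * (d - 2)) * k + tau * ((d - 1) * r - (d - 1) * (d + 1) * k / r) /\
  (2 * d * tau <= r -> 0 <= - (d * (d - 2)) * k + tau * ((d - 1) * r - (d - 1) * (d + 1) * k / r)).
Proof.
move=> d4 tr; have r0 : 0 < r := lt_le_trans tau0 tr.
set x := k / r; have -> : (d - 1) * (d + 1) * k / r = (d - 1) * (d + 1) * x by rewrite /x; ring.
have xt : x <= tau by rewrite /x ler_pdivrMr// expr2 ler_pM2l.
have x0 : 0 <= x by rewrite divr_ge0 ?sqr_ge0 ?ltW.
have h : tau * ((d - 1) * r - (d - 1) * (d + 1) * tau) <=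
    tau * ((d - 1) * r - (d - 1) * (d + 1) * x).
  rewrite ler_pM2l// lerD2l lerN2 ler_wpM2l// mulr_ge0//; lra.
split=> [|hr].
  have : 0 <= tau * ((d - 1) * r) by rewrite !mulr_ge0//; lra.
  have : 0 <= k by rewrite sqr_ge0.
  have : tau * ((d - 1) * r - (d - 1) * (d + 1) * tau) = tau * ((d - 1) * r) - (d ^+ 2 - 1) * k by ring.
  nra.
have : 0 <= tau * (d - 1) * (r - 2 * d * tau) by rewrite !mulr_ge0//; lra.
have : 0 <= k by rewrite sqr_ge0.
have : tau * ((d - 1) * r - (d - 1) * (d + 1) * tau) = tau * (d - 1) * (r - 2 * d * tau) + (d - 1) * (d - 1) * k by ring.
nra.
Qed.

(** Subharmonicity fails only for |z| = O(tau), where t is comparable with tau^2 and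
    y^(2s) <= t^s; counting powers gives tau^(2s + 2 p1 - 2) = tau^-(N + 2). *)
Lemma Lop_kelvin_ge z : half_space z ->
  - (2 * D ^+ 2) * tau `^ (- (N%:R + 2)) <= Lop a kelvin z /\
  (4 * D ^+ 2 * k <= quad 1 0 z -> 0 <= Lop a kelvin z).
Proof.
move=> z0; rewrite Lop_kelvin//; set q := quad 1 0 z + k.
have Q0 := @quad_ge0 R N 1 0 z ler01.
have k1 := tau_sqr_gt0.
have q0 : 0 < q by rewrite /q; lra.
have [r0 rq -> ->] := profile_split q0; set r := q `^ (1 / 2) in r0 rq *.
have d4 : 4 <= D by have n2 := natr_ge2; move: s0 => s0'; rewrite /kdim; lra.
have tr : tau <= r by rewrite -ler_sqr ?nnegrE ?(ltW tau0) ?(ltW r0)// rq /q; lra.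
have [h1 h2] := kelvin_alg d4 tr.
set X := q `^ (p1 - 2).
have X0 : 0 <= X by exact: powR_ge0.
set B := - (D * (D - 2)) * k + tau * ((D - 1) * r - (D - 1) * (D + 1) * k / r) in h1 h2.
have -> : - (D * (D - 2)) * k * X + tau * ((D - 1) * (X * r) - (D - 1) * (D + 1) * k * (X / r)) = X * B.
  by rewrite /B; ring.
have Y0 : 0 <= ypow z by exact: powR_ge0.
split=> [|hQ]; last first.
  rewrite mulr_ge0// mulr_ge0// h2// -ler_sqr ?nnegrE ?(ltW r0)//; last first.
    by rewrite !mulr_ge0// ?(ltW tau0)//; lra.
  by rewrite rq /q !exprMn; lra.
have YX : ypow z * X * k <= tau `^ (- (N%:R + 2)).
  apply: (@le_trans _ _ (q `^ s * X * k)).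
    by rewrite ler_wpM2r ?(ltW k1)// ler_wpM2r// ypow_le.
  rewrite /X -powRD; last by rewrite (gt_eqF q0) implybT.
  apply: (@le_trans _ _ (k `^ (s + (p1 - 2)) * k)).
    rewrite ler_wpM2r ?(ltW k1)//; apply: powR_antitone => //; last by rewrite /q; lra.
    by have n2 := natr_ge2; rewrite /kexp1 /kdim; lra.
  rewrite -powR_mulrn ?(ltW tau0)// -powRrM -powRD; last by rewrite (gt_eqF tau0) implybT.
  rewrite le_eqVlt; apply/orP; left; apply/eqP; congr (_ `^ _).
  by rewrite /kexp1 /kdim; lra.
have YX0 : 0 <= ypow z * X by exact: mulr_ge0.
apply: (@le_trans _ _ (ypow z * X * (- (2 * D ^+ 2) * k))).
  rewrite -subr_ge0.
  have -> : ypow z * X * (- (2 * D ^+ 2) * k) - - (2 * D ^+ 2) * tau `^ (- (N%:R + 2)) =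
    2 * D ^+ 2 * (tau `^ (- (N%:R + 2)) - ypow z * X * k) by ring.
  by rewrite mulr_ge0 ?subr_ge0// mulr_ge0 ?sqr_ge0.
by rewrite mulrA; apply: ler_wpM2l.
Qed.

Lemma kelvin_le z : half_space z ->
  kelvin z <= (quad 1 0 z + k) `^ (s + p1) + (quad 1 0 z + k) `^ (s + p2).
Proof.
move=> z0; set q := quad 1 0 z + k; have q0 : 0 < q by rewrite ltr_wpDl ?quad_ge0 ?tau_sqr_gt0.
have I0 : (q == 0) = false by rewrite gt_eqF.
rewrite !powRD ?I0 ?implybT// -mulrDr /kelvin /kelvin_profile -/q.
apply: ler_pM; first exact: powR_ge0.
- by rewrite addr_ge0 ?mulr_ge0 ?powR_ge0// ltW.
- exact: ypow_le.
- by rewrite lerD2l ler_piMl ?powR_ge0.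
Qed.

Lemma kelvin_ge z : ypow z * (quad 1 0 z + k) `^ p1 <= kelvin z.
Proof.
rewrite /kelvin ler_wpM2l ?powR_ge0// /kelvin_profile lerDl.
by rewrite mulr_ge0 ?powR_ge0// ltW.
Qed.

Lemma Gam_quad_kelvin z : half_space z -> let q := quad 1 0 z + k in
  Gam (quad 1 0) kelvin z =
    ypow z * (4 * quad 1 0 z * 'D_1 H q + 4 * s * H q).
Proof.
move=> z0 q.
have CH n : Cn n half_space (fun x => H (quad 1 0 x + k)).
  exact: (Cn_half_space (fun m => Cn_radial 0 tau_sqr_gt0 (Cn_profile m))).
have Cq n : Cn n half_space (fun x => quad 1 0 x + k).
  exact: (Cn_half_space (fun m => Cn_addT (Cn_quad m 1 0) (Cn_cstT m k))).
have posq (x : E) : half_space x -> pos (quad 1 0 x + k).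
  by move=> _; rewrite /= ltr_wpDl ?quad_ge0 ?tau_sqr_gt0.
apply: etrans (Gam_mulr _ z0 (Cn_ypow 1) (CH 1)) _.
rewrite Gam_ypow// Dy_quad.
have -> : Gam (quad 1 0) (fun x => H (quad 1 0 x + k)) z = 'D_1 H q * (4 * quad 1 0 z).
  apply: etrans (Gam_compr _ open_half_space z0 posq (Cn_profile 1) (Cq 1)) _.
  rewrite -/q; congr (_ * _).
  have -> : Gam (quad 1 0) (fun x => quad 1 0 x + k) z = Gam (quad 1 0) (quad 1 0) z.
    apply: eq_bigr => e _; congr (_ * _).
    exact: (D_shift k e z0 (Cn_half_space (fun m => Cn_quad m 1 0) 1)).
  by rewrite Gam_quad ?mulr1.
have -> : ypow z = ycoord z `^ (2 * s - 1) * z.2 by rewrite powR_p1.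
by rewrite -/q subr0; ring.
Qed.

(** By Cauchy-Schwarz it suffices to bound the radial derivative, and z . grad w is
    negative of order w because the Kelvin transform is homogeneous of degree -N, up to the
    regularisation. *)
Lemma Gam_kelvin_ge z : half_space z -> 2 * k <= quad 1 0 z ->
  (ypow z * (quad 1 0 z + k) `^ (p1 - 1)) ^+ 2 * quad 1 0 z <= Gam kelvin kelvin z.
Proof.
move=> z0 hQ; set Q := quad 1 0 z in hQ *; set q := Q + k.
have k1 := tau_sqr_gt0.
have Q0 : 0 < Q by lra.
have q0 : 0 < q by rewrite /q; lra.
have n2 := natr_ge2.
have CS := Gam_CS (quad 1 0) kelvin z; rewrite Gam_quad ?mulr1// -/Q in CS.
have G : Gam (quad 1 0) kelvin z <= - (2 * (ypow z * q `^ (p1 - 1)) * Q).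
  rewrite Gam_quad_kelvin// -/Q -/q D1_profile// /kelvin_profile.
  have -> : q `^ p1 = q `^ (p1 - 1) * q by rewrite powR_p1.
  have -> : q `^ p2 = q `^ (p2 - 1) * q by rewrite powR_p1.
  have -> : - (2 * (ypow z * q `^ (p1 - 1)) * Q) = ypow z * (- (2 * q `^ (p1 - 1) * Q)) by ring.
  rewrite ler_wpM2l ?powR_ge0//.
  have B0 := powR_ge0 q (p2 - 1); have A0 := powR_ge0 q (p1 - 1).
  have h p : p + s <= - 1 -> p * Q + s * q <= - (Q / 2).
    move=> ps; have : 0 <= (- 1 - (p + s)) * Q by rewrite mulr_ge0//; lra.
    have : 0 <= (1 - s) * k by rewrite mulr_ge0 ?subr_ge0 ?(ltW s1) ?(ltW k1).
    by rewrite /q; lra.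
  have h1 : p1 * Q + s * q <= - (Q / 2) by apply: h; rewrite /kexp1 /kdim; lra.
  have h2 : p2 * Q + s * q <= 0.
    by apply: (@le_trans _ _ (- (Q / 2))); [apply: h; rewrite /kexp2 /kdim; lra|lra].
  have -> : 4 * Q * (p1 * q `^ (p1 - 1) + tau * (p2 * q `^ (p2 - 1))) +
    4 * s * (q `^ (p1 - 1) * q + tau * (q `^ (p2 - 1) * q)) =
    4 * q `^ (p1 - 1) * (p1 * Q + s * q) + 4 * (tau * q `^ (p2 - 1)) * (p2 * Q + s * q) by ring.
  have : 0 <= q `^ (p1 - 1) * (- (Q / 2) - (p1 * Q + s * q)) by rewrite mulr_ge0// subr_ge0.
  have : 0 <= tau * q `^ (p2 - 1) * (- (p2 * Q + s * q)).
    by apply: mulr_ge0; [exact: mulr_ge0 (ltW tau0) B0|rewrite oppr_ge0].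
  by move: (q `^ (p1 - 1)) (q `^ (p2 - 1)) => A B; lra.
set W := ypow z * q `^ (p1 - 1) in G *.
have W0 : 0 <= W by apply: mulr_ge0; exact: powR_ge0.
have WQ : 0 <= 2 * W * Q by apply: mulr_ge0 (ltW Q0); apply: mulr_ge0.
have : (2 * W * Q) ^+ 2 <= Gam (quad 1 0) kelvin z ^+ 2.
  rewrite -[leRHS]sqrrN; apply: lerXn2r; rewrite ?nnegrE//; first by lra.
  by lra.
move=> /le_trans /(_ CS).
have -> : (2 * W * Q) ^+ 2 = 4 * Q * (W ^+ 2 * Q) by ring.
by rewrite ler_pM2l//; lra.
Qed.

End decay.

Section decay_kernel.
Context {R : realType} {N : nat}.
Local Notation E := ('rV[R]_N * R)%type.
Implicit Types (f g phi : E -> R) (z w e : E).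
Local Notation ey := (@ey R N).
Local Notation half_space := (@half_space R N).

Lemma ek3_ge (m W t : R) : 0 < m -> m <= t <= W -> W^-1 ^+ 3 * expR (- m^-1) <= ek 3 t.
Proof.
move=> m0 /andP[mt tW]; have t0 : 0 < t := lt_le_trans m0 mt.
rewrite /ek t0; apply: ler_pM; rewrite ?expR_ge0// ?exprn_ge0 ?invr_ge0//.
- by rewrite (le_trans (ltW t0)).
- by rewrite lerXn2r ?nnegrE ?invr_ge0 ?(ltW t0) ?(le_trans (ltW t0))// lef_pV2 ?posrE// (lt_le_trans t0).
- by rewrite ler_expR lerN2 lef_pV2 ?posrE.
Qed.

Lemma kink_le0 (t : R) : t <= 0 -> kink t = 0.
Proof. by move=> t0; rewrite /kink ek_le0// mulr0 oppr0. Qed.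

(** For phi = kink(w - m) and G = -kink, L phi = -G'(w - m) L w - G''(w - m) |grad w|^2. The first term
    is positive only near the origin and, since G' <= 1, of size tau^-(N+2) at most; the second
    is uniformly negative on the shell, because w is at least 2m there. The level m cuts off a
    neighbourhood of {y = 0}, where w vanishes, and the exterior of a ball, where w decays. *)
Lemma decay_kernel (s a dl : R) : 0 < s < 1 -> a = 1 - 2 * s -> (2 <= N)%N -> 0 < dl <= 1 ->
  exists (C k0 K : R), [/\ 0 < C, 0 < k0 & forall tau : R, 0 < tau < dl / 2 ->
    exists phi, [/\ test_function setT phi,
      forall x, 0 <= phi (x, 0) /\ 'D_ey phi (x, 0) = 0 &
      forall z, half_space z -> Lop a phi z <=
        (K * tau `^ (- (N%:R + 2))) * \1_(upper_ball (C * tau ^+ 2)) z -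
        k0 * \1_(shell dl 36) z]].
Proof.
move=> /andP[s0 s1] -> N2 /andP[dl0 dl1].
have n2 : 2 <= (N%:R : R) by rewrite ler_nat.
pose D := @kdim R N s; pose p1 := @kexp1 R N s; pose p2 := @kexp2 R N s.
have p1E : p1 = - (N%:R / 2) - s by rewrite /p1 /kexp1 /kdim; lra.
have p2E : p2 = p1 - 1 / 2 by rewrite /p2 /p1 /kexp2 /kexp1; lra.
have D0 : 0 < D by rewrite /D /kdim; lra.
pose A : R := dl `^ (2 * s).
have A0 : 0 < A by exact: powR_gt0.
(* On the shell w is at least 2 m, since y > dl and |z|^2 + tau^2 < 37 there. *)
pose m : R := A * 37 `^ p1 / 2.
have m0 : 0 < m by apply: divr_gt0 => //; apply: mulr_gt0 => //; exact: powR_gt0.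
pose W : R := (dl ^+ 2) `^ (s + p1) + (dl ^+ 2) `^ (s + p2).
pose gm : R := W^-1 ^+ 3 * expR (- m^-1).
have W0 : 0 < W by apply: addr_gt0; rewrite powR_gt0// exprn_gt0.
have gm0 : 0 < gm by rewrite mulr_gt0 ?expR_gt0// exprn_gt0// invr_gt0.
pose k1 : R := (A * 37 `^ (p1 - 1)) ^+ 2 * dl ^+ 2.
have k10 : 0 < k1.
  by apply: mulr_gt0; apply: exprn_gt0 => //; apply: mulr_gt0 => //; exact: powR_gt0.
exists (4 * D ^+ 2), (gm * k1), (2 * D ^+ 2); split; first by rewrite mulr_gt0// exprn_gt0.
  exact: mulr_gt0.
move=> tau /andP[tau0 taul].
have tau1 : tau <= 1 by lra.
have k0' : 0 < tau ^+ 2 by rewrite exprn_gt0.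
have kdl : 2 * tau ^+ 2 <= dl ^+ 2 by nra.
have k37 : tau ^+ 2 <= 1 by nra.
pose w := @kelvin R N s tau.
have Cw n : Cn n half_space w := Cn_kelvin s tau0 n.
pose f (z : E) : R := kink (w z + - m).
have Cf n : Cn n half_space f.
  apply: (Cn_comp open_half_space openT (Cn_kink n) _ (fun _ _ => I)).
  exact: (Cn_add open_half_space (Cw n) (Cn_cst n (- m) open_half_space)).
pose phi (z : E) : R := if 0 < z.2 then f z else 0.
have phiE z : half_space z -> phi z = f z by rewrite /phi /half_space /= => ->.
have [y1 y10 wy] : exists2 y1 : R, 0 < y1 & forall z, half_space z -> z.2 < y1 -> w z <= m.
  pose B : R := (tau ^+ 2) `^ p1 + tau * (tau ^+ 2) `^ p2.
  have B0 : 0 < B by apply: addr_gt0; rewrite ?mulr_gt0 ?powR_gt0.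
  have mB : 0 < m / B := divr_gt0 m0 B0.
  exists ((m / B) `^ (2 * s)^-1); first by apply: powR_gt0; exact: divr_gt0.
  move=> z z0 zy; have z0' : 0 < z.2 := z0.
  have q0 := @quad_ge0 R N 1 0 z ler01.
  have Yb : ypow s z <= m / B.
    have -> : m / B = ((m / B) `^ (2 * s)^-1) `^ (2 * s).
      rewrite -powRrM mulVf ?powRr1 ?(ltW mB)//.
      by apply: lt0r_neq0; exact: mulr_gt0.
    by apply: ge0_ler_powR; rewrite ?nnegrE ?mulr_ge0 ?powR_ge0 ?ltW.
  have Hb : @kelvin_profile R N s tau (quad 1 0 z + tau ^+ 2) <= B.
    apply: lerD; last (rewrite ler_pM2l//);
      by apply: powR_antitone; rewrite ?lerDr// -/p1 -/p2; lra.
  apply: le_trans (_ : m / B * B <= _); last by rewrite divfK// gt_eqF.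
  by apply: ler_pM; rewrite ?powR_ge0// addr_ge0 ?mulr_ge0 ?powR_ge0 ?ltW.
have phi_small z : z.2 < y1 -> phi z = 0.
  rewrite /phi; case: ifPn => // z0 zy; rewrite /f kink_le0// subr_le0; exact: wy.
have w_far z : half_space z -> 1 + 2 / m <= quad 1 0 z -> w z <= m.
  move=> z0 zm; apply: le_trans (kelvin_le s0 tau0 tau1 z0) _; rewrite -/p1 -/p2.
  set q := _ + tau ^+ 2; have qm : 1 + 2 / m <= q by rewrite /q; lra.
  have m20 : 0 < 2 / m by rewrite divr_gt0.
  have q1 : 1 <= q by lra.
  have qi : q^-1 <= m / 2.
    by rewrite -[m / 2]invrK invf_div lef_pV2 ?posrE; lra.
  have pw (p : R) : p <= - 1 -> q `^ p <= m / 2.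
    by move=> p1'; apply: le_trans qi; rewrite -powR_inv1 ?(le_trans ler01)// ler_powR.
  have := pw (s + p1) _; have := pw (s + p2) _; lra.
have Cphi n : Cn n setT phi.
  have -> : [set: E] = half_space `|` [set z : E | z.2 < y1].
    apply/esym/seteqP; split=> // z _; have [z0|z0] := ltrP 0 z.2; first by left.
    by right; rewrite /= (le_lt_trans z0).
  have oy : open [set z : E | z.2 < y1].
    have -> : [set z : E | z.2 < y1] = (@ycoord R N) @^-1` [set t : R | t < y1] by [].
    by apply: open_comp; [move=> z _; exact: (Cn_continuous (Cn_ycoord 0) I)|exact: open_lt].
  apply: Cn_setU.
    by apply: (Cn_eq open_half_space _ (Cf n)) => z z0; rewrite phiE.
  by apply: (Cn_eq oy _ (Cn_cst n 0 oy)) => z zy; rewrite phi_small.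
exists phi; split.
- apply: (@test_functionI _ _ _ [set z : E | quad 1 0 z <= 1 + 2 / m]) => //.
  + exact/smoothP.
  + exact: quad_compact.
  + move=> z /= /negP; rewrite -ltNge => /ltW zm; rewrite /phi; case: ifPn => // z0.
    by rewrite /f kink_le0// subr_le0; exact: w_far.
- move=> x; split; first by rewrite phi_small.
  apply: etrans (@D_near R N [set z | z.2 < y1] phi (fun=> 0) ey (x, 0) _ _ _) _ => //.
  + have -> : [set z : E | z.2 < y1] = (@ycoord R N) @^-1` [set t : R | t < y1] by [].
    by apply: open_comp; [move=> z _; exact: (Cn_continuous (Cn_ycoord 0) I)|exact: open_lt].
  + exact: (@derive_cst _ E R 0 (x, 0) ey).
move=> z z0; have z0' : 0 < z.2 := z0.
rewrite (@Lop_near R N _ half_space phi f z open_half_space z0 phiE).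
have Cm n : Cn n half_space (fun x => w x + - m).
  exact: (Cn_add open_half_space (Cw n) (Cn_cst n (- m) open_half_space)).
have LE : Lop (1 - 2 * s) f z =
    - (ek 0 (w z - m) + ek 1 (w z - m)) * Lop (1 - 2 * s) w z - ek 3 (w z - m) * Gam w w z.
  apply: etrans (Lop_comp _ open_half_space openT z0 (fun _ _ => I) (Cn_kink 2) (Cm 2)) _.
  rewrite D1_kink D2_kink (Lop_shift _ (- m) open_half_space z0 (Cw 2)).
  by rewrite (Gam_shift (- m) z0 (Cw 1)) mulNr [X in _ + X]mulNr.
rewrite LE; have [L1 L2] := Lop_kelvin_ge s0 tau0 N2 z0.
set q := quad 1 0 z in L2 *.
have q0 : 0 <= q by exact: quad_ge0.
have y2q : z.2 ^+ 2 <= q by have := sq_ge_y 0 z; rewrite sq_quad subr0.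
set G := Gam w w z; set L := Lop (1 - 2 * s) w z; set g := ek 0 _ + ek 1 _.
have g01 : 0 <= g <= 1 by rewrite slope_le1 addr_ge0 ?ek_ge0.
have G0 : 0 <= G by apply: sumr_ge0 => e _; rewrite -expr2 sqr_ge0.
have Lpart : - g * L <= 2 * D ^+ 2 * tau `^ (- (N%:R + 2)) * \1_(upper_ball (4 * D ^+ 2 * tau ^+ 2)) z.
  rewrite indicE; case: (pselect (upper_ball (4 * D ^+ 2 * tau ^+ 2) z)) => [zb|nzb].
    rewrite mem_set// mulr1; move: L1; rewrite -/L -/D; set P := 2 * D ^+ 2 * _.
    have P0 : 0 <= P by apply: mulr_ge0; [rewrite mulr_ge0 ?sqr_ge0|exact: powR_ge0].
    rewrite mulNr -/P => L1; case/andP: g01 => g0 g1.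
    have : 0 <= g * (L + P) by rewrite mulr_ge0//; lra.
    have : 0 <= (1 - g) * P by rewrite mulr_ge0// subr_ge0.
    lra.
  rewrite memNset// mulr0 mulNr oppr_le0 mulr_ge0//; first by case/andP: g01.
  by apply: L2; rewrite leNgt; apply/negP => zq; apply: nzb; split.
have Gpart : gm * k1 * \1_(shell dl 36) z <= ek 3 (w z - m) * G.
  rewrite indicE; case: (pselect (shell dl 36 z)) => [[zdl z36]|nz]; last first.
    by rewrite memNset// mulr0; apply: mulr_ge0 => //; exact: ek_ge0.
  rewrite mem_set ?mulr1//; rewrite -/q in z36.
  have d2q : dl ^+ 2 <= q.
    by apply: le_trans y2q; rewrite ler_pXn2r// ?nnegrE ltW.
  have Ay : A <= ypow s z.
    by apply: ge0_ler_powR; rewrite ?nnegrE ?mulr_ge0 ?ltW.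
  have qp : 0 < q + tau ^+ 2 by lra.
  have q37 : q + tau ^+ 2 <= 37 by lra.
  have A00 := ltW A0.
  have p10 : p1 <= 0 by lra.
  apply: ler_pM; [exact: ltW|exact: ltW| |].
    apply: ek3_ge => //; apply/andP; split.
      have := kelvin_ge s tau0 z; rewrite -/w -/q -/p1 => H.
      have : A * 37 `^ p1 <= ypow s z * (q + tau ^+ 2) `^ p1.
        by apply: ler_pM; rewrite ?powR_ge0//; exact: powR_antitone.
      by rewrite /m; lra.
    apply: (@le_trans _ _ (w z)); first by rewrite gerBl ltW.
    apply: le_trans (kelvin_le s0 tau0 tau1 z0) _; rewrite -/q -/p1 -/p2.
    apply: lerD; apply: powR_antitone; rewrite ?exprn_gt0//; lra.
  apply: le_trans (Gam_kelvin_ge s1 tau0 N2 z0 _); rewrite -/q -/p1; last by lra.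
  apply: ler_pM; rewrite ?sqr_ge0//.
  have B37 : 0 <= 37 `^ (p1 - 1) by exact: powR_ge0.
  apply: lerXn2r; rewrite ?nnegrE ?mulr_ge0 ?powR_ge0//.
  apply: ler_pM => //; apply: powR_antitone => //; lra.
lra.
Qed.

End decay_kernel.

(** * Growth of a positive solution *)

Section growth.
Context {R : realType} {N : nat}.
Local Notation E := ('rV[R]_N * R)%type.
Implicit Types (u v phi : E -> R) (z w : E) (S T : set E).
Local Notation ey := (@ey R N).
Local Notation half_space := (@half_space R N).
Local Notation closed_half_space := (@closed_half_space R N).
Local Notation lpt := (@Defs.lebesgue_pt R N).

Lemma obox_volume (c : E) (r : R) : 0 < r -> fine (lpt (obox c r)) = (2 * r) ^+ N.+1.
Proof.
move=> r0.
have itvE (t0 t : R) : (`|t - t0| < r) = (t \in `]t0 - r, t0 + r[).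
  by rewrite ltr_distl in_itv.
have lE (t0 : R) : lebesgue_measure (`]t0 - r, t0 + r[%classic : set R) = (2 * r)%:E.
  rewrite lebesgue_measure_itv /= lte_fin ltrBlDr -addrA ltrDl ifT ?addr_gt0//.
  by rewrite -EFinB; congr EFin; ring.
have -> : obox c r = [set x : 'rV[R]_N | forall i,
    `](c.1 ord0 i - r), (c.1 ord0 i + r)[%classic (x ord0 i)] `*` `](c.2 - r), (c.2 + r)[%classic.
  apply/seteqP; split=> z [h1 h2]; split.
  - by move=> i /=; rewrite -itvE; exact: h1.
  - by rewrite /= -itvE.
  - by move=> i; rewrite itvE; exact: h1.
  - by rewrite itvE; exact: h2.
rewrite /Defs.lebesgue_pt product_measure1E//; last first.
  exact: (@measurable_box R N (fun i => `](c.1 ord0 i - r), (c.1 ord0 i + r)[%classic)).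
have := @lebesgue_rV_box R N (fun i => `](c.1 ord0 i - r), (c.1 ord0 i + r)[%classic) (fun=> measurable_itv _).
move=> /= ->.
rewrite (eq_bigr (fun=> (2 * r)%:E)) => [|i _]; last exact: lE.
rewrite lE prodEFin -EFinM /= prodr_const card_ord exprSr.
by [].
Qed.

Lemma mass_obox_ge (a m : R) u (c : E) (r : R) : -1 < a ->
  {within closed_half_space, continuous u} -> 0 < r -> obox c r `<=` half_space ->
  (forall z, obox c r z -> m <= z.2 `^ a * u z) ->
  m * (2 * r) ^+ N.+1 <= mass a u (obox c r).
Proof.
move=> a1 cu r0 bH hm.
have mb := measurable_obox c r.
have [r' br] : exists r', obox c r `<=` cbox r'.
  exists (\sum_i `|c.1 ord0 i| + `|c.2| + r) => z [h1 h2].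
  have S0 : 0 <= \sum_i `|c.1 ord0 i| by apply: sumr_ge0.
  have c20 := normr_ge0 c.2.
  split=> [i|].
    have ci : `|c.1 ord0 i| <= \sum_i `|c.1 ord0 i| by rewrite (bigD1 i)//= lerDl sumr_ge0.
    have := h1 i; have : `|z.1 ord0 i| <= `|z.1 ord0 i - c.1 ord0 i| + `|c.1 ord0 i|.
      by rewrite -[in leLHS](subrK (c.1 ord0 i) (z.1 ord0 i)) ler_normD.
    lra.
  have : `|z.2| <= `|z.2 - c.2| + `|c.2| by rewrite -[in leLHS](subrK c.2 z.2) ler_normD.
  lra.
rewrite -(obox_volume c r0) -(Rintegral_cst lpt mb m).
apply: le_Rintegral => //.
- apply: (@integrable_bounded R N _ (fun=> m) r' `|m|) => //.
- exact: (integrable_mass a1 cu mb bH br).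
Qed.

Lemma quad_scaled (c : E) (x0 : 'rV[R]_N) (l : R) z : 0 < l ->
  quad 1 c (dil x0 l z) = l^-1 ^+ 2 * quad 1 (x0 + l *: c.1, l * c.2) z.
Proof.
move=> l0; have ln : l != 0 by rewrite gt_eqF.
rewrite /quad !mul1r dil2 mulrDr mulr_sumr; congr (_ + _) => /=.
  by apply: eq_bigr => i _; rewrite dil1 !mxE; field.
by field.
Qed.

Lemma quad_ball_scaled (c : E) (x0 : 'rV[R]_N) (l t : R) z : 0 < l ->
  (quad 1 c (dil x0 l z) < t) = (quad 1 (x0 + l *: c.1, l * c.2) z < l ^+ 2 * t).
Proof. by move=> l0; rewrite quad_scaled// exprVn ltr_pdivrMl ?exprn_gt0. Qed.

Lemma quad_cbox (c : E) (t : R) : exists r, [set z : E | quad 1 c z < t] `<=` cbox r.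
Proof.
have [r _ h] := compact_sub_cbox (@quad_compact R N c t).
by exists r => z /= /ltW zt; exact: h.
Qed.

Lemma open_shell (dl t : R) : open (shell dl t : set E).
Proof.
have -> : shell dl t = [set z : E | dl < z.2] `&` [set z : E | quad 1 0 z < t] by [].
apply: openI; last exact: open_quad_lt.
have -> : [set z : E | dl < z.2] = (@ycoord R N) @^-1` [set s : R | dl < s] by [].
by apply: open_comp; [move=> z _; exact: (Cn_continuous (Cn_ycoord 0) I)|exact: open_gt].
Qed.

Lemma open_unit_ball (t : R) : open (unit_ball t : set E).
Proof. exact: open_quad_lt. Qed.

Lemma upper_ballE (t : R) : upper_ball t = shell 0 t :> set E.
Proof. by []. Qed.

Lemma open_obox (c : E) (r : R) : 0 < r -> open (obox c r).
Proof. by move=> r0; rewrite -ball_obox//; exact: ball_open. Qed.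

Lemma unit_ball_half z : unit_ball (1 / 64) z -> 7 / 8 < z.2 < 9 / 8.
Proof.
rewrite /unit_ball /= -sq_quad => zq; have := le_lt_trans (sq_ge_y ey z) zq.
rewrite /=; nra.
Qed.

Section estimate.
Context (s a : R) (u v : E -> R).
Context (s0 : 0 < s) (s1 : s < 1) (aE : a = 1 - 2 * s) (N2 : (2 <= N)%N).
Context (cu : {within closed_half_space, continuous u}) (Hu : H1a_loc a u).
Context (wu : weak_equation a u v) (u0 : forall z, closed_half_space z -> 0 < u z).
Local Notation d := (N%:R + 1 + a).

Lemma weight_range : -1 < a < 1.
Proof. by move: s0 s1 => t0 t1; rewrite aE; apply/andP; split; lra. Qed.

Lemma weight_gtN1 : -1 < a. Proof. by case/andP: weight_range. Qed.

(** On a small box around (x0, y0) continuity gives u y^a at least half its value at the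
    centre; the factor eps^-(N+1) of the kernel cancels the volume of the box. *)
Lemma interior_bound : exists2 C, 0 <= C & forall (x0 : 'rV[R]_N) (y0 : R), 0 < y0 ->
  u (x0, y0) * y0 `^ d <= C * mass a u (scaled x0 y0 (unit_ball (1 / 64))).
Proof.
have a1 := weight_gtN1.
have [dl [k0 [K [dl0 k00 HK]]]] := interior_kernel N2 weight_range.
exists (`|K| / (k0 * 2 ^+ N)) => [|x0 y0 y00].
  by rewrite divr_ge0// mulr_ge0 ?exprn_ge0// ltW.
pose p : E := (x0, y0).
pose F z : R := z.2 `^ a * u z.
have p0 : half_space p by [].
have F0 : 0 < F p by rewrite mulr_gt0 ?powR_gt0// u0// /closed_half_space /= ltW.
have cF : {for p, continuous F}.
  apply: continuousM; last exact: within_half_space.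
  apply: (@continuous_comp _ _ _ (@snd 'rV[R]_N R) (fun y : R => y `^ a)); first exact: cvg_snd.
  exact: powR_cont.
have : nbhs p [set z | F p / 2 < F z].
  apply: (cF [set t | F p / 2 < t]).
  apply: open_nbhs_nbhs; split; first exact: open_gt.
  by rewrite /= ltr_pdivrMr// ltr_pMr// ltr1n.
move=> /nbhs_obox[r r0 rF].
pose eps : R := Num.min (dl / 2) (r / y0).
have eps0 : 0 < eps by rewrite lt_min !divr_gt0.
have epsdl : eps < dl by rewrite gt_min ltr_pdivrMr// ltr_pMr// ltr1n.
have epsr : eps * y0 <= r by rewrite -ler_pdivlMr// ge_min lexx orbT.
have [sub [phi [tphi phi0 Lphi]]] := HK eps (introT andP (conj eps0 epsdl)).
have [rS hS] := quad_cbox ey (1 / 64).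
have SH : unit_ball (1 / 64) `<=` half_space.
  by move=> z /unit_ball_half /andP[z1 _]; rewrite /Defs.half_space /=; lra.
have TH : scaled x0 y0 (obox ey eps) `<=` half_space := scaled_half y00 (subset_trans sub SH).
have := mass_comparison a1 cu Hu wu u0 tphi (fun x => (phi0 x).1) (fun x => (phi0 x).2)
  (@open_unit_ball (1 / 64)) (@open_obox ey eps eps0) SH (subset_trans sub SH)
  hS (subset_trans sub hS) Lphi x0 y00.
have scE : scaled x0 y0 (obox ey eps) = obox p (eps * y0).
  have dE (t t0 : R) : (`|y0^-1 * t - t0| < eps) = (`|t - y0 * t0| < eps * y0).
    have -> : y0^-1 * t - t0 = y0^-1 * (t - y0 * t0) by rewrite mulrBr mulKf// gt_eqF.
    by rewrite normrM gtr0_norm ?invr_gt0// mulrC ltr_pdivrMr.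
  have d1E (t t0 : R) : (`|y0^-1 * (t - t0) - 0| < eps) = (`|t - t0| < eps * y0).
    by rewrite dE mulr0 subr0.
  apply/seteqP; split=> z [h1 h2]; split.
  - by move=> i; have := h1 i; rewrite dil1 mxE d1E.
  - by move: h2; rewrite dil2 dE mulr1.
  - by move=> i; rewrite dil1 mxE d1E; exact: h1.
  - by rewrite dil2 dE mulr1; exact: h2.
rewrite scE in TH *.
have e20 : 0 < eps * y0 by rewrite mulr_gt0.
have bsub : obox p (eps * y0) `<=` obox p r.
  by move=> z [h1 h2]; split=> [i|]; [exact: lt_le_trans (h1 i) epsr|exact: lt_le_trans h2 epsr].
have := @mass_obox_ge a (F p / 2) u p (eps * y0) a1 cu e20 TH (fun z bz => ltW (rF z (bsub z bz))).
set m1 := mass a u (obox _ _); set M := mass a u _ => h1 h2.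
have M0 : 0 <= M.
  apply: mass_ge0 => // z /(scaled_half y00 SH) z0; exact: ltW.
have e1 : eps `^ (- (N%:R + 1)) * eps ^+ N.+1 = 1.
  have -> : - (N%:R + 1) = - N.+1%:R :> R by rewrite -[N.+1]addn1 natrD.
  rewrite powRN powR_mulrn ?(ltW eps0)// mulVf// expf_neq0// gt_eqF//.
have e2 : u (x0, y0) * y0 `^ d = F p * y0 ^+ N.+1.
  rewrite powRD; last by rewrite (gt_eqF y00) implybT.
  have -> : N%:R + 1 = N.+1%:R :> R by rewrite -[N.+1]addn1 natrD.
  by rewrite powR_mulrn ?(ltW y00)// /F /=; ring.
have ep0 : 0 <= k0 * eps `^ (- (N%:R + 1)) by rewrite mulr_ge0 ?powR_ge0// ltW.
have h3 := le_trans (ler_wpM2l ep0 h1) h2.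
have e3 : k0 * eps `^ (- (N%:R + 1)) * (F p / 2 * (2 * (eps * y0)) ^+ N.+1) =
    k0 * 2 ^+ N * (F p * y0 ^+ N.+1).
  transitivity (k0 * (eps `^ (- (N%:R + 1)) * eps ^+ N.+1) * 2 ^+ N * (F p * y0 ^+ N.+1)).
    by rewrite !exprMn [2 ^+ N.+1]exprS; field.
  by rewrite e1 mulr1.
rewrite e2 [leRHS]mulrAC ler_pdivlMr; last by rewrite mulr_gt0// exprn_gt0.
rewrite mulrC -e3; apply: le_trans h3 _.
by rewrite ler_wpM2r// ler_norm.
Qed.

Lemma shell_half (dl t : R) : 0 <= dl -> (shell dl t : set E) `<=` half_space.
Proof. by move=> dl0 z [zl _]; rewrite /Defs.half_space /=; exact: le_lt_trans zl. Qed.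

Lemma shell_cbox (dl t : R) : exists r, (shell dl t : set E) `<=` cbox r.
Proof.
by have [r h] := quad_cbox 0 t; exists r => z [_ zt]; exact: h.
Qed.

Lemma mass_scaled_le x0 x1 (l l' : R) S T : 0 < l -> 0 < l' -> open S -> open T ->
  (exists r, T `<=` cbox r) -> T `<=` half_space -> scaled x0 l S `<=` scaled x1 l' T ->
  mass a u (scaled x0 l S) <= mass a u (scaled x1 l' T).
Proof.
move=> l0 l0' oS oT [r Tr] TH ST.
have [r' _ Tr'] := scaled_cbox x1 l0' Tr.
apply: (mass_le weight_gtN1 cu u0 _ _ ST (scaled_half l0' TH) Tr').
  by apply: open_measurableE; exact: open_scaled.
by apply: open_measurableE; exact: open_scaled.
Qed.

Lemma boundary_bound : exists dl C : R, [/\ 0 < dl <= 1, 0 <= C &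
  forall (x0 : 'rV[R]_N) (l eps : R), 0 < l -> 0 < eps < dl ->
  mass a u (scaled x0 l (upper_ball (eps ^+ 2))) <=
    C * eps `^ d * mass a u (scaled x0 l (shell dl 16))].
Proof.
have a1 := weight_gtN1.
have [dl [k0 [K [dl01 k00 HK]]]] := boundary_kernel N2 weight_range.
have dl0 : 0 < dl by case/andP: dl01.
exists dl, (`|K| / k0); split=> [//||x0 l eps l0 e0]; first by rewrite divr_ge0// ltW.
have eps0 : 0 < eps by case/andP: e0.
have [phi [tphi phi0 Lphi]] := HK eps e0.
have [r1 hr1] := shell_cbox dl 16; have [r2 hr2] := shell_cbox 0 (eps ^+ 2).
pose r := Num.max r1 r2.
have cbr (t t' : R) : t <= t' -> cbox t `<=` (cbox t' : set E).
  by move=> tt z [h1 h2]; split=> [i|]; [exact: le_trans (h1 i) tt|exact: le_trans h2 tt].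
have hS : (shell dl 16 : set E) `<=` cbox r.
  by apply: subset_trans hr1 _; apply: cbr; rewrite le_max lexx.
have hT : (upper_ball (eps ^+ 2) : set E) `<=` cbox r.
  by apply: subset_trans hr2 _; apply: cbr; rewrite le_max lexx orbT.
have := mass_comparison a1 cu Hu wu u0 tphi (fun x => (phi0 x).1) (fun x => (phi0 x).2)
  (@open_shell dl 16) (@open_shell 0 (eps ^+ 2)) (@shell_half dl 16 (ltW dl0))
  (@shell_half 0 (eps ^+ 2) (lexx 0)) hS hT Lphi x0 l0.
rewrite -upper_ballE; set m1 := mass _ _ _; set M := mass _ _ _ => h1.
have M0 : 0 <= M.
  apply: mass_ge0 => // z /(scaled_half l0 (@shell_half dl 16 (ltW dl0))) z0; exact: ltW.
have e1 : eps `^ d * eps `^ (- d) = 1.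
  by rewrite powRN mulfV// gt_eqF// powR_gt0.
have h3 := le_trans h1 (ler_wpM2r M0 (ler_norm K)).
have E0 : 0 <= eps `^ d / k0 by rewrite divr_ge0 ?powR_ge0// ltW.
have -> : `|K| / k0 * eps `^ d * M = eps `^ d / k0 * (`|K| * M) by ring.
have -> : m1 = eps `^ d / k0 * (k0 * eps `^ (- d) * m1).
  transitivity (eps `^ d * eps `^ (- d) * (k0^-1 * k0) * m1); last by ring.
  by rewrite e1 mulVf ?gt_eqF// !mul1r.
exact: ler_wpM2l.
Qed.

Lemma decay_bound (dl : R) : 0 < dl <= 1 -> exists2 C : R, 0 <= C &
  forall l : R, 2 / dl < l -> mass a u (scaled 0 l (shell dl 36)) <= C * l `^ (N%:R + 2).
Proof.
move=> dl01; have a1 := weight_gtN1; have dl0 : 0 < dl by case/andP: dl01.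
have [C [k0 [K [C0 k00 HK]]]] := decay_kernel (introT andP (conj s0 s1)) aE N2 dl01.
have M0 : 0 <= mass a u (upper_ball C).
  by apply: mass_ge0 => // z [z0 _]; exact: ltW.
exists (`|K| / k0 * mass a u (upper_ball C)) => [|l dll].
  by rewrite mulr_ge0// divr_ge0// ltW.
have l0 : 0 < l by apply: lt_trans dll; rewrite divr_gt0.
have t0 : 0 < l^-1 < dl / 2.
  by rewrite invr_gt0 l0 /= -[dl / 2]invrK invf_div ltf_pV2 ?posrE ?divr_gt0.
have [phi [tphi phi0 Lphi]] := HK _ t0.
have [r1 hr1] := shell_cbox 0 (C * l^-1 ^+ 2); have [r2 hr2] := shell_cbox dl 36.
pose r := Num.max r1 r2.
have cbr (t t' : R) : t <= t' -> cbox t `<=` (cbox t' : set E).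
  by move=> tt z [h1 h2]; split=> [i|]; [exact: le_trans (h1 i) tt|exact: le_trans h2 tt].
have hS : (upper_ball (C * l^-1 ^+ 2) : set E) `<=` cbox r.
  by apply: subset_trans hr1 _; apply: cbr; rewrite le_max lexx.
have hT : (shell dl 36 : set E) `<=` cbox r.
  by apply: subset_trans hr2 _; apply: cbr; rewrite le_max lexx orbT.
have := mass_comparison a1 cu Hu wu u0 tphi (fun x => (phi0 x).1) (fun x => (phi0 x).2)
  (@open_shell 0 (C * l^-1 ^+ 2)) (@open_shell dl 36)
  (@shell_half 0 (C * l^-1 ^+ 2) (lexx 0)) (@shell_half dl 36 (ltW dl0)) hS hT Lphi 0 l0.
have -> : scaled (0 : 'rV[R]_N) l (shell 0 (C * l^-1 ^+ 2)) = (upper_ball C : set E).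
  apply/seteqP; split=> z [h1 h2].
    split; first by move: h1; rewrite dil2 pmulr_rgt0 ?invr_gt0.
    move: h2; rewrite quad_ball_scaled// scaler0 addr0 mulr0 mulrCA -exprMn mulfV ?gt_eqF//.
    by rewrite expr1n mulr1.
  split; first by rewrite dil2 pmulr_rgt0 ?invr_gt0.
  rewrite quad_ball_scaled// scaler0 addr0 mulr0 mulrCA -exprMn mulfV ?gt_eqF//.
  by rewrite expr1n mulr1.
have -> : l^-1 `^ (- (N%:R + 2)) = l `^ (N%:R + 2).
  by rewrite -powR_inv1 ?(ltW l0)// -powRrM mulN1r opprK.
set m1 := mass _ _ _; set M := mass _ _ _ => h1.
have L0 : 0 <= l `^ (N%:R + 2) by exact: powR_ge0.
have h2 : k0 * m1 <= `|K| * l `^ (N%:R + 2) * M.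
  apply: le_trans h1 _; rewrite ler_wpM2r// ler_wpM2r//; exact: ler_norm.
rewrite mulrAC [_ / k0 * _]mulrAC mulrAC ler_pdivlMr//.
by rewrite mulrC.
Qed.

Lemma quad_shift (x0 : 'rV[R]_N) z :
  quad 1 0 z <= 2 * quad 1 (x0, 0) z + 2 * \sum_(i < N) x0 ord0 i ^+ 2.
Proof.
rewrite /quad /= !mul1r subr0.
have : \sum_(i < N) (z.1 ord0 i - (0 : 'rV[R]_N) ord0 i) ^+ 2 <=
  \sum_(i < N) (2 * (z.1 ord0 i - x0 ord0 i) ^+ 2 + 2 * x0 ord0 i ^+ 2).
  apply: ler_sum => i _; rewrite mxE subr0.
  have := sqr_ge0 (z.1 ord0 i - x0 ord0 i - x0 ord0 i); nra.
rewrite big_split /= -!mulr_sumr; have := sqr_ge0 z.2.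
by lra.
Qed.

(** The three bounds are chained at a scale l comparable with sqrt(1 + |x0|^2 + y0^2):
    the ball about (x0, y0)
    lies in the half ball of radius 2 y0 about (x0, 0), and the shell about x0 at scale l in
    the larger shell about the origin. *)
Lemma interior_growth : exists2 C : R, 0 <= C & forall (x0 : 'rV[R]_N) (y0 : R), 0 < y0 ->
  u (x0, y0) <= C * (1 + \sum_(i < N) x0 ord0 i ^+ 2 + y0 ^+ 2) `^ s.
Proof.
have [C1 C10 H1] := interior_bound.
have [dl [C2 [dl01 C20 H2]]] := boundary_bound.
have [C3 C30 H3] := decay_bound dl01.
have /andP[dl0 dl1] := dl01.
(* Large enough for eps < dl and 1 / l < dl / 2. *)
pose L : R := 2 / dl + 1.
have L0 : 0 < 2 / dl by rewrite divr_gt0.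
have L1 : 1 <= L by rewrite /L; lra.
have Ls0 : 0 <= L `^ (2 * s) by exact: powR_ge0.
exists (C1 * (C2 * 2 `^ d) * C3 * L `^ (2 * s)).
  by rewrite !mulr_ge0 ?powR_ge0.
move=> x0 y0 y00.
set X := \sum_(i < N) _; set Q : R := 1 + X + y0 ^+ 2.
have X0 : 0 <= X by apply: sumr_ge0 => i _; exact: sqr_ge0.
have y20 : 0 < y0 ^+ 2 by rewrite exprn_gt0.
have Q1 : 1 < Q by rewrite /Q; lra.
pose r := Num.sqrt Q.
have Q0 : 0 <= Q by lra.
have rQ : r ^+ 2 = Q by rewrite sqr_sqrtr.
have r0 : 0 <= r by exact: sqrtr_ge0.
have r1 : 1 <= r by rewrite -ler_sqr ?nnegrE// expr1n rQ ltW.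
have yr : y0 <= r by rewrite -ler_sqr ?nnegrE ?(ltW y00)// rQ /Q; lra.
pose l : R := L * r.
have l0 : 0 < l by apply: mulr_gt0; lra.
have rl : r <= l by rewrite /l ler_peMl.
have dll : 2 / dl < l.
  by apply: (@lt_le_trans _ _ L); [rewrite /L; lra|rewrite /l ler_peMr//; lra].
(* The half ball of radius eps l about (x0, 0) contains the ball about (x0, y0). *)
pose eps : R := 2 * y0 / l.
have eps0 : 0 < eps by rewrite divr_gt0// mulr_gt0.
have epsdl : eps < dl.
  rewrite /eps ltr_pdivrMr//; apply: (@le_lt_trans _ _ (2 * r)); first by rewrite ler_pM2l.
  have : dl * (2 / dl) = 2 by rewrite mulrC divfK// gt_eqF.
  have : dl * L * r = dl * l by rewrite /l mulrA.
  rewrite /L mulrDr mulr1 => <- e; rewrite e mulrDl ltrDl mulr_gt0//; lra.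
have I1 : scaled x0 y0 (unit_ball (1 / 64)) `<=` scaled x0 l (shell 0 (eps ^+ 2)).
  move=> z zb; have zq : quad 1 ey (dil x0 y0 z) < 1 / 64 := zb.
  have := unit_ball_half zb; rewrite dil2 => /andP[z1 z2]; have z0 : 0 < z.2.
    by rewrite -(pmulr_rgt0 (x := y0^-1)) ?invr_gt0//; lra.
  split; first by rewrite dil2 mulr_gt0// invr_gt0.
  rewrite quad_ball_scaled// scaler0 addr0 mulr0.
  have -> : l ^+ 2 * eps ^+ 2 = 4 * y0 ^+ 2.
    rewrite -exprMn /eps mulrCA mulfV ?gt_eqF// mulr1; ring.
  move: zq; rewrite quad_ball_scaled// scaler0 addr0 mulr1.
  rewrite /quad /= !mul1r subr0.
  move: z2; rewrite mulrC ltr_pdivrMr// => z2 zq.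
  have : z.2 ^+ 2 < 2 * y0 ^+ 2 by nra.
  have := sqr_ge0 (z.2 - y0); lra.
have I2 : scaled x0 l (shell dl 16) `<=` scaled 0 l (shell dl 36).
  move=> z [h1 h2]; split; first by move: h1; rewrite !dil2.
  move: h2; rewrite !quad_ball_scaled// !scaler0 !addr0 !mulr0 => h2.
  apply: le_lt_trans (quad_shift x0 z) _; rewrite -/X.
  have : X <= l ^+ 2.
    by apply: (@le_trans _ _ (r ^+ 2)); [rewrite rQ /Q; lra|rewrite lerXn2r// ?nnegrE// ltW].
  have : 0 < l ^+ 2 by rewrite exprn_gt0.
  lra.
have a1 := weight_gtN1.
have m1 := mass_scaled_le y00 l0 (@open_unit_ball (1 / 64)) (@open_shell 0 (eps ^+ 2))
  (shell_cbox 0 _) (@shell_half 0 _ (lexx 0)) I1.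
have m2 := mass_scaled_le l0 l0 (@open_shell dl 16) (@open_shell dl 36)
  (shell_cbox dl _) (@shell_half dl _ (ltW dl0)) I2.
have h1 := H1 x0 y0 y00.
have h2 := H2 x0 l eps l0 (introT andP (conj eps0 epsdl)).
have h3 := H3 l dll.
have yd0 : 0 < y0 `^ d by exact: powR_gt0.
have e1 : eps `^ d * l `^ (N%:R + 2) = 2 `^ d * y0 `^ d * l `^ (2 * s).
  have -> : N%:R + 2 = d + 2 * s by rewrite aE; lra.
  rewrite [l `^ (d + 2 * s)]powRD; last by rewrite (gt_eqF l0) implybT.
  rewrite mulrA -powRM ?(ltW eps0) ?(ltW l0)// /eps divfK ?gt_eqF// powRM// ltW//.
rewrite -(ler_pM2r yd0); apply: le_trans h1 _.
have step1 := le_trans m1 (le_trans h2 (ler_wpM2l (mulr_ge0 C20 (powR_ge0 _ _)) (le_trans m2 h3))).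
apply: le_trans (ler_wpM2l C10 step1) _.
have -> : C2 * eps `^ d * (C3 * l `^ (N%:R + 2)) = C2 * C3 * (2 `^ d * y0 `^ d * l `^ (2 * s)).
  by rewrite -e1; ring.
have -> : l `^ (2 * s) = L `^ (2 * s) * Q `^ s.
  rewrite /l powRM//; last lra.
  by rewrite -rQ -powR_mulrn// -powRrM.
by rewrite le_eqVlt; apply/orP; left; apply/eqP; ring.
Qed.

(** For y0 = 0 the value of u is at most twice its value at some height y < 1. *)
Lemma growth : exists2 C : R, 0 <= C & forall (x0 : 'rV[R]_N) (y0 : R), 0 <= y0 ->
  u (x0, y0) <= C * (1 + \sum_(i < N) x0 ord0 i ^+ 2 + y0 ^+ 2) `^ s.
Proof.
have [C C0 H] := interior_growth.
exists (2 * (C * 2 `^ s)) => [|x0 y0]; first by rewrite !mulr_ge0 ?powR_ge0.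
set X := \sum_(i < N) _.
have X0 : 0 <= X by apply: sumr_ge0 => i _; exact: sqr_ge0.
have base (y : R) : 0 < y -> y ^+ 2 <= y0 ^+ 2 + 1 ->
    u (x0, y) <= C * 2 `^ s * (1 + X + y0 ^+ 2) `^ s.
  move=> yp y2; apply: le_trans (H x0 y yp) _; rewrite -/X -mulrA ler_wpM2l//.
  have y00 := sqr_ge0 y0; have yy := sqr_ge0 y.
  rewrite -powRM//; last lra.
  by apply: ge0_ler_powR; rewrite ?nnegrE ?(ltW s0)//; lra.
rewrite le_eqVlt => /orP[/eqP y00|y00]; last first.
  have B := base y0 y00 _; have := B (ltac:(lra)).
  have : 0 <= C * 2 `^ s * (1 + X + y0 ^+ 2) `^ s by rewrite !mulr_ge0 ?powR_ge0.
  lra.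
have cl : closed_half_space (x0, 0) by rewrite /Defs.closed_half_space /=.
have up := u0 cl.
have : \forall z \near nbhs (x0, 0 : R), closed_half_space z -> u (x0, 0) / 2 < u z.
  have /subspace_continuousP/(_ _ cl) h := cu.
  apply: (h [set t | u (x0, 0) / 2 < t]).
  apply: open_nbhs_nbhs; split; first exact: open_gt.
  by rewrite /= ltr_pdivrMr// ltr_pMr// ltr1n.
move=> /nbhs_obox[r r0 hr].
pose y : R := Num.min (r / 2) 1.
have yp : 0 < y by rewrite lt_min ltr01 divr_gt0.
have yr : y < r by rewrite gt_min ltr_pdivrMr// ltr_pMr// ltr1n.
have y1 : y <= 1 by rewrite ge_min lexx orbT.
have : u (x0, 0) / 2 < u (x0, y).
  apply: hr; last by rewrite /Defs.closed_half_space /= ltW.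
  split=> [i|] /=; first by rewrite subrr normr0.
  by rewrite subr0 gtr0_norm.
have := base y yp _; rewrite -y00; have : y ^+ 2 <= 0 ^+ 2 + 1 by nra.
by move=> h /(_ h); lra.
Qed.

End estimate.
End growth.

Theorem theorem1p2 (R : realType) (s a : R) (N : nat)
    (u v : 'rV[R]_N * R -> R) :
  0 < s < 1 -> a = 1 - 2 * s -> (2 <= N)%N ->
  weak_solution a u v ->
  (forall z, closed_half_space z -> 0 < u z /\ 0 < v z) ->
  exists c : R, 0 < c /\
    forall (x : 'rV[R]_N) (y : R), closed_half_space (x, y) ->
      u (x, y) + v (x, y) <=
        c * (1 + \sum_(i < N) x ord0 i ^+ 2 + y ^+ 2) `^ s.
Proof.
move=> /andP[s0 s1] aE N2 [[Hu Hv] cu cv wu wv] pos.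
have [C C0 hC] := growth s0 s1 aE N2 cu Hu wu (fun z hz => (pos z hz).1).
have [D D0 hD] := growth s0 s1 aE N2 cv Hv wv (fun z hz => (pos z hz).2).
exists (C + D + 1); split=> [|x y hxy]; first by rewrite ltr_pwDr// addr_ge0.
set q := (_ `^ s); have q0 : 0 <= q by exact: powR_ge0.
by have := hC x y hxy; have := hD x y hxy; rewrite -/q !mulrDl mul1r; lra.
Qed.
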